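(* Let $s>0$ and $t\ge0$ be integers with $d=s-t>0$, and let $B_{z^t\overline{z}^s}$ be the H-Toeplitz operator on the Bergman space $L^2_a(\mathbb{D})$ with symbol $z^t\overline{z}^s$. (a) If $s\le 3d-2$, then $B^*_{z^t\overline{z}^s}$ is a direct sum of weighted shifts, each of which is $\mathcal{MID}$. (b) For any such $s>0$ and $d=s-t>0$, $B^*_{z^t\overline{z}^s}$ is a direct sum of weighted shifts, each of which is subnormal, and is therefore subnormal. In either case $B_{z^t\overline{z}^s}$ is not hyponormal.
   Context: $\mathbb{D}$ is the open unit disk and $L^2(\mathbb{D})$ has inner product $\langle f,g\rangle=\frac1\pi\int_{\mathbb{D}}f\overline{g}\,dA$, with $dA$ area measure. The Bergman space $L^2_a(\mathbb{D})$ is the closed subspace of analytic functions in $L^2(\mathbb{D})$, with orthonormal basis $e_n(z)=\sqrt{n+1}\,z^n$, $n\ge 0$; $P$ is the orthogonal projection of $L^2(\mathbb{D})$ onto $L^2_a(\mathbb{D})$. $L^2_{harm}(\mathbb{D})$ is the closed subspace of complex-valued harmonic functions in $L^2(\mathbb{D})$. The bounded linear operator $K:L^2_a(\mathbb{D})\to L^2_{harm}(\mathbb{D})$ is defined by $K(e_{2n})=e_n$ and $K(e_{2n+1})=\overline{e_{n+1}}$ for all $n\ge0$. For $\varphi\in L^\infty(\mathbb{D})$, the H-Toeplitz operator $B_\varphi:L^2_a(\mathbb{D})\to L^2_a(\mathbb{D})$ is $B_\varphi(f)=P(\varphi\cdot K(f))$, with Hilbert space adjoint $B_\varphi^*$.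 A (unilateral) weighted shift with bounded positive weight sequence $(\alpha_n)_{n\ge0}$ is an operator $W$ with $Wu_n=\alpha_n u_{n+1}$ for an orthonormal basis $(u_n)_{n\ge0}$ of its space. A weighted shift is moment infinitely divisible ($\mathcal{MID}$) if, for every real $p>0$, the weighted shift with weight sequence $(\alpha_n^p)_{n\ge0}$ is subnormal. An operator $T$ is hyponormal if $T^*T-TT^*\ge0$, and subnormal if it is the restriction of a normal operator to an invariant subspace. Direct sums are orthogonal direct sums over reducing subspaces. *)

(* Defs.v *)
From HB Require Import structures.
From mathcomp Require Import all_boot all_order all_algebra.
From mathcomp Require Import complex.
From mathcomp Require Import all_classical all_reals all_analysis.
From mathcomp Require Import measurable_realfun.
From mathcomp Require Import ring lra.

Set Implicit Arguments.
Unset Strict Implicit.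
Unset Printing Implicit Defensive.

Import Order.TTheory GRing.Theory Num.Theory.
Import numFieldNormedType.Exports ComplexField.

Local Open Scope classical_set_scope.
Local Open Scope ring_scope.
Local Open Scope complex_scope.

Section SquareIntegrable.
Variable R : realType.
Implicit Types (f g h : R[i] -> R[i]) (z : R[i]).

Local Notation plane := (measurableTypeR R * measurableTypeR R)%type.

Definition of_plane (p : plane) : R[i] := p.1 +i* p.2.

Definition disc : set plane := [set p | `|of_plane p| < 1].

Definition area : {measure set plane -> \bar R} :=
  (@lebesgue_measure R \x @lebesgue_measure R)%E.

Definition sqnorm z : R := complex.Re z ^+ 2 + complex.Im z ^+ 2.

Definition integral_disc (F : R[i] -> R[i]) : R[i] :=
  (\int[area]_(p in disc) complex.Re (F (of_plane p))) +i*
  (\int[area]_(p in disc) complex.Im (F (of_plane p))).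

(* Functions in L^2 are not identified up to null sets: only their inner
   products with other functions are used. *)
Definition square_integrable f : Prop :=
  [/\ measurable_fun disc (@complex.Re R \o f \o of_plane),
      measurable_fun disc (@complex.Im R \o f \o of_plane) &
      area.-integrable disc (EFin \o sqnorm \o f \o of_plane)].

Definition l2ip f g : R[i] :=
  (pi^-1)%:C * integral_disc (fun z => f z * (g z)^*).

Definition l2norm f : R := Num.sqrt (complex.Re (l2ip f f)).

Lemma sqnorm_ge0 z : 0 <= sqnorm z.
Proof. by rewrite addr_ge0 // sqr_ge0. Qed.

Lemma sqnormC z : (sqnorm z)%:C = `|z| ^+ 2.
Proof. exact: add_Re2_Im2. Qed.

Lemma norm_lt_sq z (r : R) : 0 <= r -> (`|z| < r%:C) = (sqnorm z < r ^+ 2).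
Proof.
move=> r0; rewrite -ltcR sqnormC rmorphXn /= ltr_pXn2r //.
by rewrite nnegrE lecR.
Qed.

Lemma discE : disc = [set p | p.1 ^+ 2 + p.2 ^+ 2 < 1].
Proof.
apply/seteqP; split=> p /=; rewrite /disc /=.
  by rewrite -[1]/(1%:C) norm_lt_sq ?ler01 // expr1n.
by move=> h; rewrite -[1]/(1%:C) norm_lt_sq ?ler01 // expr1n.
Qed.

Lemma measurable_disc : measurable disc.
Proof.
have m1 : measurable_fun [set: plane] (fun p : plane => p.1 ^+ 2 + p.2 ^+ 2).
  by apply: measurable_funD; apply: measurable_funX;
    [exact: measurable_fst|exact: measurable_snd].
rewrite discE (_ : [set p | _] = setT `&` (fun p : plane => p.1 ^+ 2 + p.2 ^+ 2) @^-1` `]-oo, 1[%classic).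
  exact: m1.
by apply/seteqP; split=> p /=; rewrite in_itv //= => -[].
Qed.

Lemma area_disc_lty : (area disc < +oo)%E.
Proof.
apply: (@le_lt_trans _ _ (area (`[-1, 1]%classic `*` `[-1, 1]%classic))).
  apply: le_measure; rewrite ?inE; [exact: measurable_disc|exact: measurableX|].
  rewrite discE => -[x y] /= h; rewrite !in_itv /= -!ler_norml.
  have hx := sqr_ge0 x; have hy := sqr_ge0 y.
  by split; rewrite -(@ler_pXn2r _ 2) ?nnegrE // real_normK ?num_real // expr1n; lra.
rewrite [X in (X < _)%E]product_measure1E //= lebesgue_measure_itv /= lte_fin.
by rewrite ifT ?(lt_trans _ (@ltr01 R)) ?ltrN10 // -EFinM ltry.
Qed.

Lemma integrable_sqnormP f : square_integrable f ->
  area.-integrable disc (fun p => (sqnorm (f (of_plane p)))%:E).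
Proof. by case. Qed.

Lemma ReM_conj (z w : R[i]) :
  complex.Re (z * w^* ) = complex.Re z * complex.Re w + complex.Im z * complex.Im w.
Proof. by case: z w => a b [c d] /=; rewrite mulrN opprK. Qed.

Lemma ImM_conj (z w : R[i]) :
  complex.Im (z * w^* ) = complex.Im z * complex.Re w - complex.Re z * complex.Im w.
Proof. by case: z w => a b [c d] /=; rewrite mulrN addrC. Qed.

Lemma prod_bound (a b c d : R) (u v : R) : u = a * c -> v = b * d ->
  `|u + v| <= (a ^+ 2 + b ^+ 2) + (c ^+ 2 + d ^+ 2).
Proof.
move=> -> ->; rewrite ler_norml; apply/andP; split.
  have := sqr_ge0 (a + c); have := sqr_ge0 (b + d).
  have := sqr_ge0 a; have := sqr_ge0 b; have := sqr_ge0 c; have := sqr_ge0 d.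
  by nra.
have := sqr_ge0 (a - c); have := sqr_ge0 (b - d).
have := sqr_ge0 a; have := sqr_ge0 b; have := sqr_ge0 c; have := sqr_ge0 d.
by nra.
Qed.

Lemma integrable_sq_bound (u : plane -> R) f g :
  square_integrable f -> square_integrable g -> measurable_fun disc u ->
  (forall p, `|u p| <= sqnorm (f (of_plane p)) + sqnorm (g (of_plane p))) ->
  area.-integrable disc (EFin \o u).
Proof.
move=> [_ _ If] [_ _ Ig] mu ub.
apply: (@le_integrable _ _ _ area disc measurable_disc _
  (EFin \o (fun p => sqnorm (f (of_plane p)) + sqnorm (g (of_plane p))))).
- exact/measurable_EFinP.
- move=> p _ /=; rewrite lee_fin (le_trans (ub p)) // ler_norm //.
- have := integrableD measurable_disc If Ig.
  by apply: eq_integrable => //; exact: measurable_disc.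
Qed.

Lemma integrable_ReM f g : square_integrable f -> square_integrable g ->
  area.-integrable disc
    (EFin \o (fun p => complex.Re (f (of_plane p) * (g (of_plane p))^* ))).
Proof.
move=> sf sg; apply: (integrable_sq_bound sf sg).
  case: sf sg => [rf mf _] [rg mg _].
  under eq_fun do rewrite ReM_conj.
  by apply: measurable_funD; apply: measurable_funM.
by move=> p; rewrite ReM_conj; apply: prod_bound.
Qed.

Lemma integrable_ImM f g : square_integrable f -> square_integrable g ->
  area.-integrable disc
    (EFin \o (fun p => complex.Im (f (of_plane p) * (g (of_plane p))^* ))).
Proof.
move=> sf sg; apply: (integrable_sq_bound sf sg).
  case: sf sg => [rf mf _] [rg mg _].
  under eq_fun do rewrite ImM_conj.
  by apply: measurable_funB; apply: measurable_funM.
move=> p; rewrite ImM_conj.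
move: (f _) (g _) => z w.
have := @prod_bound (complex.Im z) (complex.Re z) (complex.Re w) (- complex.Im w) _ _ erefl erefl.
by rewrite mulrN sqrrN [X in _ <= X + _]addrC.
Qed.

Lemma square_integrable_lin (a : R[i]) f g :
  square_integrable f -> square_integrable g -> square_integrable (a *: f + g).
Proof.
move=> sf sg; have [rf mf If] := sf; have [rg mg Ig] := sg.
have eR p : complex.Re ((a *: f + g) (of_plane p)) =
  complex.Re a * complex.Re (f (of_plane p)) -
  complex.Im a * complex.Im (f (of_plane p)) + complex.Re (g (of_plane p)).
  rewrite -[(a *: f + g) _]/(a * f (of_plane p) + g (of_plane p)).
  by move: (f _) (g _) => [? ?] [? ?]; case: (a).
have eI p : complex.Im ((a *: f + g) (of_plane p)) =
  complex.Re a * complex.Im (f (of_plane p)) +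
  complex.Im a * complex.Re (f (of_plane p)) + complex.Im (g (of_plane p)).
  rewrite -[(a *: f + g) _]/(a * f (of_plane p) + g (of_plane p)).
  by move: (f _) (g _) => [? ?] [? ?]; case: (a).
have mR : measurable_fun disc (@complex.Re R \o (a *: f + g) \o of_plane).
  rewrite [X in measurable_fun _ X](funext eR); apply: measurable_funD => //.
  by apply: measurable_funB; apply: measurable_funM.
have mI : measurable_fun disc (@complex.Im R \o (a *: f + g) \o of_plane).
  rewrite [X in measurable_fun _ X](funext eI); apply: measurable_funD => //.
  by apply: measurable_funD; apply: measurable_funM.
split => //.
pose c : R := 2 * sqnorm a + 2.
have c0 : 0 <= c by rewrite addr_ge0 // mulr_ge0 // sqnorm_ge0.
apply: (@le_integrable _ _ _ area disc measurable_disc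
  (fun p => (sqnorm ((a *: f + g) (of_plane p)))%:E)
  (fun p => (c * (sqnorm (f (of_plane p)) + sqnorm (g (of_plane p))))%:E)).
- apply/measurable_EFinP.
  by apply: measurable_funD; apply: measurable_funX.
- move=> p _; rewrite /= lee_fin ger0_norm ?sqnorm_ge0 // ger0_norm; last first.
    by rewrite mulr_ge0 // addr_ge0 // sqnorm_ge0.
  rewrite {1}/sqnorm eR eI /c /sqnorm.
  move: (complex.Re a) (complex.Im a) (f _) (g _) => x y [u v] [w t] /=.
  have := sqr_ge0 (x * u - y * v - w); have := sqr_ge0 (x * v + y * u - t).
  have := mulr_ge0 (sqr_ge0 x) (sqr_ge0 w); have := mulr_ge0 (sqr_ge0 x) (sqr_ge0 t).
  have := mulr_ge0 (sqr_ge0 y) (sqr_ge0 w); have := mulr_ge0 (sqr_ge0 y) (sqr_ge0 t).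
  have := sqr_ge0 u; have := sqr_ge0 v; have := sqr_ge0 w; have := sqr_ge0 t.
  by nra.
- have := integrableZl measurable_disc c (integrableD measurable_disc If Ig).
  by apply: eq_integrable => //; exact: measurable_disc.
Qed.

Lemma square_integrable0 : square_integrable 0.
Proof.
split; [exact: measurable_cst|exact: measurable_cst|].
have -> : EFin \o sqnorm \o 0 \o of_plane = cst 0%E :> (plane -> \bar R).
  by apply/funext => p /=; rewrite /sqnorm /= expr0n addr0.
exact: integrable0.
Qed.

Lemma l2ip_linl (h : R[i] -> R[i]) (a : R[i]) f g : square_integrable f ->
  square_integrable g -> square_integrable h ->
  l2ip (a *: f + g) h = a * l2ip f h + l2ip g h.
Proof.
move=> sf sg sh; rewrite /l2ip mulrCA -mulrDr; congr (_ * _).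
have If := integrable_ReM sf sh; have Jf := integrable_ImM sf sh.
have Ig := integrable_ReM sg sh; have Jg := integrable_ImM sg sh.
have mD := measurable_disc.
rewrite /integral_disc.
have -> : \int[area]_(p in disc) complex.Re ((a *: f + g) (of_plane p) * (h (of_plane p))^* ) =
  complex.Re a * \int[area]_(p in disc) complex.Re (f (of_plane p) * (h (of_plane p))^* )
  - complex.Im a * \int[area]_(p in disc) complex.Im (f (of_plane p) * (h (of_plane p))^* )
  + \int[area]_(p in disc) complex.Re (g (of_plane p) * (h (of_plane p))^* ).
  rewrite -!RintegralZl // -RintegralB // -?RintegralD //.
  - apply: eq_Rintegral => p _.
    rewrite -[(a *: f + g) _]/(a * f (of_plane p) + g (of_plane p)) mulrDl -mulrA.
    by move: (f _ * _) (g _ * _) => [? ?] [? ?]; case: (a).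
  - exact: (integrableB mD (integrableZl mD _ If) (integrableZl mD _ Jf)).
  - exact: (integrableZl mD _ If).
  - exact: (integrableZl mD _ Jf).
have -> : \int[area]_(p in disc) complex.Im ((a *: f + g) (of_plane p) * (h (of_plane p))^* ) =
  complex.Re a * \int[area]_(p in disc) complex.Im (f (of_plane p) * (h (of_plane p))^* )
  + complex.Im a * \int[area]_(p in disc) complex.Re (f (of_plane p) * (h (of_plane p))^* )
  + \int[area]_(p in disc) complex.Im (g (of_plane p) * (h (of_plane p))^* ).
  rewrite -!RintegralZl // -RintegralD // -?RintegralD //.
  - apply: eq_Rintegral => p _.
    rewrite -[(a *: f + g) _]/(a * f (of_plane p) + g (of_plane p)) mulrDl -mulrA.
    by move: (f _ * _) (g _ * _) => [? ?] [? ?]; case: (a).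
  - exact: (integrableD mD (integrableZl mD _ Jf) (integrableZl mD _ If)).
  - exact: (integrableZl mD _ Jf).
  - exact: (integrableZl mD _ If).
by case: a.
Qed.

Lemma l2ipC f g : square_integrable f -> square_integrable g ->
  l2ip f g = (l2ip g f)^*.
Proof.
move=> sf sg; rewrite /l2ip rmorphM /= oppr0; congr (_ * _).
rewrite /integral_disc /=; congr (_ +i* _).
  by apply: eq_Rintegral => p _; rewrite !ReM_conj; ring.
rewrite -mulN1r -RintegralZl; last exact: integrable_ImM.
  by apply: eq_Rintegral => p _; rewrite !ImM_conj; ring.
exact: measurable_disc.
Qed.

Lemma l2ip_norm f : l2ip f f =
  (pi^-1 * \int[area]_(p in disc) sqnorm (f (of_plane p)))%:C.
Proof.
rewrite /l2ip rmorphM /=; congr (_ * _); rewrite /integral_disc.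
congr (_ +i* _).
  by apply: eq_Rintegral => p _; rewrite ReM_conj /sqnorm !expr2.
under eq_Rintegral do rewrite ImM_conj mulrC subrr.
by rewrite Rintegral_cst ?mul0r //; exact: measurable_disc.
Qed.

End SquareIntegrable.
Arguments area {R}.
Arguments disc {R}.

Section Bergman.
Variable R : realType.
Local Notation plane := (measurableTypeR R * measurableTypeR R)%type.
Implicit Types (f g : R[i] -> R[i]) (z : R[i]) (n : nat).

Definition holomorphic_disc f : Prop :=
  forall z, `|z| < 1 -> derivable (f : R[i]^o -> R[i]^o) z 1.

Definition zero_off_disc f : Prop := forall z, ~~ (`|z| < 1) -> f z = 0.

(* A function on the disc is represented by its extension by 0 to R[i], so that
   equality of analytic or harmonic functions on the disc is Leibniz equality. *)
Definition bergman_pred : {pred R[i] -> R[i]} := fun f =>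
  `[< [/\ holomorphic_disc f, square_integrable f & zero_off_disc f] >].

Record bergman := Bergman {
  bergman_fun :> R[i] -> R[i];
  bergman_funP : bergman_fun \in bergman_pred }.

HB.instance Definition _ := [isSub for bergman_fun].
HB.instance Definition _ := [Choice of bergman by <:].

Lemma bergman_predP f : reflect
  [/\ holomorphic_disc f, square_integrable f & zero_off_disc f]
  (f \in bergman_pred).
Proof. exact: asboolP. Qed.

Lemma bergman_submod_closed : submod_closed bergman_pred.
Proof.
split.
  by apply/bergman_predP; split => //; exact: square_integrable0.
move=> a f g /bergman_predP[hf sf zf] /bergman_predP[hg sg zg].
apply/bergman_predP; split.
- move=> z z1; apply: derivableD; last exact: hg.
  exact: (derivableZ (k := a) (hf z z1)).
- exact: square_integrable_lin.
- move=> z z1; rewrite -[LHS]/(a * f z + g z).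
  by rewrite zf // zg // mulr0 addr0.
Qed.

HB.instance Definition _ :=
  GRing.isSubmodClosed.Build _ _ bergman_pred bergman_submod_closed.
HB.instance Definition _ := [SubChoice_isSubLmodule of bergman by <:].

Lemma bergman_holo (f : bergman) : holomorphic_disc f.
Proof. by have /bergman_predP[] := bergman_funP f. Qed.

Lemma bergman_sqint (f : bergman) : square_integrable f.
Proof. by have /bergman_predP[] := bergman_funP f. Qed.

Lemma bergman_zero (f : bergman) : zero_off_disc f.
Proof. by have /bergman_predP[] := bergman_funP f. Qed.

Definition bergman_ip (f g : bergman) : R[i] := l2ip f g.

Lemma bergman_ip_hermitian (f g : bergman) :
  bergman_ip f g = (-1) ^+ false * (bergman_ip g f)^*.
Proof. by rewrite expr0 mul1r; apply: l2ipC; exact: bergman_sqint. Qed.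

Lemma bergman_ip_bilinear :
  bilinear_for *%R (Num.conj \; *%R) bergman_ip.
Proof.
have linl h : linear_for *%R (bergman_ip ^~ h).
  by move=> a f g; apply: l2ip_linl; exact: bergman_sqint.
split; first exact: linl.
move=> h a f g /=.
rewrite bergman_ip_hermitian [bergman_ip h f]bergman_ip_hermitian.
by rewrite [bergman_ip h g]bergman_ip_hermitian !expr0 !mul1r linl rmorphD rmorphM.
Qed.

Lemma holomorphic_lower_bound f z : holomorphic_disc f -> `|z| < 1 -> f z != 0 ->
  exists d c : R, [/\ 0 < d, 0 < c &
    forall w, `|w - z| < d%:C -> `|w| < 1 /\ c <= sqnorm (f w)].
Proof.
move=> hf z1 fz0.
have := differentiable_continuous ((derivable1_diffP (f : R[i]^o -> R[i]^o) z).1 (hf z z1)).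
have e0 : 0 < `|f z| / 2 by rewrite divr_gt0 // normr_gt0.
move=> /cvgrPdist_lt /(_ _ e0) [/= d1 d10 H].
have d2 : 0 < 1 - `|z| by rewrite subr_gt0.
have posC (x : R[i]) : 0 < x -> x = (complex.Re x)%:C /\ 0 < complex.Re x.
  by case: x => x y; rewrite ltcE /= => /andP[/eqP-> ?].
have [E1 P1] := posC _ d10; have [E2 P2] := posC _ d2.
have [E3 P3] := posC _ e0.
pose m := Num.min (complex.Re d1) (complex.Re (1 - `|z|)).
have m0 : 0 < m by rewrite lt_min P1 P2.
have md1 : m%:C <= d1 by rewrite E1 lecR ge_min lexx.
have md2 : m%:C <= 1 - `|z| by rewrite [leRHS]E2 lecR ge_min lexx orbT.
exists m, (complex.Re (`|f z| / 2) ^+ 2); split=> //; first by rewrite exprn_gt0.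
move=> w hw.
have hw1 := lt_le_trans hw md1; have hw2 := lt_le_trans hw md2.
split.
  rewrite -[w](subrK z) (le_lt_trans (ler_normD _ _)) //.
  by rewrite -ltrBrDr.
have {}H := H w; rewrite /= distrC in H; have {H} := H hw1.
rewrite -lecR sqnormC rmorphXn /= -E3 => H.
rewrite ler_pXn2r ?nnegrE ?normr_ge0 ?(ltW e0) //.
have := lerB_dist (f z) (f w).
move=> /le_lt_trans /(_ H); rewrite ltrBlDr => /ltW.
by rewrite {1}[`|f z|]splitr lerD2l.
Qed.

Lemma bergman_ip_gt0 (f : bergman) : f != 0 -> 0 < bergman_ip f f.
Proof.
move=> f0; have [z fz] : exists z, f z != 0.
  apply: contrapT => nf; move/eqP: f0; apply; apply: val_inj; apply/funext => z /=.
  by apply: contrapT => /eqP h; apply: nf; exists z.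
have z1 : `|z| < 1 by apply: contraT => /bergman_zero h; rewrite h eqxx in fz.
have [d [c [d0 c0 H]]] := holomorphic_lower_bound (bergman_holo (f := f)) z1 fz.
rewrite /bergman_ip l2ip_norm ltcR mulr_gt0 ?invr_gt0 ?pi_gt0 //.
have [_ _ If] := bergman_sqint f.
pose I (x : R) : set (measurableTypeR R) := `]x - d / 2, x + d / 2[%classic.
pose Q : set plane := I (complex.Re z) `*` I (complex.Im z).
have mI x : measurable (I x) by exact: measurable_itv.
have mQ : measurable Q by exact: measurableX.
have muI x : lebesgue_measure (I x) = d%:E.
  rewrite /I lebesgue_measure_itv /= lte_fin ifT; last by lra.
  by rewrite -EFinD; congr EFin; field.
have muQ : area Q = (d * d)%:E.
  transitivity (lebesgue_measure (I (complex.Re z)) * lebesgue_measure (I (complex.Im z)))%E.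
    exact: product_measure1E.
  by rewrite !muI.
have Qin p : Q p -> `|of_plane p - z| < d%:C.
  move=> [/=]; rewrite /I /= !in_itv /= => /andP[a1 a2] /andP[b1 b2].
  rewrite norm_lt_sq ?ltW //; rewrite /sqnorm /of_plane.
  by case: z a1 a2 b1 b2 {z1 fz H Q mQ muQ} => x y /= a1 a2 b1 b2; nra.
have QD : Q `<=` @disc R by move=> p /Qin /H [].
have mD := @measurable_disc R.
have : (c%:E * area Q <= \int[area]_(p in disc) (sqnorm (f (of_plane p)))%:E)%E.
  rewrite -integral_cst //.
  apply: (@le_trans _ _ (\int[area]_(p in Q) (sqnorm (f (of_plane p)))%:E)%E).
    apply: ge0_le_integral => //.
    - by move=> *; rewrite lee_fin ltW.
    - exact: (measurable_funS mD QD (measurable_int _ If)).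
    - by move=> p /Qin /H [].
  apply: ge0_subset_integral => //; first exact: measurable_int If.
  by move=> *; rewrite lee_fin sqnorm_ge0.
rewrite muQ -EFinM => hc.
rewrite /Rintegral -lte_fin fineK; last exact: integrable_fin_num.
by apply: lt_le_trans hc; rewrite lte_fin !mulr_gt0.
Qed.

HB.instance Definition _ :=
  bilinear_isBilinear.Build R[i] bergman bergman _ *%R (Num.conj \; *%R)
    bergman_ip bergman_ip_bilinear.
HB.instance Definition _ :=
  isHermitianSesquilinear.Build R[i] bergman false Num.conj bergman_ip
    bergman_ip_hermitian.
HB.instance Definition _ :=
  isDotProduct.Build R[i] bergman bergman_ip bergman_ip_gt0.

Definition basis_fun n z : R[i] :=
  if `|z| < 1 then (Num.sqrt n.+1%:R)%:C * z ^+ n else 0.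

Lemma measurable_monomial n :
  measurable_fun [set: plane] (fun p => complex.Re (of_plane p ^+ n)) /\
  measurable_fun [set: plane] (fun p => complex.Im (of_plane p ^+ n)).
Proof.
have m1 : measurable_fun [set: plane] (fun p : plane => p.1).
  exact: measurable_fst.
have m2 : measurable_fun [set: plane] (fun p : plane => p.2).
  exact: measurable_snd.
elim: n => [|n [IR II]].
  by split; exact: measurable_cst.
split.
  rewrite [X in measurable_fun _ X](_ : _ = fun p : plane =>
    p.1 * complex.Re (of_plane p ^+ n) - p.2 * complex.Im (of_plane p ^+ n)).
    by apply: measurable_funB; apply: measurable_funM.
  by apply/funext => p; rewrite exprS; case: (_ ^+ n).
rewrite [X in measurable_fun _ X](_ : _ = fun p : plane =>
  p.1 * complex.Im (of_plane p ^+ n) + p.2 * complex.Re (of_plane p ^+ n)).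
  by apply: measurable_funD; apply: measurable_funM.
by apply/funext => p; rewrite exprS; case: (_ ^+ n).
Qed.

Lemma basis_fun_bergman n : basis_fun n \in bergman_pred.
Proof.
pose g : R[i] -> R[i] := (Num.sqrt n.+1%:R)%:C \*: (id ^+ n : R[i]^o -> R[i]^o).
have gE z : g z = (Num.sqrt n.+1%:R)%:C * z ^+ n.
  by rewrite /g /= fctE.
have eg z : `|z| < 1 -> basis_fun n z = g z by rewrite gE /basis_fun => ->.
have [mR mI] := measurable_monomial n.
apply/bergman_predP; split.
- move=> z z1; have : derivable (g : R[i]^o -> R[i]^o) z 1.
    by apply: derivableZ; apply: derivableX; exact: derivable_id.
  apply: near_eq_derivable.
  exists (1 - `|z|); first by rewrite /= subr_gt0.
  move=> w /= hw; apply/esym/eg.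
  rewrite -[w](subrK z) (le_lt_trans (ler_normD _ _)) //.
  by rewrite distrC -ltrBrDr.
- have eR : {in disc, (fun p : plane => Num.sqrt n.+1%:R * complex.Re (of_plane p ^+ n)) =1
      @complex.Re R \o basis_fun n \o @of_plane R}.
    move=> p; rewrite inE => pd; rewrite /= eg // gE.
    by case: (_ ^+ n) => x y /=; rewrite mul0r subr0.
  have eI : {in disc, (fun p : plane => Num.sqrt n.+1%:R * complex.Im (of_plane p ^+ n)) =1
      @complex.Im R \o basis_fun n \o @of_plane R}.
    move=> p; rewrite inE => pd; rewrite /= eg // gE.
    by case: (_ ^+ n) => x y /=; rewrite mul0r addr0.
  have mbR : measurable_fun disc (@complex.Re R \o basis_fun n \o @of_plane R).
    apply: (eq_measurable_fun _ eR).
    apply: (@measurable_funS _ _ _ _ setT) => //.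
    by apply: measurable_funM => //; exact: measurable_cst.
  have mbI : measurable_fun disc (@complex.Im R \o basis_fun n \o @of_plane R).
    apply: (eq_measurable_fun _ eI).
    apply: (@measurable_funS _ _ _ _ setT) => //.
    by apply: measurable_funM => //; exact: measurable_cst.
  split=> //.
  have mD := @measurable_disc R.
  apply: (@le_integrable _ _ _ area disc mD _ (EFin \o cst (n.+1%:R : R))).
  + apply/measurable_EFinP.
    by apply: measurable_funD; apply: measurable_funX.
  + move=> p pd /=; rewrite lee_fin ger0_norm ?sqnorm_ge0 // ger0_norm ?ler0n //.
    rewrite -lecR sqnormC eg // gE normrM exprMn.
    rewrite normc_def /= expr0n addr0 sqrtr_sqr ger0_norm ?sqrtr_ge0 //.
    rewrite -rmorphXn /= sqr_sqrtr ?ler0n // ler_piMr ?lecR ?ler0n //.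
    by rewrite normrX -exprM exprn_ile1 // ltW.
  + apply: measurable_bounded_integrable => //; first exact: area_disc_lty.
    exact: bounded_cst.
- by move=> z z1; rewrite /basis_fun (negbTE z1).
Qed.

Definition basis n : bergman := Bergman (basis_fun_bergman n).

End Bergman.

(* Inner product spaces are pairs of an lmodType over R[i] and a form
   {dot H for Num.conj}, linear in the first and conjugate-linear in the second
   argument; a Hilbert space is such a pair satisfying ip_complete. *)
Section InnerProductSpace.
Variables (R : realType) (H : lmodType R[i]) (ip : {dot H for Num.conj}).
Implicit Types (S A : set H) (T W : H -> H) (u : nat -> H) (w : nat -> R).

Definition ipnorm (x : H) : R := Num.sqrt (complex.Re (ip x x)).

Definition ip_cvg u (l : H) : Prop :=
  (fun n => ipnorm (u n - l)) @ \oo --> (0 : R).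

Definition ip_complete : Prop := forall u,
  (forall e : R, 0 < e -> exists N : nat, forall m n,
     (N <= m)%N -> (N <= n)%N -> ipnorm (u m - u n) < e) ->
  exists l, ip_cvg u l.

Definition bounded_operator T : Prop :=
  linear T /\ exists M : R, forall x, ipnorm (T x) <= M * ipnorm x.

Definition adjoint T Ts : Prop := forall x y, ip (T x) y = ip x (Ts y).

(* In the next definitions Ts stands for the adjoint of T. *)
Definition hyponormal T Ts : Prop :=
  forall x, 0 <= ip (Ts (T x) - T (Ts x)) x.

Definition normal_operator T : Prop := bounded_operator T /\
  exists Ts, adjoint T Ts /\ forall x, Ts (T x) = T (Ts x).

Definition linear_span A : set H :=
  [set x | exists n (c : 'I_n -> R[i]) (v : 'I_n -> H),
     (forall i, A (v i)) /\ x = \sum_(i < n) c i *: v i].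

Definition closed_span A : set H :=
  [set x | exists u, (forall n, linear_span A (u n)) /\ ip_cvg u x].

Definition closed_subspace S : Prop :=
  [/\ S 0, forall a x y, S x -> S y -> S (a *: x + y) &
      forall u l, (forall n, S (u n)) -> ip_cvg u l -> S l].

Definition reducing T Ts S : Prop :=
  [/\ closed_subspace S, forall x, S x -> S (T x) & forall x, S x -> S (Ts x)].

Definition orthonormal_basis S u : Prop :=
  (forall m n, ip (u m) (u n) = (m == n)%:R) /\ S = closed_span (range u).

(* The restriction of W to S is the weighted shift with weights w relative to
   the orthonormal basis u of S. *)
Definition weighted_shift_in S W u w : Prop :=
  [/\ bounded_operator W,
      (forall n, 0 < w n) /\ (exists M, forall n, w n <= M),
      orthonormal_basis S u &
      forall n, W (u n) = (w n)%:C *: u n.+1].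

Definition weighted_shift S W : Prop := exists u w, weighted_shift_in S W u w.

(* P holds for the restriction of T to each summand. *)
Definition direct_sum_of T Ts (P : set H -> Prop) : Prop :=
  exists (I : Type) (S : I -> set H),
    [/\ forall i, reducing T Ts (S i),
        forall i j, i <> j -> forall x y, S i x -> S j y -> ip x y = 0,
        closed_span (\bigcup_i S i) = setT &
        forall i, P (S i)].

End InnerProductSpace.

(* The restriction of T to the invariant subspace S is subnormal: V embeds S
   isometrically in the Hilbert space L, where it is intertwined with the
   restriction of the normal operator N to the invariant subspace V @` S. *)
Definition subnormal_in (R : realType) (H : lmodType R[i])
    (ip : {dot H for Num.conj}) (S : set H) (T : H -> H) : Prop :=
  exists (L : lmodType R[i]) (ipL : {dot L for Num.conj})
      (N : L -> L) (V : H -> L),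
    [/\ ip_complete ipL, normal_operator ipL N,
        forall a x y, S x -> S y -> V (a *: x + y) = a *: V x + V y,
        forall x y, S x -> S y -> ipL (V x) (V y) = ip x y &
        forall x, S x -> S (T x) /\ V (T x) = N (V x)].

Definition subnormal (R : realType) (H : lmodType R[i])
    (ip : {dot H for Num.conj}) (T : H -> H) : Prop :=
  subnormal_in ip setT T.

(* Weighted shifts with equal weights are unitarily equivalent, so quantifying
   over all of them is the same as considering one. *)
Definition subnormal_weights (R : realType) (w : nat -> R) : Prop :=
  forall (H : lmodType R[i]) (ip : {dot H for Num.conj}) (W : H -> H) u,
    ip_complete ip -> weighted_shift_in ip setT W u w -> subnormal ip W.

Definition MID_shift (R : realType) (H : lmodType R[i])
    (ip : {dot H for Num.conj}) (S : set H) (W : H -> H) : Prop :=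
  exists u w, weighted_shift_in ip S W u w /\
    forall p : R, 0 < p -> subnormal_weights (fun n => w n `^ p).

Section HToeplitz.
Variable R : realType.

(* Quantifying over all pairs of directions v, w makes U twice continuously
   differentiable. *)
Definition harmonic_disc_real (U : R^o * R^o -> R^o) : Prop :=
  (forall p v w, @disc R p ->
     [/\ derivable U p v, derivable ('D_v U) p w &
         {for p, continuous ('D_w ('D_v U))}]) /\
  (forall p, @disc R p ->
     'D_(1, 0) ('D_(1, 0) U) p + 'D_(0, 1) ('D_(0, 1) U) p = 0).

Definition harmonic_disc (f : R[i] -> R[i]) : Prop :=
  harmonic_disc_real (@complex.Re R \o f \o @of_plane R) /\
  harmonic_disc_real (@complex.Im R \o f \o @of_plane R).

Definition L2harm : set (R[i] -> R[i]) :=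
  [set f | [/\ harmonic_disc f, square_integrable f & zero_off_disc f]].

(* The values of P outside L^2 are irrelevant. *)
Definition bergman_projection (P : (R[i] -> R[i]) -> bergman R) : Prop :=
  forall f, square_integrable f ->
    forall g : bergman R, l2ip (f \- P f) g = 0.

Definition HToeplitz_K (K : bergman R -> (R[i] -> R[i])) : Prop :=
  [/\ linear K /\ (forall f, L2harm (K f)),
      exists M : R, forall f, l2norm (K f) <= M * l2norm f,
      forall n, K (basis R n.*2) = basis R n &
      forall n, K (basis R n.*2.+1) = (fun z => (basis R n.+1 z)^* )].

Definition HToeplitz P K (phi : R[i] -> R[i]) (f : bergman R) : bergman R :=
  P (fun z => phi z * K f z).

End HToeplitz.

(* Main.v *)
(** Since B maps e_(2(m+d)) to c_m e_m and kills the other basis vectors, the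
    adjoint maps e_m to c_m e_(2(m+d)) with
    c_m^2 = (m+1)(m+d+1)/(m+s+1)^2, and the orbits of m |-> 2(m+d) split it into
    weighted shifts. Put y = 1/(m+2d): the map on indices becomes y |-> y/2, and
    c_m^2 = (1-Ay)(1-By)/(1-Cy)^2 with A = 2d-1, B = d-1, C = 2d-s-1. If a power
    series G with nonnegative coefficients satisfies G(y/2) = c(y)^(2p) G(y), then
    the weights nu_m(n) = g_n y^n / G(y) are probability distributions with
    c_m^(2p) nu_(2(m+d))(n) = 2^(-n) nu_m(n); placing e_m at sqrt(nu_m) in an l^2
    space turns the p-th power of the shift into the restriction of a normal
    operator (a permutation of fibres times multiplication by 2^(-n/2)).
    For p = 1 the series is the product of the solutions of
    (1-Cy) G(y/2) = (1-Ay) G(y) and of the same equation with B in place of A.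
    For arbitrary p > 0 it is exp(p L), where L has the Taylor coefficients
    (A^n + B^n - 2 C^n) / (n (1 - 2^(-n))); they are nonnegative when |C| <= B,
    that is, when s <= 3d-2.
    Completeness of the basis e_n rests on Cauchy's formula for functions that are
    merely complex differentiable, obtained by bisection in polar-like
    coordinates, and on the moments of z^a zbar^b over discs. *)
Require Import Defs.
From HB Require Import structures.
From mathcomp Require Import all_boot all_order all_algebra.
From mathcomp Require Import complex.
From mathcomp Require Import all_classical all_reals all_analysis.
From mathcomp Require Import measurable_realfun.
From mathcomp Require Import zify ring lra.

Set Implicit Arguments.
Unset Strict Implicit.
Unset Printing Implicit Defensive.

Import Order.TTheory GRing.Theory Num.Theory.
Import numFieldNormedType.Exports ComplexField.

Local Open Scope classical_set_scope.
Local Open Scope ring_scope.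
Local Open Scope complex_scope.

(** * Complex modulus *)

(** The map m |-> 2(m+d) fixes -2d, so m + 2d doubles at each step: hence the variable y = 1/(m+2d).
    Normalised by G(0) = 1 and continuous at 0, the solution of G(y/2) = c(y)^(2p) G(y) is the
    product over k of c(y/2^k)^(-2p), so the k-th moment of the p-th power started at e_m is
    G(y/2^k)/G(y), the sum over n of nu_m(n) 2^(-kn). Thus nu_m is the Berger measure, the mass
    nu_m(n) sitting at 2^(-n), and everything depends on the signs of the coefficients of G. For p =
    1 the recursions multiply by A - C 2^(-n) and B - C 2^(-n), nonnegative for every C <= B; a real
    power cannot be taken inside these recursions, so the sign is then read on the logarithm, a
    stronger demand. Neither linearity nor continuity of the adjoint is given: both follow from its
    values on the basis and from adjointness. Hyponormality fails at e_0, which no index reaches: B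
    kills it and the adjoint does not. *)

Section ComplexAbs.
Variable R : realType.
Implicit Types (z w : R[i]) (x y : R).

(** The norm of [R[i]] takes its values in [R[i]]; estimates are made with its real part, an element
    of the ordered field [R]. *)
Definition cabs z : R := complex.Re `|z|.

Lemma cabsE z : `|z| = (cabs z)%:C.
Proof. by rewrite /cabs normc_def. Qed.

Lemma cabs_ge0 z : 0 <= cabs z.
Proof. by rewrite -lecR -cabsE normr_ge0. Qed.

Lemma sqnormE z : sqnorm z = cabs z ^+ 2.
Proof. by apply: (@complexI R); rewrite sqnormC cabsE rmorphXn. Qed.

Lemma cabsD z w : cabs (z + w) <= cabs z + cabs w.
Proof. by rewrite -lecR rmorphD /= -!cabsE ler_normD. Qed.

Lemma cabsN z : cabs (- z) = cabs z.
Proof. by rewrite /cabs normrN. Qed.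

Lemma cabsB z w : cabs (z - w) <= cabs z + cabs w.
Proof. by rewrite (le_trans (cabsD _ _)) ?cabsN. Qed.

Lemma cabsBC z w : cabs (z - w) = cabs (w - z).
Proof. by rewrite -cabsN opprB. Qed.

Lemma cabsM z w : cabs (z * w) = cabs z * cabs w.
Proof. by apply: (@complexI R); rewrite rmorphM /= -!cabsE normrM. Qed.

Lemma cabsX z n : cabs (z ^+ n) = cabs z ^+ n.
Proof. by apply: (@complexI R); rewrite rmorphXn /= -!cabsE normrX. Qed.

Lemma cabsR x : cabs x%:C = `|x|.
Proof. by apply: (@complexI R); rewrite -cabsE normc_def /= expr0n addr0 sqrtr_sqr. Qed.

Lemma cabs0 : cabs 0 = 0.
Proof. by rewrite -[0]/(0%:C) cabsR normr0. Qed.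

Lemma cabs1 : cabs 1 = 1.
Proof. by rewrite -[1 in LHS]/(1%:C) cabsR normr1. Qed.

Lemma cabsV z : cabs z^-1 = (cabs z)^-1.
Proof. by apply: (@complexI R); rewrite -cabsE normfV cabsE fmorphV. Qed.

Lemma cabs_eq0 z : (cabs z == 0) = (z == 0).
Proof. by rewrite -(inj_eq (@complexI R)) -cabsE normr_eq0. Qed.

Lemma cabs_gt0 z : (0 < cabs z) = (z != 0).
Proof. by rewrite lt_def cabs_ge0 andbT cabs_eq0. Qed.

Lemma cabs_conj z : cabs z^* = cabs z.
Proof. by rewrite /cabs normcJ. Qed.

Lemma cabsi : cabs ('i : R[i]) = 1.
Proof. by apply: (@complexI R); rewrite -cabsE normc_def /= expr0n expr1n add0r sqrtr1. Qed.

Lemma ler_Re_cabs z : `|complex.Re z| <= cabs z.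
Proof. by rewrite -lecR -cabsE normc_ge_Re. Qed.

Lemma ler_Im_cabs z : `|complex.Im z| <= cabs z.
Proof.
by rewrite -[cabs z]mul1r -cabsi -cabsM (le_trans _ (ler_Re_cabs _)) //;
  case: z => a b /=; rewrite mul0r mul1r add0r normrN.
Qed.

Lemma cabs_le z : cabs z <= `|complex.Re z| + `|complex.Im z|.
Proof.
rewrite {1}[z]complexE (le_trans (cabsD _ _)) // cabsM !cabsR.
by rewrite -['i%C]/('i : R[i]) cabsi mul1r.
Qed.

Lemma lt_norm_cabs z x : (`|z| < x%:C) = (cabs z < x).
Proof. by rewrite cabsE ltcR. Qed.

End ComplexAbs.

(** * Goursat's bisection for additive functions of rectangles *)

Section Bisection.
Variables (R : realType) (I : R -> R -> R -> R -> R[i]) (a b c d : R).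
Hypotheses (ab : a < b) (cd : c < d).
Hypothesis addx : forall x1 x2 x3 y1 y2, a <= x1 -> x1 < x2 -> x2 < x3 ->
  x3 <= b -> c <= y1 -> y1 < y2 -> y2 <= d ->
  I x1 x3 y1 y2 = I x1 x2 y1 y2 + I x2 x3 y1 y2.
Hypothesis addy : forall x1 x2 y1 y2 y3, a <= x1 -> x1 < x2 ->
  x2 <= b -> c <= y1 -> y1 < y2 -> y2 < y3 -> y3 <= d ->
  I x1 x2 y1 y3 = I x1 x2 y1 y2 + I x1 x2 y2 y3.
Hypothesis loc : forall x y e, a <= x <= b -> c <= y <= d -> 0 < e ->
  exists2 del, 0 < del & forall x1 x2 y1 y2,
    a <= x1 <= x -> x <= x2 <= b -> c <= y1 <= y -> y <= y2 <= d ->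
    x1 < x2 -> y1 < y2 -> x2 - x1 < del -> y2 - y1 < del ->
    cabs (I x1 x2 y1 y2) <= e * ((x2 - x1) + (y2 - y1)) ^+ 2.

Let h n := (b - a) / 2 ^+ n.
Let k n := (d - c) / 2 ^+ n.
Let J n (p : R * R) := cabs (I p.1 (p.1 + h n) p.2 (p.2 + k n)).
Let good n (p : R * R) := [/\ a <= p.1, p.1 + h n <= b, c <= p.2 & p.2 + k n <= d].

Let h2 n : h n = h n.+1 + h n.+1.
Proof. by rewrite /h exprS; field; rewrite expf_neq0. Qed.

Let k2 n : k n = k n.+1 + k n.+1.
Proof. by rewrite /k exprS; field; rewrite expf_neq0. Qed.

Let h_gt0 n : 0 < h n.
Proof. by rewrite divr_gt0 ?exprn_gt0 // subr_gt0. Qed.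

Let k_gt0 n : 0 < k n.
Proof. by rewrite divr_gt0 ?exprn_gt0 // subr_gt0. Qed.

(** By additivity the value on a rectangle is the sum of the values on its four quarters, so one
    quarter carries at least a fourth of the modulus. *)
Let step n p : good n p -> exists q, [/\ good n.+1 q,
   p.1 <= q.1, q.1 + h n.+1 <= p.1 + h n, p.2 <= q.2 &
   q.2 + k n.+1 <= p.2 + k n] /\ J n p <= 4 * J n.+1 q.
Proof.
move=> [/=]; set x := p.1; set y := p.2 => ax xb cy yd.
have hn := h_gt0 n.+1; have kn := k_gt0 n.+1.
have eh := h2 n; have ek := k2 n; set hh := h n.+1 in eh hn *; set kk := k n.+1 in ek kn *.
apply: contrapT => H.
have {}H q1 q2 : (q1 = x \/ q1 = x + hh) -> (q2 = y \/ q2 = y + kk) ->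
  4 * J n.+1 (q1, q2) < J n p.
  move=> E1 E2; rewrite ltNge; apply/negP => hJ; apply: H; exists (q1, q2).
  by rewrite /good /= -/hh -/kk; split => //; case: E1 => ->; case: E2 => ->; repeat split; lra.
have H1 := H x y (or_introl erefl) (or_introl erefl).
have H2 := H _ y (or_intror erefl) (or_introl erefl).
have H3 := H x _ (or_introl erefl) (or_intror erefl).
have H4 := H _ _ (or_intror erefl) (or_intror erefl).
move: H1 H2 H3 H4; rewrite /J /= -/hh -/kk -/x -/y eh ek !addrA.
have [l1 l2 l3 l4] : [/\ x < x + hh, x + hh < x + hh + hh, y < y + kk & y + kk < y + kk + kk].
  by rewrite !ltrDl.
have l5 : x + hh + hh <= b by rewrite -addrA -eh.
have l6 : y + kk + kk <= d by rewrite -addrA -ek.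
have l7 := ltW (lt_le_trans l2 l5); have l8 := ltW (lt_le_trans l4 l6).
have l9 := le_trans ax (ltW l1).
rewrite (addx ax l1 l2 l5 cy (lt_trans l3 l4) l6).
rewrite (addy ax l1 l7 cy l3 l4 l6) (addy l9 l2 l5 cy l3 l4 l6).
clear -R.
set A := I _ _ _ _; set B := I _ _ _ _; set C := I _ _ _ _; set D := I _ _ _ _.
have := cabsD (A + B) (C + D); have := cabsD A B; have := cabsD C D.
by lra.
Qed.

(** Rectangles chosen by [step] shrink to a point, where [loc] makes [J n] small compared with the
    square of the side lengths, that is with 4^(-n). This beats the factor 4^n lost in n
    bisections. *)
Lemma bisection_eq0 : I a b c d = 0.
Proof.
have [next nextP] : {next : nat -> R * R -> R * R | forall n p, good n p ->
  [/\ good n.+1 (next n p),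
   p.1 <= (next n p).1, (next n p).1 + h n.+1 <= p.1 + h n, p.2 <= (next n p).2 &
   (next n p).2 + k n.+1 <= p.2 + k n] /\ J n p <= 4 * J n.+1 (next n p)}.
  apply: constructive_indefinite_description.
  have := @choice (nat * (R * R)) (R * R) (fun np q => good np.1 np.2 ->
   [/\ good np.1.+1 q, np.2.1 <= q.1, q.1 + h np.1.+1 <= np.2.1 + h np.1,
     np.2.2 <= q.2 & q.2 + k np.1.+1 <= np.2.2 + k np.1] /\
     J np.1 np.2 <= 4 * J np.1.+1 q).
  case.
    move=> [n p] /=; have [/step[q Hq]|ng] := pselect (good n p); first by exists q.
    by exists p.
  by move=> f Hf; exists (fun n p => f (n, p)) => n p; exact: (Hf (n, p)).
pose fix s n := if n is m.+1 then next m (s m) else (a, c).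
have gs n : good n (s n).
  elim: n => [|n /nextP[[]//]].
  by rewrite /good /h /k /= expr0 !divr1 !subrKC.
have sP n := (nextP _ _ (gs n)).1.
have mono m n : (m <= n)%N -> [/\ (s m).1 <= (s n).1,
  (s n).1 + h n <= (s m).1 + h m, (s m).2 <= (s n).2 &
  (s n).2 + k n <= (s m).2 + k m].
  elim: n => [|n IH]; first by rewrite leqn0 => /eqP ->.
  rewrite leq_eqVlt => /predU1P[->//|]; rewrite ltnS => /IH[? ? ? ?].
  by case: (sP n) => _ /= ? ? ? ?; split; lra.
have JP n : J 0 (a, c) <= 4 ^+ n * J n (s n).
  elim: n => [|n IH]; first by rewrite expr0 mul1r.
  have := (nextP _ _ (gs n)).2; rewrite exprSr -mulrA => le4.
  by rewrite (le_trans IH) // ler_pM2l // exprn_gt0.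
(* The suprema of the lower left corners give a point common to all the nested rectangles. *)
pose X := sup (range (fun n => (s n).1)); pose Y := sup (range (fun n => (s n).2)).
have crossx m n : (s m).1 <= (s n).1 + h n.
  have [/mono[? ? _ _]|/ltnW /mono[? ? _ _]] := leqP m n.
    by have := h_gt0 n; lra.
  by have := h_gt0 m; lra.
have crossy m n : (s m).2 <= (s n).2 + k n.
  have [/mono[_ _ ? ?]|/ltnW /mono[_ _ ? ?]] := leqP m n.
    by have := k_gt0 n; lra.
  by have := k_gt0 m; lra.
have Xl n : (s n).1 <= X.
  by apply: ub_le_sup; [exists ((s 0).1 + h 0) => _ [m _ <-]|exists n].
have Xu n : X <= (s n).1 + h n.
  by apply: ge_sup; [exists (s 0).1, 0|move=> _ [m _ <-]].
have Yl n : (s n).2 <= Y.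
  by apply: ub_le_sup; [exists ((s 0).2 + k 0) => _ [m _ <-]|exists n].
have Yu n : Y <= (s n).2 + k n.
  by apply: ge_sup; [exists (s 0).2, 0|move=> _ [m _ <-]].
have Xab : a <= X <= b.
  by have := Xl 0; have := Xu 0; have [] := gs 0 => /= *; apply/andP; split; lra.
have Ycd : c <= Y <= d.
  by have := Yl 0; have := Yu 0; have [] := gs 0 => /= *; apply/andP; split; lra.
have J0 : J 0 (a, c) = cabs (I a b c d).
  by rewrite /J /h /k /= expr0 !divr1 !subrKC.
apply/eqP; rewrite -cabs_eq0 eq_le cabs_ge0 andbT -J0.
(* [4 ^+ n * (h n + k n) ^+ 2] equals [S] for every n, so [loc] applied with [e / S] bounds [J 0] by
   exactly [e]. *)
pose S := ((b - a) + (d - c)) ^+ 2.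
have S_gt0 : 0 < S by rewrite exprn_gt0 // addr_gt0 ?subr_gt0.
apply/ler_addgt0Pl => e e0; rewrite addr0.
have [del del0 Hd] := loc Xab Ycd (divr_gt0 e0 S_gt0).
have [n [hn kn]] : exists n, h n < del /\ k n < del.
  have small (l : R) : 0 < l -> exists N, forall n, (N <= n)%N -> l / 2 ^+ n < del.
    move=> l0.
    have : (fun n => l * 2^-1 ^+ n) @ \oo --> (l * 0 : R).
      apply: cvgM; first exact: cvg_cst.
      by apply: cvg_expr; rewrite ger0_norm; lra.
    rewrite mulr0 => /cvgrPdist_lt /(_ _ del0) [N _ HN]; exists N => n Nn.
    have := HN n Nn; rewrite /= sub0r normrN ger0_norm ?exprVn //.
    by rewrite ltW // divr_gt0 // exprn_gt0.
  have /small[N1 H1] : 0 < b - a by rewrite subr_gt0.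
  have /small[N2 H2] : 0 < d - c by rewrite subr_gt0.
  by exists (maxn N1 N2); split; [apply: H1; exact: leq_maxl|apply: H2; exact: leq_maxr].
have [g1 g2 g3 g4] := gs n; have hn0 := h_gt0 n; have kn0 := k_gt0 n.
have := Hd (s n).1 ((s n).1 + h n) (s n).2 ((s n).2 + k n).
rewrite !ltrDl Xl Xu Yl Yu g1 g2 g3 g4 hn0 kn0 ![_ + h n - _]addrAC ![_ + k n - _]addrAC !subrr !add0r.
move=> /(_ isT isT isT isT isT isT hn kn) HJ.
apply: (le_trans (JP n)); apply: (@le_trans _ _ (4 ^+ n * (e / S * (h n + k n) ^+ 2))).
  by rewrite ler_pM2l ?exprn_gt0.
rewrite le_eqVlt; apply/orP; left; apply/eqP.
rewrite /h /k -mulrDl exprMn -/S exprVn -exprM mulnC exprM.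
have -> : (2 : R) ^+ 2 = 4 by rewrite -natrX.
by field; rewrite ?gt_eqF // exprn_gt0.
Qed.

End Bisection.

(** * Calculus along complex curves *)

Section ComplexCurves.
Variable R : realType.
Implicit Types (F G : R -> R[i]) (x y : R).

(** Curves are handled through their real and imaginary parts, to which the real theorems on limits,
    derivatives and integrals apply; [cder] and [cint] follow the same pattern. *)
Definition ccts F x : Prop :=
  {for x, continuous (fun t => complex.Re (F t) : R)} /\
  {for x, continuous (fun t => complex.Im (F t) : R)}.

Lemma cctsP F x : ccts F x <-> forall e : R, 0 < e -> exists2 d : R, 0 < d &
  forall t, `|t - x| < d -> cabs (F t - F x) < e.
Proof.
split.
  move=> [cR cI] e e0; have e20 : 0 < e / 2 by lra.
  move/cvgrPdist_lt/(_ _ e20): cR => [d1 /= d10 H1].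
  move/cvgrPdist_lt/(_ _ e20): cI => [d2 /= d20 H2].
  exists (Num.min d1 d2); first by rewrite lt_min d10.
  move=> t; rewrite lt_min distrC => /andP[/H1 {}H1 /H2 {}H2].
  rewrite cabsBC (le_lt_trans (cabs_le _)) //.
  rewrite /= in H1 H2; case: (F x) (F t) H1 H2 => [? ?] [? ?] /= H1 H2.
  lra.
move=> H; split; apply/cvgrPdist_lt => e e0; have [d d0 {}H] := H e e0;
  exists d => //= t xt; have := H t; rewrite distrC => /(_ xt);
  rewrite cabsBC => h; apply: le_lt_trans h.
  by rewrite (le_trans _ (ler_Re_cabs _)) //; case: (F x) (F t) => [? ?] [? ?].
by rewrite (le_trans _ (ler_Im_cabs _)) //; case: (F x) (F t) => [? ?] [? ?].
Qed.

Lemma ccts_cst (z : R[i]) x : ccts (fun=> z) x.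
Proof. by split; exact: cvg_cst. Qed.

Lemma cctsR (f : R -> R) x : {for x, continuous f} -> ccts (fun t => (f t)%:C) x.
Proof. by move=> cf; split; [exact: cf|exact: cvg_cst]. Qed.

Lemma cctsD F G x : ccts F x -> ccts G x -> ccts (fun t => F t + G t) x.
Proof.
move=> [a b] [c d]; split.
  rewrite (_ : (fun t => _) = (fun t => complex.Re (F t) + complex.Re (G t))); last first.
    by apply/funext => t; case: (F t) (G t) => [? ?] [? ?].
  exact: (cvgD a c).
rewrite (_ : (fun t => _) = (fun t => complex.Im (F t) + complex.Im (G t))); last first.
  by apply/funext => t; case: (F t) (G t) => [? ?] [? ?].
exact: (cvgD b d).
Qed.

Lemma cctsM F G x : ccts F x -> ccts G x -> ccts (fun t => F t * G t) x.
Proof.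
move=> [a b] [c d]; split.
  rewrite (_ : (fun t => _) = (fun t => complex.Re (F t) * complex.Re (G t)
     - complex.Im (F t) * complex.Im (G t))); last first.
    by apply/funext => t; case: (F t) (G t) => [? ?] [? ?].
  exact: (cvgB (cvgM a c) (cvgM b d)).
rewrite (_ : (fun t => _) = (fun t => complex.Re (F t) * complex.Im (G t)
     + complex.Im (F t) * complex.Re (G t))); last first.
  by apply/funext => t; case: (F t) (G t) => [? ?] [? ?].
exact: (cvgD (cvgM a d) (cvgM b c)).
Qed.

Lemma cctsN F x : ccts F x -> ccts (fun t => - F t) x.
Proof.
move=> /(cctsM (ccts_cst (-1) x)); congr ccts.
by apply/funext => t; rewrite mulN1r.
Qed.

Lemma cctsB F G x : ccts F x -> ccts G x -> ccts (fun t => F t - G t) x.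
Proof. by move=> cF cG; apply: cctsD => //; exact: cctsN. Qed.

Lemma cctsX F n x : ccts F x -> ccts (fun t => F t ^+ n) x.
Proof.
move=> cF; elim: n => [|n IH]; first exact: ccts_cst.
by under eq_fun do rewrite exprS; exact: cctsM.
Qed.

Lemma ccts_conj F x : ccts F x -> ccts (fun t => (F t)^*) x.
Proof.
move=> [a b]; split.
  rewrite (_ : (fun t => _) = (fun t => complex.Re (F t))) //.
  by apply/funext => t; case: (F t).
rewrite (_ : (fun t => _) = (fun t => - complex.Im (F t))); first exact: cvgN.
by apply/funext => t; case: (F t).
Qed.

Lemma cctsV F x : ccts F x -> F x != 0 -> ccts (fun t => (F t)^-1) x.
Proof.
move=> [cR cI] Fx0.
pose n t := (complex.Re (F t) ^+ 2 + complex.Im (F t) ^+ 2)^-1.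
rewrite (_ : (fun t => _) = (fun t => (F t)^* * (n t)%:C)).
  apply: cctsM; first exact: ccts_conj.
  apply: cctsR; apply: cvgV.
    by rewrite -/(sqnorm (F x)) sqnormE sqrf_eq0 cabs_eq0.
  by apply: cvgD; rewrite !expr2; apply: cvgM.
apply/funext => t; rewrite /n; case: (F t) => a b /=.
by apply/eqP; rewrite eq_complex /=; apply/andP; split; apply/eqP; ring.
Qed.

(** Complex differentiability as a first-order expansion with real epsilon and delta, the form in
    which the bisection argument uses it. *)
Lemma derivable_linear_approx (f : R[i] -> R[i]) z :
  derivable (f : R[i]^o -> R[i]^o) z 1 -> exists l, forall e : R, 0 < e ->
  exists2 d : R, 0 < d & forall w, cabs (w - z) < d ->
    cabs (f w - f z - l * (w - z)) <= e * cabs (w - z).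
Proof.
move=> /cvg_ex[/= l Hl]; exists l => e e0.
have eC0 : 0 < e%:C by rewrite ltcR.
move/cvgrPdist_lt/(_ _ eC0): Hl => [d /= d0 H].
have dE : d = (complex.Re d)%:C.
  by move: d0; rewrite ltcE /= => /andP[/eqP h _]; case: (d) h => a b /= ->.
exists (complex.Re d); first by rewrite -ltcR -dE.
move=> w; have [->|wz hw] := eqVneq w z.
  by rewrite !subrr mulr0 subr0 cabs0 mulr0.
have wz0 : w - z != 0 by rewrite subr_eq0.
have := H (w - z); rewrite /= sub0r normrN dE lt_norm_cabs => /(_ hw wz0).
rewrite [(w - z) *: 1](_ : _ = w - z); last exact: mulr1.
rewrite subrK lt_norm_cabs => {}H.
have -> : f w - f z - l * (w - z) = - ((l - (w - z)^-1 * (f w - f z)) * (w - z)).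
  by rewrite mulrBl mulrAC mulVf // mul1r opprB.
rewrite cabsN cabsM ler_pM2r ?cabs_gt0 //; exact: ltW.
Qed.

Lemma derivable_lipschitz (f : R[i] -> R[i]) z :
  derivable (f : R[i]^o -> R[i]^o) z 1 -> exists L d : R, [/\ 0 < L, 0 < d &
    forall w, cabs (w - z) < d -> cabs (f w - f z) <= L * cabs (w - z)].
Proof.
move=> /derivable_linear_approx[l /(_ 1 ltr01)[d d0 H]].
exists (1 + cabs l), d; split=> //; first by have := cabs_ge0 l; lra.
move=> w /H {}H; rewrite -[f w - f z](subrK (l * (w - z))).
by rewrite (le_trans (cabsD _ _)) // mulrDl lerD // cabsM.
Qed.

Lemma ccts_comp_derivable (f : R[i] -> R[i]) F x :
  derivable (f : R[i]^o -> R[i]^o) (F x) 1 -> ccts F x -> ccts (fun t => f (F t)) x.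
Proof.
move=> /derivable_lipschitz[L [d [L0 d0 H]]] /cctsP cF; apply/cctsP => e e0.
have m0 : 0 < Num.min d (e / L) by rewrite lt_min d0 divr_gt0.
have [d' d'0 {}cF] := cF _ m0; exists d' => // t /cF.
rewrite lt_min => /andP[/H le1 lt2]; rewrite (le_lt_trans le1) //.
by rewrite mulrC -ltr_pdivlMr.
Qed.

Definition cder F x (l : R[i]) : Prop :=
  is_derive x 1 (fun t => complex.Re (F t) : R) (complex.Re l) /\
  is_derive x 1 (fun t => complex.Im (F t) : R) (complex.Im l).

Lemma cder_ccts F x l : cder F x l -> ccts F x.
Proof.
by move=> [[d1 _] [d2 _]]; split; apply/differentiable_continuous; apply/derivable1_diffP.
Qed.

Lemma cder_cst z x : cder (fun=> z) x 0.
Proof. by split; exact: is_derive_cst. Qed.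

Lemma cderR (f : R -> R) x l : is_derive x 1 f l -> cder (fun t => (f t)%:C) x l%:C.
Proof. by move=> df; split => //; exact: is_derive_cst. Qed.

Lemma cderD F G x l m : cder F x l -> cder G x m -> cder (fun t => F t + G t) x (l + m).
Proof.
move=> [a b] [c d]; split.
  rewrite (_ : (fun t => _) = (fun t => complex.Re (F t) : R) \+ (fun t => complex.Re (G t))); last first.
    by apply/funext => t /=; case: (F t) (G t) => [? ?] [? ?].
  by apply: is_derive_eq; case: l m {a b c d} => [? ?] [? ?].
rewrite (_ : (fun t => _) = (fun t => complex.Im (F t) : R) \+ (fun t => complex.Im (G t))); last first.
  by apply/funext => t /=; case: (F t) (G t) => [? ?] [? ?].
by apply: is_derive_eq; case: l m {a b c d} => [? ?] [? ?].
Qed.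

Lemma cderM F G x l m : cder F x l -> cder G x m ->
  cder (fun t => F t * G t) x (l * G x + F x * m).
Proof.
move=> [a b] [c d]; split.
  rewrite (_ : (fun t => _) = (fun t => complex.Re (F t) : R) * (fun t => complex.Re (G t))
    - (fun t => complex.Im (F t) : R) * (fun t => complex.Im (G t))); last first.
    by apply/funext => t /=; rewrite /GRing.mul /= /GRing.opp /GRing.add /=; case: (F t) (G t) => [? ?] [? ?].
  apply: is_derive_eq => /=; rewrite /GRing.scale /=; case: l m (F x) (G x) {a b c d} => [? ?] [? ?] [? ?] [? ?] /=; ring.
rewrite (_ : (fun t => _) = (fun t => complex.Re (F t) : R) * (fun t => complex.Im (G t))
    + (fun t => complex.Im (F t) : R) * (fun t => complex.Re (G t))); last first.
  by apply/funext => t /=; rewrite /GRing.mul /= /GRing.add /=; case: (F t) (G t) => [? ?] [? ?].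
apply: is_derive_eq => /=; rewrite /GRing.scale /=; case: l m (F x) (G x) {a b c d} => [? ?] [? ?] [? ?] [? ?] /=; ring.
Qed.

Lemma cder_eq F x l m : cder F x l -> l = m -> cder F x m.
Proof. by move=> ? <-. Qed.

Lemma cderZ z F x l : cder F x l -> cder (fun t => z * F t) x (z * l).
Proof. by move=> dF; apply: (cder_eq (cderM (cder_cst z x) dF)); rewrite mul0r add0r. Qed.

Lemma cderX F x l n : cder F x l ->
  cder (fun t => F t ^+ n) x (n%:R * F x ^+ n.-1 * l).
Proof.
move=> dF; elim: n => [|n IH]; first by rewrite !mul0r; exact: cder_cst.
under eq_fun do rewrite exprS.
apply: (cder_eq (cderM dF IH)); rewrite /= -[n.+1%:R]natr1; case: n {IH} => [|n].
  by rewrite expr0 !mul0r mulr0 addr0 add0r !mul1r mulr1.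
by rewrite /= exprS; ring.
Qed.

Lemma cder_conj F x l : cder F x l -> cder (fun t => (F t)^*) x l^*.
Proof.
move=> [a b]; split.
  rewrite (_ : (fun t => _) = (fun t => complex.Re (F t))); first by case: l a b.
  by apply/funext => t; case: (F t).
rewrite (_ : (fun t => _) = - (fun t => complex.Im (F t) : R)).
  by apply: is_derive_eq; case: l a b.
by apply/funext => t; rewrite /GRing.opp /=; case: (F t).
Qed.

Definition cint (a b : R) F : R[i] :=
  (\int[@lebesgue_measure R]_(x in `[a, b]) complex.Re (F x)) +i*
  (\int[@lebesgue_measure R]_(x in `[a, b]) complex.Im (F x)).

Definition cctsin (a b : R) F : Prop := forall x, a <= x <= b -> ccts F x.

Section CintBasics.
Variables a b : R.

Lemma continuous_itv_integrable (f : R -> R) :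
  (forall x, a <= x <= b -> {for x, continuous f}) ->
  (@lebesgue_measure R).-integrable `[a, b] (EFin \o f).
Proof.
move=> cf; apply: continuous_compact_integrable; first exact: segment_compact.
apply: continuous_in_subspaceT => x; rewrite inE /= in_itv /=.
exact: cf.
Qed.

Lemma cint_integrable F : cctsin a b F ->
  (@lebesgue_measure R).-integrable `[a, b] (EFin \o (fun x => complex.Re (F x))) /\
  (@lebesgue_measure R).-integrable `[a, b] (EFin \o (fun x => complex.Im (F x))).
Proof.
by move=> cF; split; apply: continuous_itv_integrable => x /cF[].
Qed.

Lemma eq_cint F G : (forall x, a <= x <= b -> F x = G x) -> cint a b F = cint a b G.
Proof.
by move=> FG; congr (_ +i* _); apply: eq_Rintegral => x;
  rewrite inE /= in_itv /= => /FG ->.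
Qed.

Lemma cintD F G : cctsin a b F -> cctsin a b G ->
  cint a b (fun x => F x + G x) = cint a b F + cint a b G.
Proof.
move=> /cint_integrable[? ?] /cint_integrable[? ?].
rewrite /cint; apply/eqP; rewrite eq_complex /=; apply/andP; split; apply/eqP;
  rewrite -RintegralD //; apply: eq_Rintegral => x _;
  by case: (F x) (G x) => [? ?] [? ?].
Qed.

Lemma cintZ z F : cctsin a b F -> cint a b (fun x => z * F x) = z * cint a b F.
Proof.
move=> /cint_integrable[iR iI].
have iZ (k : R) (f : R -> R) : (@lebesgue_measure R).-integrable `[a, b] (EFin \o f) ->
    (@lebesgue_measure R).-integrable `[a, b] (EFin \o (fun x => k * f x)).
  move=> h; have H := integrableZl _ k h.
  by apply: eq_integrable (H _).
rewrite /cint; apply/eqP; rewrite eq_complex; case: z => u v /=; apply/andP; split; apply/eqP.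
  rewrite -!RintegralZl // -RintegralB //; [|exact: iZ|exact: iZ].
  by apply: eq_Rintegral => x _; case: (F x).
rewrite -!RintegralZl // -RintegralD //; [|exact: iZ|exact: iZ].
by apply: eq_Rintegral => x _; case: (F x).
Qed.

Lemma cintN F : cctsin a b F -> cint a b (fun x => - F x) = - cint a b F.
Proof.
move=> cF; rewrite -mulN1r -cintZ //.
by apply: eq_cint => x _; rewrite mulN1r.
Qed.

Lemma cintB F G : cctsin a b F -> cctsin a b G ->
  cint a b (fun x => F x - G x) = cint a b F - cint a b G.
Proof.
move=> cF cG; rewrite cintD ?cintN // => x /cG; exact: cctsN.
Qed.

(** The factor 2 comes from bounding the real and imaginary parts separately. *)
Lemma cint_bound F (M : R) : a <= b -> cctsin a b F ->
  (forall x, a <= x <= b -> cabs (F x) <= M) -> cabs (cint a b F) <= 2 * M * (b - a).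
Proof.
move=> ab cF FM; have [iR iI] := cint_integrable cF.
have mu_ab : fine (@lebesgue_measure R `[a, b]) = b - a.
  rewrite lebesgue_measure_itv /= lte_fin; case: ltP => //= ba.
  by apply/esym/eqP; rewrite subr_eq0 eq_le ab ba.
have bnd (f : R -> R) : (@lebesgue_measure R).-integrable `[a, b] (EFin \o f) ->
   (forall x, a <= x <= b -> `|f x| <= M) ->
   `|\int[@lebesgue_measure R]_(x in `[a, b]) f x| <= M * (b - a).
  move=> fi fM; apply: (le_trans (le_normr_Rintegral _ fi)) => //.
  rewrite -mu_ab -Rintegral_cst //; apply: le_Rintegral => //.
  - by have := integrable_abse fi; apply: eq_integrable.
  - apply: continuous_itv_integrable => x _; exact: cvg_cst.
rewrite (le_trans (cabs_le _)) //= -mulrA mulr_natl mulr2n lerD //; apply: bnd => // x /FM;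
  apply: le_trans; [exact: ler_Re_cabs|exact: ler_Im_cabs].
Qed.

Lemma cint_FTC F F' : a < b -> (forall x, a <= x <= b -> cder F x (F' x)) ->
  cctsin a b F' -> cint a b F' = F b - F a.
Proof.
move=> ab dF cF'.
have FTC (f f' : R -> R) : (forall x, a <= x <= b -> is_derive x 1 f (f' x)) ->
   (forall x, a <= x <= b -> {for x, continuous f'}) ->
   \int[@lebesgue_measure R]_(x in `[a, b]) f' x = f b - f a.
  move=> df cf; rewrite /Rintegral (@continuous_FTC2 _ f' f) //.
  - by apply: continuous_in_subspaceT => x; rewrite inE /= in_itv /=; exact: cf.
  - have cc x : a <= x <= b -> {for x, continuous f}.
      move=> /df[d _]; apply/differentiable_continuous; exact/derivable1_diffP.
    split.
    + by move=> x; rewrite in_itv /= => /andP[h1 h2]; have [] := df x; rewrite ?ltW.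
    + apply: cvg_at_right_filter; apply: cc; rewrite lexx ltW //.
    + apply: cvg_at_left_filter; apply: cc; rewrite lexx ltW //.
  - move=> x; rewrite in_itv /= => /andP[h1 h2]; have h : a <= x <= b by rewrite !ltW.
      by have [_ <-] := df _ h; rewrite derive1E.
rewrite /cint; apply/eqP; rewrite eq_complex /=; apply/andP; split; apply/eqP.
  rewrite (FTC _ _ (fun x hx => (dF x hx).1) (fun x hx => (cF' x hx).1)).
  by case: (F b) (F a) => [? ?] [? ?].
rewrite (FTC _ _ (fun x hx => (dF x hx).2) (fun x hx => (cF' x hx).2)).
by case: (F b) (F a) => [? ?] [? ?].
Qed.

End CintBasics.

Lemma cint_cst a b z : a < b -> cint a b (fun=> z) = z * (b - a)%:C.
Proof.
move=> ab; rewrite (@cint_FTC a b (fun x => z * x%:C)) //.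
- by rewrite -mulrBr rmorphB.
- move=> x _; apply: (cder_eq (cderZ z (cderR (is_derive_id x 1)))).
  by rewrite -[RHS]mulr1.
- move=> x _; exact: ccts_cst.
Qed.

Lemma cint_split a b c F : a <= b -> b <= c -> cctsin a c F ->
  cint a c F = cint a b F + cint b c F.
Proof.
move=> ab bc cF; have [iR iI] := cint_integrable cF.
have sp (f : R -> R) : (@lebesgue_measure R).-integrable `[a, c] (EFin \o f) ->
   \int[@lebesgue_measure R]_(x in `[a, c]) f x =
   \int[@lebesgue_measure R]_(x in `[a, b]) f x + \int[@lebesgue_measure R]_(x in `[b, c]) f x.
  move=> fi; have := Rintegral_itvB fi; move=> /(_ b); rewrite !bnd_simp => /(_ ab bc).
  rewrite Rintegral_itv_obnd_cbnd; first by move=> <-; rewrite addrC subrK.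
  apply: integrableS fi => //; apply: subset_itv; rewrite bnd_simp //.
by rewrite /cint (sp _ iR) (sp _ iI).
Qed.

End ComplexCurves.

(** * Cauchy's formula *)

Section CauchyCircle.
Variable R : realType.
Implicit Types (f : R[i] -> R[i]) (z : R[i]) (rho th : R).

Lemma cctsin_bounded (a b : R) (F : R -> R[i]) : a <= b -> cctsin a b F ->
  exists2 M : R, 0 <= M & forall x, a <= x <= b -> cabs (F x) <= M.
Proof.
move=> ab cF; have [|c _ H] := @EVT_max R (fun x => cabs (F x)) a b ab.
  apply: continuous_in_subspaceT => x; rewrite inE /= in_itv /= => /cF /cctsP cFx.
  apply/cvgrPdist_lt => e /cFx[d d0 {}H]; exists d => //= t xt.
  apply: le_lt_trans (H t _); last by rewrite distrC.
  rewrite ler_norml; apply/andP; split.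
    by have := cabsD (F t - F x) (F x); rewrite subrK; lra.
  by have := cabsD (F x - F t) (F t); rewrite subrK cabsBC; lra.
exists (cabs (F c)); first exact: cabs_ge0.
by move=> x xab; apply: H; rewrite in_itv.
Qed.

Definition circ rho th : R[i] := rho%:C * (cos th +i* sin th).
(** The inverse of [circ rho th], in a form that is differentiated without a quotient rule. *)
Definition icirc rho th : R[i] := rho^-1%:C * (cos th -i* sin th).

Lemma circ_icirc rho th : rho != 0 -> circ rho th * icirc rho th = 1.
Proof.
move=> r0; rewrite /circ /icirc mulrACA -rmorphM /= mulfV // mul1r.
apply/eqP; rewrite eq_complex /=; apply/andP; split; apply/eqP.
  by have := cos2Dsin2 th; rewrite mulrN opprK !expr2.
by rewrite mulrN mulrC addNr.
Qed.

Lemma cabs_circ rho th : 0 <= rho -> cabs (circ rho th) = rho.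
Proof.
move=> r0; rewrite /circ cabsM cabsR ger0_norm //.
suff -> : cabs (cos th +i* sin th) = 1 by rewrite mulr1.
apply/eqP; rewrite -(@eqrXn2 _ 2) ?cabs_ge0 //.
by rewrite -sqnormE /sqnorm /= cos2Dsin2 expr1n.
Qed.

Lemma circ_neq0 rho th : 0 < rho -> circ rho th != 0.
Proof. by move=> r0; rewrite -cabs_gt0 cabs_circ // ltW. Qed.

Lemma icircE rho th : 0 < rho -> icirc rho th = (circ rho th)^-1.
Proof.
move=> r0; apply: (mulfI (circ_neq0 th r0)).
by rewrite circ_icirc ?gt_eqF // mulfV // circ_neq0.
Qed.

Lemma cabs_icirc rho th : 0 < rho -> cabs (icirc rho th) = rho^-1.
Proof. by move=> r0; rewrite icircE // cabsV cabs_circ // ltW. Qed.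

Lemma cder_circ rho th : cder (circ rho) th ('i * circ rho th).
Proof.
apply: (@cder_eq _ _ _ (rho%:C * ('i * (cos th +i* sin th)))); last by rewrite mulrCA.
apply: cderZ; split => /=.
  by rewrite mul0r mul1r sub0r; exact: is_derive_cos.
by rewrite mul0r mul1r add0r; exact: is_derive_sin.
Qed.

Lemma cder_icirc rho th : cder (icirc rho) th (- 'i * icirc rho th).
Proof.
apply: (@cder_eq _ _ _ (rho^-1%:C * (- 'i * (cos th -i* sin th)))); last by rewrite mulrCA.
apply: cderZ; split => /=.
  by rewrite oppr0 mul0r mulrN mulNr mul1r opprK sub0r; exact: is_derive_cos.
rewrite oppr0 mul0r mulN1r add0r.
by apply: is_derive_eq.
Qed.

Lemma circ_2pi rho : circ rho (2 * pi) = circ rho 0.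
Proof. by rewrite /circ mulr_natl cos2pi sin2pi cos0 sin0. Qed.

Lemma icirc_2pi rho : icirc rho (2 * pi) = icirc rho 0.
Proof. by rewrite /icirc mulr_natl cos2pi sin2pi cos0 sin0. Qed.

Lemma ccts_circ rho th : ccts (circ rho) th.
Proof. exact: cder_ccts (cder_circ rho th). Qed.

Lemma ccts_icirc rho th : ccts (icirc rho) th.
Proof. exact: cder_ccts (cder_icirc rho th). Qed.

Let pi2 : 0 < 2 * pi :> R.
Proof. by rewrite mulr_gt0 ?pi_gt0. Qed.

(** For a positive exponent the integrand is, up to a nonzero constant, the derivative of a function
    of period 2 pi. *)
Lemma cint_icircX rho n :
  cint 0 (2 * pi) (fun th => icirc rho th ^+ n) = (2 * pi * (n == 0%N)%:R)%:C.
Proof.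
case: n => [|n].
  by under eq_cint do rewrite expr0; rewrite cint_cst // mul1r subr0 mulr1.
have n0 : - 'i * n.+1%:R != 0 :> R[i].
  by rewrite mulf_neq0 ?oppr_eq0 ?neq0Ci // pnatr_eq0.
rewrite mulr0; apply: (mulfI n0); rewrite -cintZ; last first.
  by move=> th _; apply: cctsX; exact: ccts_icirc.
rewrite (@cint_FTC _ _ _ (fun th => icirc rho th ^+ n.+1)) //.
- by rewrite icirc_2pi subrr mulr0.
- move=> th _; apply: (cder_eq (cderX n.+1 (cder_icirc rho th))).
  by rewrite /= exprS; ring.
- move=> th _; apply: cctsM; first exact: ccts_cst.
  by apply: cctsX; exact: ccts_icirc.
Qed.

Lemma circ_sub_neq0 rho z th : cabs z < rho -> circ rho th - z != 0.
Proof.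
move=> zr; rewrite subr_eq0; apply/eqP => h.
by have := le_lt_trans (cabs_ge0 z) zr; move: zr; rewrite -h => + /ltW r0; rewrite cabs_circ ?ltxx.
Qed.

Lemma ccts_cauchy_kernel rho z th : cabs z < rho ->
  ccts (fun th => circ rho th / (circ rho th - z)) th.
Proof.
move=> zr; apply: cctsM; first exact: ccts_circ.
apply: cctsV; last exact: circ_sub_neq0.
by apply: cctsB; [exact: ccts_circ|exact: ccts_cst].
Qed.

Lemma cabs_cauchy_kernel rho z th : cabs z < rho ->
  cabs (circ rho th / (circ rho th - z)) <= rho / (rho - cabs z).
Proof.
move=> zr; have r0 := le_lt_trans (cabs_ge0 z) zr.
rewrite cabsM cabsV cabs_circ ?(ltW r0) // ler_pM2l // lef_pV2 ?posrE ?subr_gt0 //; last first.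
  by rewrite cabs_gt0 circ_sub_neq0.
by have := cabsD (circ rho th - z) z; rewrite subrK cabs_circ ?(ltW r0) //; lra.
Qed.

(** The kernel w/(w - z) is the sum of the geometric series of z/w, and its remainder after N terms
    is exactly (z/w)^N times the kernel itself. The bound is then that of [cint_bound]. *)
Lemma cauchy_kernel_expand rho z F (M : R) N : cabs z < rho -> 0 <= M ->
  cctsin 0 (2 * pi) F -> (forall th, 0 <= th <= 2 * pi -> cabs (F th) <= M) ->
  cabs (cint 0 (2 * pi) (fun th => F th * (circ rho th / (circ rho th - z))) -
    \sum_(n < N) z ^+ n * cint 0 (2 * pi) (fun th => F th * icirc rho th ^+ n)) <=
  2 * (M * (cabs z / rho) ^+ N * (rho / (rho - cabs z))) * (2 * pi).
Proof.
move=> zr M0 cF FM; have r0 := le_lt_trans (cabs_ge0 z) zr.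
have cX n : cctsin 0 (2 * pi) (fun th => F th * icirc rho th ^+ n).
  by move=> th h; apply: cctsM; [exact: cF|apply: cctsX; exact: ccts_icirc].
have cK : cctsin 0 (2 * pi) (fun th => F th * (circ rho th / (circ rho th - z))).
  by move=> th h; apply: cctsM; [exact: cF|exact: ccts_cauchy_kernel].
have cS N' : cctsin 0 (2 * pi) (fun th => \sum_(n < N') z ^+ n * (F th * icirc rho th ^+ n)).
  move=> th h; elim: N' => [|N' IH].
    by under eq_fun do rewrite big_ord0; exact: ccts_cst.
  under eq_fun do rewrite big_ord_recr /=; apply: cctsD => //.
  by apply: cctsM; [exact: ccts_cst|exact: cX].
have -> : \sum_(n < N) z ^+ n * cint 0 (2 * pi) (fun th => F th * icirc rho th ^+ n) =
   cint 0 (2 * pi) (fun th => \sum_(n < N) z ^+ n * (F th * icirc rho th ^+ n)).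
  elim: N => [|N IH].
    rewrite big_ord0; under eq_cint do rewrite big_ord0.
    by rewrite cint_cst // mul0r.
  rewrite big_ord_recr /= IH -cintZ // -cintD //; last first.
    by move=> th h; apply: cctsM; [exact: ccts_cst|exact: cX].
  by apply: eq_cint => th _; rewrite big_ord_recr.
rewrite -cintB // -[X in _ <= _ * X]subr0.
apply: cint_bound; first exact: ltW.
  by move=> th h; apply: cctsB; [exact: cK|exact: cS].
move=> th h.
have -> : F th * (circ rho th / (circ rho th - z)) -
    \sum_(n < N) z ^+ n * (F th * icirc rho th ^+ n) =
    F th * (z * icirc rho th) ^+ N * (circ rho th / (circ rho th - z)).
  have z0 := circ_neq0 th r0; have zz := circ_sub_neq0 th zr.
  elim: N => [|N IH]; first by rewrite big_ord0 expr0 subr0 mulr1.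
  rewrite big_ord_recr /= opprD addrA IH exprS icircE // exprMn.
  by field; rewrite z0 zz.
rewrite cabsM [cabs (F th * _)]cabsM cabsX cabsM cabs_icirc //.
apply: ler_pM; rewrite ?mulr_ge0 ?exprn_ge0 ?mulr_ge0 ?cabs_ge0 ?invr_ge0 ?(ltW r0) //; last exact: cabs_cauchy_kernel.
by rewrite ler_pM ?cabs_ge0 ?exprn_ge0 ?mulr_ge0 ?cabs_ge0 ?invr_ge0 ?(ltW r0) // FM.
Qed.

Lemma geometric_bound_eq0 (x C q : R) : 0 <= q < 1 ->
  (forall N, x <= C * q ^+ N) -> x <= 0.
Proof.
move=> /andP[q0 q1] H.
have : (fun n => C * q ^+ n) @ \oo --> (C * 0 : R).
  by apply: cvgM; [exact: cvg_cst|apply: cvg_expr; rewrite ger0_norm].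
rewrite mulr0 => cv; apply: (@closed_cvg _ _ \oo _ _ (fun y => x <= y) _ _ _ cv) => //.
exact: nearW.
Qed.

(** This is the expansion of the kernel against the constant 1: only the term of exponent 0 has a
    nonzero integral, and the remainder tends to 0. *)
Lemma cint_cauchy_kernel rho z : cabs z < rho ->
  cint 0 (2 * pi) (fun th => circ rho th / (circ rho th - z)) = (2 * pi)%:C.
Proof.
move=> zr; have r0 := le_lt_trans (cabs_ge0 z) zr.
apply/eqP; rewrite -subr_eq0 -cabs_eq0 eq_le cabs_ge0 andbT.
apply: (@geometric_bound_eq0 _ (2 * (1 * (rho / (rho - cabs z))) * (2 * pi)) (cabs z / rho)).
  by rewrite divr_ge0 ?cabs_ge0 ?(ltW r0) //= ltr_pdivrMr // mul1r.
have c1 : cctsin 0 (2 * pi) (fun=> 1 : R[i]) by move=> th _; exact: ccts_cst.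
have eq_le1 th : cabs ((fun=> 1 : R[i]) th) <= 1 by rewrite cabs1.
have H N : (0 < N)%N -> cabs (cint 0 (2 * pi) (fun th => circ rho th / (circ rho th - z)) - (2 * pi)%:C) <=
  2 * (1 * (cabs z / rho) ^+ N * (rho / (rho - cabs z))) * (2 * pi).
  move=> N0; have := cauchy_kernel_expand N zr ler01 c1.
  move=> /(_ (fun th _ => eq_le1 th)); congr (cabs (_ - _) <= _).
    by apply: eq_cint => th _; rewrite mul1r.
  case: N N0 => // N _; rewrite big_ord_recl big1.
    rewrite expr0 mul1r addr0 (@eq_cint _ _ _ _ (fun th => icirc rho th ^+ 0)).
      by rewrite cint_icircX mulr1.
    by move=> th _; rewrite mul1r.
  move=> i _; rewrite (_ : cint _ _ _ = 0) ?mulr0 //.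
  rewrite (@eq_cint _ _ _ _ (fun th => icirc rho th ^+ i.+1)); last by move=> ? _; rewrite mul1r.
  by rewrite cint_icircX mulr0.
(* At N = 0 the expansion lacks the term 2 pi, so the bound at N is deduced from the one at
   [N.+1]. *)
move=> N; apply: (le_trans (H N.+1 isT)).
have K0 : 0 <= rho / (rho - cabs z) by rewrite divr_ge0 ?(ltW r0) // subr_ge0 ltW.
have qN : (cabs z / rho) ^+ N.+1 <= (cabs z / rho) ^+ N.
  rewrite exprS ler_piMl // ?exprn_ge0 ?divr_ge0 ?cabs_ge0 ?(ltW r0) //.
  by rewrite ler_pdivrMr // mul1r ltW.
rewrite !mul1r (_ : 2 * (_ * _) * _ = 2 * (rho / (rho - cabs z)) * (2 * pi) * (cabs z / rho) ^+ N.+1); last by ring.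
rewrite ler_wpM2l //.
by rewrite mulr_ge0 ?(ltW pi2) // mulr_ge0.
Qed.

End CauchyCircle.

Section CauchyFormula.
Variable R : realType.
Variables (f : R[i] -> R[i]) (rho : R) (z0 : R[i]).
Hypotheses (hf : holomorphic_disc f) (r1 : rho < 1) (z0r : cabs z0 < rho).

Let r0 : 0 < rho. Proof. exact: le_lt_trans (cabs_ge0 z0) z0r. Qed.

Let pi2 : 0 < 2 * pi :> R.
Proof. by rewrite mulr_gt0 ?pi_gt0. Qed.

(* The segments from z0 to the points of the circle sweep out the disc. *)
Let Phi (x th : R) : R[i] := z0 + x%:C * (circ rho th - z0).
(** In the coordinates w = [Phi x th] one has dw/(w - z0) = dx/x + [ker th] dth. *)
Let ker (th : R) : R[i] := 'i * (circ rho th / (circ rho th - z0)).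

Let Phi_lt1 (x th : R) : 0 <= x <= 1 -> cabs (Phi x th) < 1.
Proof.
move=> /andP[x0 x1]; apply: le_lt_trans r1.
have -> : Phi x th = (1 - x)%:C * z0 + x%:C * circ rho th.
  by rewrite /Phi rmorphB /=; ring.
apply: le_trans (cabsD _ _) _.
rewrite [cabs (_ * z0)]cabsM [cabs (_ * circ _ _)]cabsM !cabsR cabs_circ ?(ltW r0) //.
rewrite !ger0_norm ?subr_ge0 //.
have : (1 - x) * cabs z0 <= (1 - x) * rho by rewrite ler_wpM2l ?subr_ge0 // ltW.
lra.
Qed.

Let hf' (x th : R) : 0 <= x <= 1 -> derivable (f : R[i]^o -> R[i]^o) (Phi x th) 1.
Proof. by move=> /Phi_lt1 h; apply: hf; rewrite -[1]/(1%:C) lt_norm_cabs h. Qed.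

Let ccts_Phi_th (x th : R) : ccts (Phi x) th.
Proof.
apply: cctsD; first exact: ccts_cst.
apply: cctsM; first exact: ccts_cst.
by apply: cctsB; [exact: ccts_circ|exact: ccts_cst].
Qed.

Let ccts_Phi_x (x th : R) : ccts (Phi ^~ th) x.
Proof.
apply: cctsD; first exact: ccts_cst.
apply: cctsM; last exact: ccts_cst.
by apply: cctsR; exact: cvg_id.
Qed.

Let ccts_ker th : ccts ker th.
Proof. by apply: cctsM; [exact: ccts_cst|exact: ccts_cauchy_kernel]. Qed.

Let ccts_fPhi_th (x th : R) : 0 <= x <= 1 -> ccts (fun th => f (Phi x th)) th.
Proof. by move=> h; apply: ccts_comp_derivable; [exact: hf'|exact: ccts_Phi_th]. Qed.

Let ccts_fPhi_x (x th : R) : 0 <= x <= 1 -> ccts (fun x => f (Phi x th)) x.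
Proof. by move=> h; apply: ccts_comp_derivable; [exact: hf'|exact: ccts_Phi_x]. Qed.

Let ccts_inv (x : R) : 0 < x -> ccts (fun x => (x^-1)%:C) x.
Proof.
move=> x0; apply: cctsR; apply: cvgV; first by rewrite gt_eqF.
exact: cvg_id.
Qed.

(* The integral of f(w) dw / (w - z0) around the image under Phi of a rectangle. *)
Let I (x1 x2 y1 y2 : R) : R[i] :=
  cint y1 y2 (fun th => (f (Phi x2 th) - f (Phi x1 th)) * ker th) -
  cint x1 x2 (fun x => (f (Phi x y2) - f (Phi x y1)) * (x^-1)%:C).

Let ccts1 (x1 x2 th : R) : 0 <= x1 <= 1 -> 0 <= x2 <= 1 ->
  ccts (fun th => (f (Phi x2 th) - f (Phi x1 th)) * ker th) th.
Proof. by move=> h1 h2; apply: cctsM => //; apply: cctsB; exact: ccts_fPhi_th. Qed.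

Let ccts2 (x y1 y2 : R) : 0 < x <= 1 ->
  ccts (fun x => (f (Phi x y2) - f (Phi x y1)) * (x^-1)%:C) x.
Proof.
move=> /andP[h1 h2]; apply: cctsM; last exact: ccts_inv.
by apply: cctsB; apply: ccts_fPhi_x; rewrite ltW.
Qed.

Let I_addx (s0 x1 x2 x3 y1 y2 : R) : 0 < s0 -> s0 <= x1 -> x1 < x2 -> x2 < x3 ->
  x3 <= 1 -> 0 <= y1 -> y1 < y2 -> y2 <= 2 * pi ->
  I x1 x3 y1 y2 = I x1 x2 y1 y2 + I x2 x3 y1 y2.
Proof.
move=> s00 sx1 x12 x23 x31 _ y12 _.
have h1 : 0 <= x1 <= 1 by apply/andP; split; lra.
have h2 : 0 <= x2 <= 1 by apply/andP; split; lra.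
have h3 : 0 <= x3 <= 1 by apply/andP; split; lra.
rewrite /I (@cint_split _ x1 x2 x3) ?ltW //; last first.
  by move=> x /andP[? ?]; apply: ccts2; apply/andP; split; lra.
rewrite addrACA -opprD; congr (_ - _).
rewrite -cintD; [|by move=> th _; exact: ccts1|by move=> th _; exact: ccts1].
by apply: eq_cint => th _; rewrite -mulrDl; congr (_ * _); ring.
Qed.

Let I_addy (s0 x1 x2 y1 y2 y3 : R) : 0 < s0 -> s0 <= x1 -> x1 < x2 ->
  x2 <= 1 -> 0 <= y1 -> y1 < y2 -> y2 < y3 -> y3 <= 2 * pi ->
  I x1 x2 y1 y3 = I x1 x2 y1 y2 + I x1 x2 y2 y3.
Proof.
move=> s00 sx1 x12 x21 _ y12 y23 _.
have h1 : 0 <= x1 <= 1 by apply/andP; split; lra.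
have h2 : 0 <= x2 <= 1 by apply/andP; split; lra.
rewrite /I (@cint_split _ y1 y2 y3) ?ltW //; last by move=> th _; exact: ccts1.
rewrite addrACA -opprD; congr (_ - _).
have c y y' : cctsin x1 x2 (fun x => (f (Phi x y) - f (Phi x y')) * (x^-1)%:C).
  by move=> x /andP[? ?]; apply: ccts2; apply/andP; split; lra.
rewrite -cintD //.
by apply: eq_cint => th _; rewrite -mulrDl; congr (_ * _); ring.
Qed.

Let circ_lip (y1 y2 : R) : y1 <= y2 -> cabs (circ rho y2 - circ rho y1) <= 2 * (y2 - y1).
Proof.
rewrite le_eqVlt => /predU1P[->|y12]; first by rewrite !subrr cabs0 mulr0.
rewrite -(@cint_FTC _ _ _ (circ rho) (fun th => 'i * circ rho th)) //; last 2 first.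
- by move=> x _; exact: cder_circ.
- by move=> x _; apply: cctsM; [exact: ccts_cst|exact: ccts_circ].
rewrite -[X in X * (y2 - _)]mulr1; apply: cint_bound; first exact: ltW.
  by move=> x _; apply: cctsM; [exact: ccts_cst|exact: ccts_circ].
by move=> x _; rewrite cabsM cabsi mul1r cabs_circ ltW.
Qed.

Let Phi_lip (x x' y y' h k : R) : 0 <= x' <= 1 -> `|x - x'| <= h -> `|y - y'| <= k ->
  cabs (Phi x y - Phi x' y') <= 2 * (h + k).
Proof.
move=> /andP[x'0 x'1] hx hy.
have -> : Phi x y - Phi x' y' = (x - x')%:C * (circ rho y - z0) + x'%:C * (circ rho y - circ rho y').
  by rewrite /Phi rmorphB /=; ring.
rewrite [leRHS]mulrDr; apply: le_trans (cabsD _ _) _; apply: lerD; rewrite cabsM cabsR.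
  rewrite mulrC ler_pM ?cabs_ge0 //.
  by rewrite (le_trans (cabsB _ _)) // cabs_circ ?(ltW r0) //; have := r1; have := z0r; lra.
rewrite ger0_norm // (le_trans (ler_piMl (cabs_ge0 _) x'1)) //.
have [yy|/ltW yy] := leP y y'.
  rewrite cabsBC (le_trans (circ_lip yy)) // ler_pM2l //.
  by move: hy; rewrite distrC ger0_norm // subr_ge0.
by rewrite (le_trans (circ_lip yy)) // ler_pM2l //; move: hy; rewrite ger0_norm // subr_ge0.
Qed.

(** Replacing f by its first-order expansion at [Phi x y] changes nothing in [I]: constants cancel
    in the differences, and the linear part gives l (b - a) (circ v - circ u) in both integrals.
    Only the remainder [g] is left; it is small relative to the size of the rectangle, and the
    kernels are bounded by [Bm] on the circle and by 1/s0 on the segments. *)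
Let I_loc (s0 x y e : R) : 0 < s0 -> s0 <= x <= 1 -> 0 <= y <= 2 * pi -> 0 < e ->
  exists2 del, 0 < del & forall x1 x2 y1 y2,
    s0 <= x1 <= x -> x <= x2 <= 1 -> 0 <= y1 <= y -> y <= y2 <= 2 * pi ->
    x1 < x2 -> y1 < y2 -> x2 - x1 < del -> y2 - y1 < del ->
    cabs (I x1 x2 y1 y2) <= e * ((x2 - x1) + (y2 - y1)) ^+ 2.
Proof.
move=> s00 /andP[sx x1] yy e0.
have x01 : 0 <= x <= 1 by apply/andP; split; lra.
have [l Hl] := derivable_linear_approx (@hf' x y x01).
pose Bm := rho / (rho - cabs z0).
have Bm0 : 0 < Bm by rewrite divr_gt0 // subr_gt0.
have s0V : 0 < s0^-1 by rewrite invr_gt0.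
(* The two integrals below add up to at most 8 e' (h + k) (Bm k + h/s0), which is less than 8 e' (Bm
   + 1/s0) (h + k)^2. *)
pose e' := e / (8 * (Bm + s0^-1)).
have e'0 : 0 < e' by rewrite divr_gt0 // mulr_gt0 // addr_gt0.
have [d d0 {}Hl] := Hl _ e'0.
(* Points of the rectangle have images within 2 (h + k) of [Phi x y], which must stay below [d]. *)
exists (d / 4); first by lra.
move=> a b u v /andP[sa ax] /andP[xb b1] /andP[u0 uy] /andP[yv vpi] ab uv had hud.
set h := b - a; set k := v - u.
have h0 : 0 < h by rewrite subr_gt0.
have k0 : 0 < k by rewrite subr_gt0.
pose zs := Phi x y.
pose g w := f w - f zs - l * (w - zs).
have fg w w' : f w - f w' = (g w - g w') + l * (w - w') by rewrite /g; ring.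
have gb x' y' : a <= x' <= b -> u <= y' <= v -> cabs (g (Phi x' y')) <= e' * (2 * (h + k)).
  move=> /andP[? ?] /andP[? ?].
  have lip : cabs (Phi x' y' - zs) <= 2 * (h + k).
    by apply: Phi_lip => //; rewrite ler_norml /h /k; apply/andP; split; lra.
  apply: le_trans (Hl _ _) _; last by rewrite ler_pM2l.
  by apply: le_lt_trans lip _; rewrite /h /k; lra.
have gc1 x' th : 0 <= x' <= 1 -> ccts (fun th => g (Phi x' th)) th.
  move=> hx'; apply: cctsB; first by apply: cctsB; [exact: ccts_fPhi_th|exact: ccts_cst].
  by apply: cctsM; [exact: ccts_cst|apply: cctsB; [exact: ccts_Phi_th|exact: ccts_cst]].
have gc2 x' th : 0 <= x' <= 1 -> ccts (fun x' => g (Phi x' th)) x'.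
  move=> hx'; apply: cctsB; first by apply: cctsB; [exact: ccts_fPhi_x|exact: ccts_cst].
  by apply: cctsM; [exact: ccts_cst|apply: cctsB; [exact: ccts_Phi_x|exact: ccts_cst]].
have ha : 0 <= a <= 1 by apply/andP; split; lra.
have hb : 0 <= b <= 1 by apply/andP; split; lra.
have c1 : cctsin u v (fun th => (g (Phi b th) - g (Phi a th)) * ker th).
  by move=> th _; apply: cctsM => //; apply: cctsB; exact: gc1.
have c2 : cctsin a b (fun x => (g (Phi x v) - g (Phi x u)) * (x^-1)%:C).
  move=> x' /andP[? ?]; apply: cctsM; last by apply: ccts_inv; lra.
  by apply: cctsB; apply: gc2; apply/andP; split; lra.
have c3 : cctsin u v (fun th => (l * (b - a)%:C) * ('i * circ rho th)).
  by move=> th _; do 2! (apply: cctsM; first exact: ccts_cst); exact: ccts_circ.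
have -> : I a b u v =
  cint u v (fun th => (g (Phi b th) - g (Phi a th)) * ker th) -
  cint a b (fun x => (g (Phi x v) - g (Phi x u)) * (x^-1)%:C).
  rewrite /I.
  rewrite (@eq_cint _ u v _ (fun th => (g (Phi b th) - g (Phi a th)) * ker th +
     (l * (b - a)%:C) * ('i * circ rho th))); last first.
    move=> th _; rewrite fg mulrDl; congr (_ + _).
    rewrite /ker /Phi rmorphB /=; field.
    exact: circ_sub_neq0.
  rewrite (@eq_cint _ a b (fun x => (f _ - _) * _) (fun x => (g (Phi x v) - g (Phi x u)) * (x^-1)%:C
    + l * (circ rho v - circ rho u))); last first.
    move=> x' /andP[? ?]; rewrite fg mulrDl; congr (_ + _).
    have x'0 : x' != 0 by rewrite gt_eqF //; lra.
    rewrite /Phi fmorphV /=; field.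
    by rewrite -[0]/(0%:C) (inj_eq (@complexI R)).
  rewrite (cintD c1 c3) (cintD c2); last by move=> ? _; exact: ccts_cst.
  rewrite cintZ; last first.
    by move=> th _; apply: cctsM; [exact: ccts_cst|exact: ccts_circ].
  rewrite (@cint_FTC _ u v (circ rho) (fun th => 'i * circ rho th)) //; last 2 first.
  - by move=> ? _; exact: cder_circ.
  - by move=> ? _; apply: cctsM; [exact: ccts_cst|exact: ccts_circ].
  by rewrite cint_cst //; ring.
have b1' : cabs (cint u v (fun th => (g (Phi b th) - g (Phi a th)) * ker th)) <=
   2 * ((e' * (2 * (h + k)) + e' * (2 * (h + k))) * Bm) * k.
  apply: cint_bound => //; first exact: ltW.
  move=> th hth; rewrite cabsM ler_pM ?cabs_ge0 //.
    by rewrite (le_trans (cabsB _ _)) // lerD // gb // ?lexx ?(ltW ab).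
  by rewrite /ker cabsM cabsi mul1r cabs_cauchy_kernel.
have b2' : cabs (cint a b (fun x => (g (Phi x v) - g (Phi x u)) * (x^-1)%:C)) <=
   2 * ((e' * (2 * (h + k)) + e' * (2 * (h + k))) * s0^-1) * h.
  apply: cint_bound => //; first exact: ltW.
  move=> x' hx'; rewrite cabsM ler_pM ?cabs_ge0 //.
    by rewrite (le_trans (cabsB _ _)) // lerD // gb // ?lexx ?(ltW uv).
  have x's : s0 <= x' by case/andP: hx' => ? _; lra.
  rewrite cabsR ger0_norm ?invr_ge0 ?(le_trans (ltW s00)) // lef_pV2 ?posrE //.
  exact: lt_le_trans s00 x's.
apply: le_trans (cabsB _ _) _; apply: le_trans (lerD b1' b2') _.
have -> : e = e' * (8 * (Bm + s0^-1)).
  by rewrite /e' divfK // gt_eqF // mulr_gt0 // addr_gt0.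
clear -e'0 h0 k0 Bm0 s0V.
rewrite -subr_ge0.
set q := s0^-1 in s0V *.
have -> : e' * (8 * (Bm + q)) * (h + k) ^+ 2 -
  (2 * ((e' * (2 * (h + k)) + e' * (2 * (h + k))) * Bm) * k +
   2 * ((e' * (2 * (h + k)) + e' * (2 * (h + k))) * q) * h) =
   8 * e' * (h + k) * (Bm * h + q * k) by ring.
apply: ltW; apply: mulr_gt0; first by apply: mulr_gt0; [exact: mulr_gt0|exact: addr_gt0].
by apply: addr_gt0; exact: mulr_gt0.
Qed.

(** On the rectangle [s, 1] x [0, 2 pi] the sides th = 0 and th = 2 pi have the same image, so
    [I = 0] says that the integral over the curve [Phi s] equals the one over the circle. The factor
    1/x forbids s = 0; as s tends to 0, f (Phi s th) tends to f z0 uniformly at rate s, and the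
    integral of the kernel alone is 2 pi. *)
Lemma cauchy_formula :
  cint 0 (2 * pi) (fun th => f (circ rho th) * (circ rho th / (circ rho th - z0))) =
  (2 * pi)%:C * f z0.
Proof.
have Phi1 th : Phi 1 th = circ rho th by rewrite /Phi mul1r addrC subrK.
have Phi0 th : Phi 0 th = z0 by rewrite /Phi mul0r addr0.
have ck th : ccts (fun th => circ rho th / (circ rho th - z0)) th.
  exact: ccts_cauchy_kernel.
have cfk s : 0 <= s <= 1 -> cctsin 0 (2 * pi) (fun th => f (Phi s th) * (circ rho th / (circ rho th - z0))).
  by move=> s01 th _; apply: cctsM => //; exact: ccts_fPhi_th.
have z01 : `|z0| < 1 by rewrite -[1]/(1%:C) lt_norm_cabs (lt_trans z0r).
have const s : 0 < s < 1 ->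
  cint 0 (2 * pi) (fun th => f (circ rho th) * (circ rho th / (circ rho th - z0))) =
  cint 0 (2 * pi) (fun th => f (Phi s th) * (circ rho th / (circ rho th - z0))).
  move=> /andP[s0 s1].
  have : I s 1 0 (2 * pi) = 0.
    apply: bisection_eq0 => //.
    - by move=> *; apply: (I_addx s0).
    - by move=> *; apply: (I_addy s0).
    - by move=> x y e hx hy e0; exact: I_loc.
  rewrite /I [X in _ - X](_ : _ = 0); last first.
    rewrite (@eq_cint _ _ _ _ (fun=> 0)); first by rewrite cint_cst // mul0r.
    by move=> x _; rewrite /Phi circ_2pi subrr mul0r.
  rewrite subr0.
  have s01 : 0 <= s <= 1 by rewrite !ltW.
  have h01 : is_true ((0 : R) <= (1 : R) <= (1 : R)) by apply/andP; split.
  rewrite (@eq_cint _ _ _ _ (fun th => 'i * (f (Phi 1 th) * (circ rho th / (circ rho th - z0)) -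
    f (Phi s th) * (circ rho th / (circ rho th - z0))))); last first.
    by move=> th _; rewrite /ker; ring.
  rewrite cintZ; last by move=> th h; apply: cctsB; apply: cfk.
  move/eqP; rewrite mulf_eq0 (negbTE (neq0Ci _)) /= cintB; [|exact: cfk|exact: cfk].
  rewrite subr_eq0 => /eqP <-; apply: eq_cint => th _; by rewrite Phi1.
have [L [d [L0 d0 HL]]] := derivable_lipschitz (hf z01).
apply/eqP; rewrite -subr_eq0 -cabs_eq0 eq_le cabs_ge0 andbT.
pose Bm := rho / (rho - cabs z0).
have Bm0 : 0 < Bm by rewrite divr_gt0 // subr_gt0.
pose C := 2 * ((L * 2) * Bm) * (2 * pi).
have C0 : 0 < C.
  by apply: mulr_gt0 => //; apply: mulr_gt0 => //; apply: mulr_gt0 => //; exact: mulr_gt0.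
apply/ler_addgt0Pl => e e0; rewrite addr0.
(* 1/2 keeps s inside (0, 1), d/3 keeps the curve in the domain of the Lipschitz bound, whose radius
   is d for a distance of at most 2 s, and e/C makes the error at most e. *)
pose s := Num.min (1/2) (Num.min (d / 3) (e / C)).
have [s0 s2 s3 s4] : [/\ 0 < s, s <= 1/2, s <= d / 3 & s <= e / C].
  rewrite /s !lt_min !ge_min !lexx /= !orbT divr_gt0 //; split=> //.
  by rewrite /= !divr_gt0.
have s01 : 0 <= s <= 1 by apply/andP; split; lra.
rewrite (const s); last by apply/andP; split; lra.
rewrite -(cint_cauchy_kernel z0r) [_ * f z0]mulrC -cintZ; last by move=> th _; exact: ck.
rewrite -cintB; [|exact: cfk|by move=> th _; apply: cctsM; [exact: ccts_cst|exact: ck]].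
apply: (@le_trans _ _ (2 * ((L * 2 * s) * Bm) * (2 * pi - 0))).
  apply: cint_bound; first exact: ltW.
    move=> th h; apply: cctsB; first exact: cfk.
    by apply: cctsM; [exact: ccts_cst|exact: ck].
  move=> th _; rewrite -mulrBl cabsM ler_pM ?cabs_ge0 //; last exact: cabs_cauchy_kernel.
  have hs : cabs (Phi s th - z0) <= 2 * s.
    have -> : Phi s th - z0 = s%:C * (circ rho th - z0) by rewrite /Phi addrC addKr.
    rewrite cabsM cabsR ger0_norm ?(ltW s0) // mulrC ler_pM2r //.
    by rewrite (le_trans (cabsB _ _)) // cabs_circ ?(ltW r0) //; have := r1; have := z0r; lra.
  rewrite (le_trans (HL _ _)) //; first by lra.
  by rewrite -mulrA ler_pM2l.
rewrite subr0 (_ : _ * _ = C * s); last by rewrite /C; ring.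
by rewrite mulrC -ler_pdivlMr.
Qed.

End CauchyFormula.

(** * Taylor expansion with a geometric remainder *)

Section Taylor.
Variable R : realType.

(** The coefficients are integrals over the circle of radius [rho], so at this stage they may depend
    on [rho]; [bergman_taylor] identifies them for functions of the Bergman space. *)
Lemma holomorphic_taylor (f : R[i] -> R[i]) (rho : R) : holomorphic_disc f ->
  0 < rho < 1 -> exists (a : nat -> R[i]) (C : R), 0 <= C /\ forall z, cabs z < rho ->
  forall N, cabs (f z - \sum_(n < N) a n * z ^+ n) <=
    C * (cabs z / rho) ^+ N / (rho - cabs z).
Proof.
move=> hf /andP[r0 r1].
have pi2 : 0 < 2 * pi :> R by rewrite mulr_gt0 ?pi_gt0.
have cF : cctsin 0 (2 * pi) (fun th => f (circ rho th)).
  move=> th _; apply: ccts_comp_derivable; last exact: ccts_circ.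
  by apply: hf; rewrite -[1]/(1%:C) lt_norm_cabs cabs_circ // ltW.
have [M M0 FM] := cctsin_bounded (ltW pi2) cF.
exists (fun n => (2 * pi)^-1%:C * cint 0 (2 * pi) (fun th => f (circ rho th) * icirc rho th ^+ n)).
exists (2 * M * rho); split; first by rewrite mulr_ge0 ?mulr_ge0 // ltW.
move=> z zr N.
have piC : (2 * pi)%:C != 0 :> R[i].
  by rewrite -[0]/(0%:C) (inj_eq (@complexI R)) gt_eqF.
rewrite -[f z](mulKf piC) -(cauchy_formula hf r1 zr) -fmorphV /=.
under eq_bigr do rewrite -mulrA.
rewrite -mulr_sumr -mulrBr cabsM cabsR ger0_norm ?invr_ge0 ?(ltW pi2) //.
rewrite mulrC ler_pdivrMr //.
have := cauchy_kernel_expand N zr M0 cF FM.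
under eq_bigr do rewrite mulrC.
by move=> /le_trans-> //; rewrite le_eqVlt; apply/orP; left; apply/eqP; ring.
Qed.

End Taylor.

(** * Integrals over discs *)

Section DiscIntegrals.
Variable R : realType.
Local Notation plane := (measurableTypeR R * measurableTypeR R)%type.
Local Notation leb := (@lebesgue_measure R).
Implicit Types (F G : plane -> R[i]) (r : R).

Definition discr r : set plane := [set p | p.1 ^+ 2 + p.2 ^+ 2 < r ^+ 2].

Lemma discr1 : discr 1 = @disc R.
Proof. by rewrite discE /discr expr1n. Qed.

Lemma measurable_discr r : measurable (discr r).
Proof.
have m1 : measurable_fun [set: plane] (fun p : plane => p.1 ^+ 2 + p.2 ^+ 2).
  by apply: measurable_funD; apply: measurable_funX;
    [exact: measurable_fst|exact: measurable_snd].
rewrite (_ : discr r = setT `&` (fun p : plane => p.1 ^+ 2 + p.2 ^+ 2) @^-1` `]-oo, r ^+ 2[%classic).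
  exact: m1.
by apply/seteqP; split=> p /=; rewrite /discr /= in_itv //= => -[].
Qed.

Lemma discr_sub r : 0 <= r <= 1 -> discr r `<=` @disc R.
Proof.
move=> /andP[r0 r1] p; rewrite -discr1 /discr /= expr1n => /lt_le_trans; apply.
by rewrite exprn_ile1.
Qed.

Lemma disc_cabs (p : plane) : @disc R p -> cabs (of_plane p) < 1.
Proof. by rewrite /disc /= -[1]/(1%:C) lt_norm_cabs. Qed.

Definition dintegrable r F : Prop :=
  area.-integrable (discr r) (EFin \o (fun p => complex.Re (F p))) /\
  area.-integrable (discr r) (EFin \o (fun p => complex.Im (F p))).

Definition dint r F : R[i] :=
  (\int[area]_(p in discr r) complex.Re (F p)) +i*
  (\int[area]_(p in discr r) complex.Im (F p)).

Lemma eq_dint r F G : (forall p, discr r p -> F p = G p) -> dint r F = dint r G.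
Proof.
by move=> FG; congr (_ +i* _); apply: eq_Rintegral => p; rewrite inE => /FG ->.
Qed.

Lemma eq_dintegrable r F G : (forall p, discr r p -> F p = G p) ->
  dintegrable r F -> dintegrable r G.
Proof.
by move=> FG [iR iI]; split; [apply: eq_integrable iR|apply: eq_integrable iI];
  (try exact: measurable_discr) => p; rewrite inE /= => /FG ->.
Qed.

Lemma dintegrableD r F G : dintegrable r F -> dintegrable r G ->
  dintegrable r (fun p => F p + G p).
Proof.
move=> [iR iI] [jR jI]; have mD := measurable_discr r; split.
  apply: eq_integrable (integrableD mD iR jR) => // p _ /=.
  by case: (F p) (G p) => [? ?] [? ?].
apply: eq_integrable (integrableD mD iI jI) => // p _ /=.
by case: (F p) (G p) => [? ?] [? ?].
Qed.

Lemma dintegrableZ r z F : dintegrable r F -> dintegrable r (fun p => z * F p).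
Proof.
move=> [iR iI]; have mD := measurable_discr r; split.
  apply: eq_integrable (integrableB mD (integrableZl mD (complex.Re z) iR)
    (integrableZl mD (complex.Im z) iI)) => // p _ /=.
  by case: (z) (F p) => [? ?] [? ?].
apply: eq_integrable (integrableD mD (integrableZl mD (complex.Re z) iI)
    (integrableZl mD (complex.Im z) iR)) => // p _ /=.
by case: (z) (F p) => [? ?] [? ?].
Qed.

Lemma dintD r F G : dintegrable r F -> dintegrable r G ->
  dint r (fun p => F p + G p) = dint r F + dint r G.
Proof.
move=> [iR iI] [jR jI]; have mD := measurable_discr r.
rewrite /dint; apply/eqP; rewrite eq_complex /=; apply/andP; split; apply/eqP;
  rewrite -RintegralD //; apply: eq_Rintegral => p _;
  by case: (F p) (G p) => [? ?] [? ?].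
Qed.

Lemma dintZ r z F : dintegrable r F -> dint r (fun p => z * F p) = z * dint r F.
Proof.
move=> [iR iI]; have mD := measurable_discr r.
rewrite /dint; apply/eqP; rewrite eq_complex; case: z => u v /=; apply/andP; split; apply/eqP.
  rewrite -!RintegralZl // -RintegralB //.
  - by apply: eq_Rintegral => p _; case: (F p).
  - exact: (integrableZl mD _ iR).
  - exact: (integrableZl mD _ iI).
rewrite -!RintegralZl // -RintegralD //.
- by apply: eq_Rintegral => p _; case: (F p).
- exact: (integrableZl mD _ iI).
- exact: (integrableZl mD _ iR).
Qed.

Lemma dint_conj r F : dintegrable r F -> dint r (fun p => (F p)^*) = (dint r F)^*.
Proof.
move=> [iR iI]; have mD := measurable_discr r.
rewrite /dint; apply/eqP; rewrite eq_complex /=; apply/andP; split; apply/eqP.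
  by apply: eq_Rintegral => p _; case: (F p).
rewrite -mulN1r -RintegralZl //.
by apply: eq_Rintegral => p _; case: (F p) => ? ? /=; rewrite mulN1r.
Qed.

Lemma dint0 r : dint r (fun=> 0) = 0.
Proof.
by rewrite /dint Rintegral_cst ?mul0r //; exact: measurable_discr.
Qed.

Lemma dint_sum r N (F : nat -> plane -> R[i]) : (forall n, dintegrable r (F n)) ->
  dintegrable r (fun p => \sum_(n < N) F n p) /\
  dint r (fun p => \sum_(n < N) F n p) = \sum_(n < N) dint r (F n).
Proof.
move=> iF; elim: N => [|N [IH1 IH2]].
  have E : (fun p : plane => \sum_(n < 0) F n p) = (fun=> 0).
    by apply/funext => p; rewrite big_ord0.
  rewrite E big_ord0 dint0; split=> //.
  have := dintegrableZ 0 (iF 0); apply: eq_dintegrable => p _; exact: mul0r.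
have E : (fun p : plane => \sum_(n < N.+1) F n p) = (fun p => \sum_(n < N) F n p + F N p).
  by apply/funext => p; rewrite big_ord_recr.
by rewrite E big_ord_recr /= -IH2; split; [exact: dintegrableD|exact: dintD].
Qed.

Lemma area_discr_lty r : 0 <= r <= 1 -> (area (discr r) < +oo)%E.
Proof.
move=> h; apply: le_lt_trans (@area_disc_lty R).
by apply: le_measure; rewrite ?inE; [exact: measurable_discr|exact: measurable_disc|exact: discr_sub].
Qed.

Lemma bounded_dintegrable r F (M : R) : 0 <= r <= 1 ->
  measurable_fun (discr r) (fun p => complex.Re (F p)) ->
  measurable_fun (discr r) (fun p => complex.Im (F p)) ->
  (forall p, discr r p -> cabs (F p) <= M) -> dintegrable r F.
Proof.
move=> h mR mI FM.
split; apply: measurable_bounded_integrable => //; (try exact: measurable_discr);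
  (try exact: area_discr_lty); exists M; split; rewrite ?num_real // => x Mx p /FM Fp /=;
  rewrite (le_trans _ (le_trans Fp (ltW Mx))) //; [exact: ler_Re_cabs|exact: ler_Im_cabs].
Qed.

Lemma cabs_dint_le r F (M : R) : 0 <= r <= 1 -> dintegrable r F ->
  (forall p, discr r p -> cabs (F p) <= M) ->
  cabs (dint r F) <= 2 * M * fine (area (discr r)).
Proof.
move=> h [iR iI] FM; have mD := measurable_discr r.
have bnd (f : plane -> R) : area.-integrable (discr r) (EFin \o f) ->
   (forall p, discr r p -> `|f p| <= M) ->
   `|\int[area]_(p in discr r) f p| <= M * fine (area (discr r)).
  move=> fi fM; apply: (le_trans (le_normr_Rintegral mD fi)).
  rewrite -Rintegral_cst //; apply: le_Rintegral => //.
  - by have := integrable_abse fi; apply: eq_integrable.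
  - apply: measurable_bounded_integrable => //; first exact: area_discr_lty.
    exact: bounded_cst.
rewrite (le_trans (cabs_le _)) //= -mulrA mulr_natl mulr2n lerD //; apply: bnd => // x /FM;
  apply: le_trans; [exact: ler_Re_cabs|exact: ler_Im_cabs].
Qed.

Lemma cint_open (s : R) (F' : R -> R[i]) : cctsin (- s) s F' -> cint (- s) s F' = 0 ->
  (\int[leb]_(x in `](- s)%R, s[) (complex.Re (F' x))%:E = 0)%E /\
  (\int[leb]_(x in `](- s)%R, s[) (complex.Im (F' x))%:E = 0)%E.
Proof.
move=> /cint_integrable[iR iI] /eqP; rewrite /cint eq_complex /= => /andP[/eqP hR /eqP hI].
have oc (f : R -> R) : leb.-integrable `[- s, s] (EFin \o f) ->
    \int[leb]_(x in `[- s, s]) f x = 0 -> (\int[leb]_(x in `](- s)%R, s[) (f x)%:E = 0)%E.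
  move=> fi; rewrite /Rintegral => f0.
  have mo : measurable_fun `]- s, s[ (EFin \o f).
    by apply: measurable_funS (measurable_int _ fi) => //; exact: subset_itv_oo_cc.
  have [ss|ss] := ltP (- s) s; last first.
    by rewrite set_itv_ge ?integral_set0 // bnd_simp -leNgt.
  rewrite integral_itv_bndo_bndc // integral_itv_obnd_cbnd //; last first.
    by apply: measurable_funS (measurable_int _ fi) => //; exact: subset_itv_oc_cc.
  by rewrite -[LHS]fineK ?f0 //; exact: integrable_fin_num.
by split; exact: oc.
Qed.

Lemma discr_section r (y : R) (x : R) : (x ^+ 2 + y ^+ 2 < r ^+ 2) =
  (x \in `]- Num.sqrt (r ^+ 2 - y ^+ 2), Num.sqrt (r ^+ 2 - y ^+ 2)[).
Proof.
rewrite in_itv /= -ltr_norml -ltrBrDr -sqrtr_sqr.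
have [h|h] := ltP 0 (r ^+ 2 - y ^+ 2); first by rewrite ltr_sqrt.
rewrite (ler0_sqrtr h) [RHS]ltNge sqrtr_ge0 /=.
by apply/negbTE; rewrite -leNgt (le_trans h) // sqr_ge0.
Qed.

(** The fundamental theorem of calculus on a chord of the disc, at both ends of which u vanishes. *)
Lemma integral_section r (y : R) (u u' : R -> R[i]) :
  (forall x, cder u x (u' x)) -> (forall x, ccts u' x) ->
  (forall x, x ^+ 2 + y ^+ 2 = r ^+ 2 -> u x = 0) ->
  (\int[leb]_(x in [set x | (x ^+ 2 + y ^+ 2 < r ^+ 2)%R]) (complex.Re (u' x))%:E = 0)%E /\
  (\int[leb]_(x in [set x | (x ^+ 2 + y ^+ 2 < r ^+ 2)%R]) (complex.Im (u' x))%:E = 0)%E.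
Proof.
move=> du cu' u0; set s := Num.sqrt (r ^+ 2 - y ^+ 2).
have -> : [set x | (x ^+ 2 + y ^+ 2 < r ^+ 2)%R] = `]- s, s[%classic.
  by apply/seteqP; split => x /=; rewrite discr_section.
have [s0|s0] := leP s 0.
  by rewrite set_itv_ge ?integral_set0 // bnd_simp -leNgt; lra.
have E : s ^+ 2 + y ^+ 2 = r ^+ 2.
  rewrite sqr_sqrtr ?subrK //; apply: ltW; rewrite ltNge; apply/negP => h.
  by move: s0; rewrite /s ler0_sqrtr ?ltxx.
apply: cint_open; first by move=> x _; exact: cu'.
by rewrite (cint_FTC _ (fun x _ => du x) (fun x _ => cu' x)) ?u0 ?sqrrN ?subrr //; lra.
Qed.

(** The divergence theorem for functions vanishing on the boundary circle, proved chord by chord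
    with Fubini after extension of the integrand by 0 to the plane. *)
Lemma dint_dx r (u u' : R -> R -> R[i]) :
  dintegrable r (fun p => u' p.1 p.2) ->
  (forall x y, cder (u ^~ y) x (u' x y)) -> (forall x y, ccts (u' ^~ y) x) ->
  (forall x y, x ^+ 2 + y ^+ 2 = r ^+ 2 -> u x y = 0) ->
  dint r (fun p => u' p.1 p.2) = 0.
Proof.
move=> [iR iI] du cu' u0.
have H (f : R -> R -> R) : area.-integrable (discr r) (EFin \o (fun p : plane => f p.1 p.2)) ->
   (forall y, (\int[leb]_(x in [set x | (x ^+ 2 + y ^+ 2 < r ^+ 2)%R]) (f x y)%:E = 0)%E) ->
   \int[area]_(p in discr r) f p.1 p.2 = 0.
  move=> fi f0; rewrite /Rintegral integral_mkcond.
  have fi' : (leb \x leb)%E.-integrable setT ((EFin \o (fun p : plane => f p.1 p.2)) \_ (discr r)).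
    exact: (integrable_mkcond _ (measurable_discr r)).1.
  rewrite -[X in fine X](integral21_prod_meas1 fi') /fubini_G integral0_eq // => y _.
  rewrite -[RHS](f0 y) [RHS]integral_mkcond; apply: eq_integral => x _.
  by rewrite !patchE; congr (if _ then _ else _); apply/idP/idP; rewrite !inE.
rewrite /dint (H (fun x y => complex.Re (u' x y))) //; last first.
  by move=> y; case: (@integral_section r y (u ^~ y) (u' ^~ y)) => // x; exact: u0.
rewrite (H (fun x y => complex.Im (u' x y))) //.
by move=> y; case: (@integral_section r y (u ^~ y) (u' ^~ y)) => // x; exact: u0.
Qed.

Lemma dint_dy r (u u' : R -> R -> R[i]) :
  dintegrable r (fun p => u' p.1 p.2) ->
  (forall x y, cder (u x) y (u' x y)) -> (forall x y, ccts (u' x) y) ->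
  (forall x y, x ^+ 2 + y ^+ 2 = r ^+ 2 -> u x y = 0) ->
  dint r (fun p => u' p.1 p.2) = 0.
Proof.
move=> [iR iI] du cu' u0.
have H (f : R -> R -> R) : area.-integrable (discr r) (EFin \o (fun p : plane => f p.1 p.2)) ->
   (forall x, (\int[leb]_(y in [set y | (y ^+ 2 + x ^+ 2 < r ^+ 2)%R]) (f x y)%:E = 0)%E) ->
   \int[area]_(p in discr r) f p.1 p.2 = 0.
  move=> fi f0; rewrite /Rintegral integral_mkcond.
  have fi' : (leb \x leb)%E.-integrable setT ((EFin \o (fun p : plane => f p.1 p.2)) \_ (discr r)).
    exact: (integrable_mkcond _ (measurable_discr r)).1.
  rewrite -[X in fine X](integral12_prod_meas1 fi') /fubini_F integral0_eq // => x _.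
  rewrite -[RHS](f0 x) [RHS]integral_mkcond; apply: eq_integral => y _.
  by rewrite !patchE; congr (if _ then _ else _); apply/idP/idP; rewrite !inE /discr /= addrC.
rewrite /dint (H (fun x y => complex.Re (u' x y))) //; last first.
  by move=> x; case: (@integral_section r x (u x) (u' x)) => // y; rewrite addrC; exact: u0.
rewrite (H (fun x y => complex.Im (u' x y))) //.
by move=> x; case: (@integral_section r x (u x) (u' x)) => // y; rewrite addrC; exact: u0.
Qed.

(** The vertical sections have length 2 sqrt(r^2 - x^2); the substitution x = r sin t leads to 2 r^2
    cos^2 t, with primitive r^2 (t + sin t cos t). *)
Lemma area_discr r : 0 < r -> area (discr r) = (pi * r ^+ 2)%:E.
Proof.
move=> r0.
have -> : area (discr r) = (\int[leb]_(x in `[(- r)%R, r]) (2 * Num.sqrt (r ^+ 2 - x ^+ 2))%:E)%E.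
  rewrite [RHS]integral_mkcond /area; apply: eq_integral => x _ /=.
  have -> : xsection (discr r) x = `]- Num.sqrt (r ^+ 2 - x ^+ 2), Num.sqrt (r ^+ 2 - x ^+ 2)[%classic.
    apply/seteqP; split => y; [move=> /xsectionP|move=> h; apply/xsectionP; move: h];
      by rewrite /discr /= -discr_section [x ^+ 2 + _]addrC.
  rewrite lebesgue_measure_itv /= lte_fin patchE mem_setE in_itv /= -ler_norml.
  have -> : (`|x| <= r) = (0 <= r ^+ 2 - x ^+ 2).
    by rewrite subr_ge0 -[x ^+ 2]real_normK ?num_real // ler_pXn2r // nnegrE ltW.
  case: ifPn => [h|]; case: ifPn => h'.
  - by rewrite -EFinB; congr EFin; lra.
  - by move: h; rewrite ler0_sqrtr ?oppr0 ?ltxx // ltW // ltNge.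
  - rewrite -leNgt => h; congr EFin; have := sqrtr_ge0 (r ^+ 2 - x ^+ 2); lra.
  - by [].
have pi20 : (0 : R) < pi / 2 by rewrite divr_gt0 ?pi_gt0.
have dF (x : R) : is_derive x 1 (fun t : R => r * sin t : R) (r * cos x).
  have -> : (fun t : R => r * sin t) = r \*: (sin : R -> R) by apply/funext.
  by apply: is_derive_eq.
have dFE : (fun t : R => r * sin t)^`()%classic = (fun t => r * cos t).
  by apply/funext => x; rewrite derive1E; have [_ ->] := dF x.
have cF (x : R) : {for x, continuous (fun t : R => r * sin t)}.
  by apply/differentiable_continuous/derivable1_diffP; have [] := dF x.
have cdF (x : R) : {for x, continuous (fun t : R => r * cos t)}.
  by apply: cvgM; [exact: cvg_cst|exact: continuous_cos].
have := @integration_by_substitution_increasing R (fun t => r * sin t)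
  (fun x => 2 * Num.sqrt (r ^+ 2 - x ^+ 2)) (- (pi / 2)) (pi / 2).
rewrite sinN sin_pihalf mulrN mulr1 dFE => -> //.
- have E : {in `[- (pi / 2), pi / 2], forall t : R,
     ((fun x => 2 * Num.sqrt (r ^+ 2 - x ^+ 2)) \o (fun t => r * sin t)) t * (r * cos t) =
     2 * r ^+ 2 * cos t ^+ 2}.
    move=> t; rewrite in_itv /= => ht.
    have -> : r ^+ 2 - (r * sin t) ^+ 2 = (r * cos t) ^+ 2.
      by rewrite !exprMn cos2sin2; ring.
    rewrite sqrtr_sqr ger0_norm; first by ring.
    by rewrite mulr_ge0 ?(ltW r0) // cos_ge0_pihalf.
  transitivity (\int[leb]_(t in `[(- (pi / 2))%R, (pi / 2)%R]) (2 * r ^+ 2 * cos t ^+ 2)%:E)%E.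
    by apply: eq_integral => t; rewrite mem_setE => /E <-.
  have dG (x : R) : is_derive x 1 (fun t : R => r ^+ 2 * (t + sin t * cos t)) (2 * r ^+ 2 * cos x ^+ 2).
    have -> : (fun t : R => r ^+ 2 * (t + sin t * cos t)) = r ^+ 2 \*: (id + (sin * cos)) :> (R -> R).
      by apply/funext => t.
    by apply: is_derive_eq; rewrite /GRing.scale /= -[cos x ^+ 2]/(cos x * cos x);
      have := sin2cos2 x; rewrite !expr2 => h; rewrite mulrN h; ring.
  rewrite (@continuous_FTC2 R (fun t : R => 2 * r ^+ 2 * cos t ^+ 2) (fun t : R => r ^+ 2 * (t + sin t * cos t))).
  + rewrite cosN cos_pihalf !mulr0 !addr0 -EFinB; congr EFin; by field.
  + lra.
  + apply: continuous_in_subspaceT => x _; apply: cvgM; first exact: cvg_cst.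
    by rewrite !expr2; apply: cvgM; exact: continuous_cos.
  + have cG (x : R) : {for x, continuous (fun t : R => r ^+ 2 * (t + sin t * cos t))}.
      by apply/differentiable_continuous/derivable1_diffP; have [] := dG x.
    split; first by move=> x _; have [] := dG x.
      by apply: cvg_at_right_filter; exact: cG.
    by apply: cvg_at_left_filter; exact: cG.
  + by move=> x _; rewrite derive1E; have [_ ->] := dG x.
- lra.
- by move=> x y hx hy xy /=; rewrite ltr_pM2l // ltr_sin.
- by move=> x _; exact: cdF.
- apply/cvg_ex; exists (r * cos (- (pi / 2))); apply: cvg_at_right_filter; exact: cdF.
- apply/cvg_ex; exists (r * cos (pi / 2)); apply: cvg_at_left_filter; exact: cdF.
- split; first by move=> x _; have [] := dF x.
    by apply: cvg_at_right_filter; exact: cF.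
  by apply: cvg_at_left_filter; exact: cF.
- apply: continuous_in_subspaceT => x _; apply: cvgM; first exact: cvg_cst.
  apply: continuous_comp; last exact: sqrt_continuous.
  by apply: cvgB; [exact: cvg_cst|rewrite !expr2; apply: cvgM; exact: cvg_id].
Qed.

End DiscIntegrals.

(** * Moments of z^a (conj z)^b on discs *)

Section Moments.
Variable R : realType.
Local Notation plane := (measurableTypeR R * measurableTypeR R)%type.
Implicit Types (F G : plane -> R[i]) (r : R).

(** A class stable under products, as integrability is not: polynomials in z and its conjugate
    belong to it by construction and are then integrable on every disc of radius at most 1. *)
Definition dgood F : Prop :=
  [/\ measurable_fun setT (fun p => complex.Re (F p)),
      measurable_fun setT (fun p => complex.Im (F p)) &
      exists M, forall p, @disc R p -> cabs (F p) <= M].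

Lemma dgood_cst z : dgood (fun=> z).
Proof. by split; [exact: measurable_cst|exact: measurable_cst|exists (cabs z)]. Qed.

Lemma dgoodD F G : dgood F -> dgood G -> dgood (fun p => F p + G p).
Proof.
move=> [a b [M HM]] [c d [N HN]]; split.
- rewrite (_ : (fun p => _) = (fun p => complex.Re (F p)) \+ (fun p => complex.Re (G p))).
    exact: measurable_funD.
  by apply/funext => p /=; case: (F p) (G p) => [? ?] [? ?].
- rewrite (_ : (fun p => _) = (fun p => complex.Im (F p)) \+ (fun p => complex.Im (G p))).
    exact: measurable_funD.
  by apply/funext => p /=; case: (F p) (G p) => [? ?] [? ?].
- by exists (M + N) => p h; rewrite (le_trans (cabsD _ _)) // lerD ?HM ?HN.
Qed.

Lemma dgoodM F G : dgood F -> dgood G -> dgood (fun p => F p * G p).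
Proof.
move=> [a b [M HM]] [c d [N HN]]; split.
- rewrite (_ : (fun p => _) = (fun p => complex.Re (F p) * complex.Re (G p)
    - complex.Im (F p) * complex.Im (G p))).
    by apply: measurable_funB; apply: measurable_funM.
  by apply/funext => p /=; case: (F p) (G p) => [? ?] [? ?].
- rewrite (_ : (fun p => _) = (fun p => complex.Re (F p) * complex.Im (G p)
    + complex.Im (F p) * complex.Re (G p))).
    by apply: measurable_funD; apply: measurable_funM.
  by apply/funext => p /=; case: (F p) (G p) => [? ?] [? ?].
- by exists (M * N) => p h; rewrite cabsM ler_pM ?cabs_ge0 ?HM ?HN.
Qed.

Lemma dgoodX F n : dgood F -> dgood (fun p => F p ^+ n).
Proof.
move=> gF; elim: n => [|n IH]; first exact: dgood_cst.
by under eq_fun do rewrite exprS; exact: dgoodM.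
Qed.

Lemma dgood_conj F : dgood F -> dgood (fun p => (F p)^*).
Proof.
move=> [a b [M HM]]; split.
- rewrite (_ : (fun p => _) = (fun p => complex.Re (F p))) //.
  by apply/funext => p /=; case: (F p).
- rewrite (_ : (fun p => _) = (fun p => - complex.Im (F p))).
    exact: measurableT_comp.
  by apply/funext => p /=; case: (F p).
- by exists M => p h; rewrite cabs_conj HM.
Qed.

Lemma dgood_of_plane : dgood (@of_plane R).
Proof.
split; [exact: measurable_fst|exact: measurable_snd|].
by exists 1 => p h; rewrite ltW // disc_cabs.
Qed.

Lemma dgood_dintegrable r F : 0 <= r <= 1 -> dgood F -> dintegrable r F.
Proof.
move=> hr [mR mI [M HM]]; apply: (@bounded_dintegrable _ _ _ M) => //.
- exact: measurable_funTS.
- exact: measurable_funTS.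
- by move=> p /(discr_sub hr) /HM.
Qed.

Definition mono (a b : nat) (p : plane) : R[i] := of_plane p ^+ a * (of_plane p)^* ^+ b.

Lemma dgood_mono a b : dgood (mono a b).
Proof.
by apply: dgoodM; apply: dgoodX; [|apply: dgood_conj]; exact: dgood_of_plane.
Qed.

Lemma dint_mono_conj r a b : 0 <= r <= 1 -> dint r (mono a b) = (dint r (mono b a))^*.
Proof.
move=> hr; rewrite -dint_conj; last exact: dgood_dintegrable (dgood_mono b a).
apply: eq_dint => p _; rewrite /mono rmorphM !rmorphXn /=.
by rewrite mulrC opprK.
Qed.

(* The integral over the disc of the d/dz derivative of
   (r^2 - |z|^2) z^a (conj z)^b vanishes. *)
Lemma dint_mono_rec r a b : 0 < r <= 1 ->
  a.+1%:R * dint r (mono a b.+1) = a%:R * (r ^+ 2)%:C * dint r (mono a.-1 b).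
Proof.
move=> /andP[r0 r1]; have hr : 0 <= r <= 1 by rewrite ltW.
pose Z (p : plane) := of_plane p; pose Zb (p : plane) := (of_plane p)^*.
pose w (p : plane) : R[i] := (r ^+ 2)%:C - Z p * Zb p.
pose dz (p : plane) := a%:R * Z p ^+ a.-1 * Zb p ^+ b.
pose dzb (p : plane) := b%:R * Z p ^+ a * Zb p ^+ b.-1.
pose u x y := w (x, y) * mono a b (x, y).
pose ux x y := - (Z (x, y) + Zb (x, y)) * mono a b (x, y) + w (x, y) * (dz (x, y) + dzb (x, y)).
pose uy x y := 'i * (Z (x, y) - Zb (x, y)) * mono a b (x, y)
  + w (x, y) * ('i * (dz (x, y) - dzb (x, y))).
have gZ : dgood Z by exact: dgood_of_plane.
have gZb : dgood Zb by exact: dgood_conj.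
have gN F : dgood F -> dgood (fun p => - F p).
  move=> gF; rewrite (_ : (fun p => _) = (fun p => -1 * F p)).
    by apply: dgoodM => //; exact: dgood_cst.
  by apply/funext => p; rewrite mulN1r.
have gw : dgood w by apply: dgoodD; [exact: dgood_cst|apply/gN; exact: dgoodM].
have gdz : dgood dz.
  by apply: dgoodM; [apply: dgoodM; [exact: dgood_cst|exact: dgoodX]|exact: dgoodX].
have gdzb : dgood dzb.
  by apply: dgoodM; [apply: dgoodM; [exact: dgood_cst|exact: dgoodX]|exact: dgoodX].
have gm := dgood_mono a b.
have gux : dgood (fun p => ux p.1 p.2).
  rewrite (_ : (fun p => _) = (fun p => - (Z p + Zb p) * mono a b p + w p * (dz p + dzb p))).
    by apply: dgoodD; apply: dgoodM => //; [apply/gN|]; exact: dgoodD.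
  by apply/funext => -[].
have guy : dgood (fun p => uy p.1 p.2).
  rewrite (_ : (fun p => _) = (fun p => 'i * (Z p - Zb p) * mono a b p + w p * ('i * (dz p - dzb p)))).
    apply: dgoodD; apply: dgoodM => //; apply: dgoodM; (try exact: dgood_cst);
      by apply: dgoodD => //; exact: gN.
  by apply/funext => -[].
have dZx x y : cder (fun x => Z (x, y)) x 1.
  by split; [exact: is_derive_id|exact: is_derive_cst].
have dZy x y : cder (fun y => Z (x, y)) y 'i.
  by split; [exact: is_derive_cst|exact: is_derive_id].
have dZbx x y : cder (fun x => Zb (x, y)) x 1.
  by apply: (cder_eq (cder_conj (dZx x y))); rewrite rmorph1.
have dZby x y : cder (fun y => Zb (x, y)) y (- 'i).
  apply: (cder_eq (cder_conj (dZy x y))); by apply/eqP; rewrite eq_complex /= oppr0 !eqxx.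
have u0 x y : x ^+ 2 + y ^+ 2 = r ^+ 2 -> u x y = 0.
  move=> h; rewrite /u /w -h /Z /Zb /of_plane /= [X in X * _](_ : _ = 0) ?mul0r //.
  by apply/eqP; rewrite eq_complex /=; apply/andP; split; apply/eqP; ring.
have Ex : dint r (fun p => ux p.1 p.2) = 0.
  apply: (@dint_dx _ _ u) => //; first exact: dgood_dintegrable.
    move=> x y; apply: cder_eq.
      apply: cderM; first (apply: cderD; first exact: cder_cst).
        rewrite (_ : (fun t => - _) = (fun t => -1 * (Z (t, y) * Zb (t, y)))); last first.
          by apply/funext => t; rewrite mulN1r.
        by apply: cderZ; apply: cderM; [exact: dZx|exact: dZbx].
      by apply: cderM; apply: cderX; [exact: dZx|exact: dZbx].
    rewrite /ux /w /dz /dzb /mono -/(Z (x, y)) -/(Zb (x, y)); ring.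
  move=> x y; have cZ := cder_ccts (dZx x y); have cZb := cder_ccts (dZbx x y).
  apply: cctsD; apply: cctsM.
  - by apply: cctsN; apply: cctsD.
  - by apply: cctsM; apply: cctsX.
  - by apply: cctsB; [exact: ccts_cst|exact: cctsM].
  - by apply: cctsD; (apply: cctsM; last exact: cctsX);
      (apply: cctsM; [exact: ccts_cst|exact: cctsX]).
have Ey : dint r (fun p => uy p.1 p.2) = 0.
  apply: (@dint_dy _ _ u) => //; first exact: dgood_dintegrable.
    move=> x y; apply: cder_eq.
      apply: cderM; first (apply: cderD; first exact: cder_cst).
        rewrite (_ : (fun t => - _) = (fun t => -1 * (Z (x, t) * Zb (x, t)))); last first.
          by apply/funext => t; rewrite mulN1r.
        by apply: cderZ; apply: cderM; [exact: dZy|exact: dZby].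
      by apply: cderM; apply: cderX; [exact: dZy|exact: dZby].
    rewrite /uy /w /dz /dzb /mono -/(Z (x, y)) -/(Zb (x, y)) /=.
    rewrite -['i%C]/('i%R : R[i]); ring.
  move=> x y; have cZ := cder_ccts (dZy x y); have cZb := cder_ccts (dZby x y).
  apply: cctsD; apply: cctsM.
  - by apply: cctsM; [exact: ccts_cst|exact: cctsB].
  - by apply: cctsM; apply: cctsX.
  - by apply: cctsB; [exact: ccts_cst|exact: cctsM].
  - by apply: cctsM; [exact: ccts_cst|]; apply: cctsB; (apply: cctsM; last exact: cctsX);
      (apply: cctsM; [exact: ccts_cst|exact: cctsX]).
have im a' b' : dintegrable r (mono a' b').
  exact: dgood_dintegrable (dgood_mono a' b').
have : dint r (fun p => ux p.1 p.2 + - 'i * uy p.1 p.2) = 0.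
  rewrite dintD; [|exact: dgood_dintegrable|apply: dintegrableZ; exact: dgood_dintegrable].
  by rewrite dintZ ?Ex ?Ey ?mulr0 ?addr0 //; exact: dgood_dintegrable.
(* The combination [ux] - i [uy] is twice the d/dz derivative. At a = 0 the truncated exponent
   [a.-1] comes with the factor 0. *)
rewrite (@eq_dint _ _ _ (fun p => -2 * a.+1%:R * mono a b.+1 p + 2 * a%:R * (r ^+ 2)%:C * mono a.-1 b p)).
  rewrite dintD; [|exact: dintegrableZ|exact: dintegrableZ].
  rewrite !dintZ // => /eqP; rewrite addrC addr_eq0 => /eqP h.
  have n2 : 2 != 0 :> R[i] by rewrite pnatr_eq0.
  by apply: (mulfI n2); rewrite !mulrA h; ring.
have ii : 'i * 'i = -1 :> R[i] by rewrite -expr2 sqrCi.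
move=> [x y] _ /=; rewrite /ux /uy /w /dz /dzb.
have mE a' b' : mono a' b' (x, y) = Z (x, y) ^+ a' * Zb (x, y) ^+ b' by [].
rewrite !mE.
move: (Z _) (Zb _) (r ^+ 2)%:C => A B C.
have -> : - (A + B) * (A ^+ a * B ^+ b) +
  (C - A * B) * (a%:R * A ^+ a.-1 * B ^+ b + b%:R * A ^+ a * B ^+ b.-1) +
  - 'i * ('i * (A - B) * (A ^+ a * B ^+ b) +
   (C - A * B) * ('i * (a%:R * A ^+ a.-1 * B ^+ b - b%:R * A ^+ a * B ^+ b.-1))) =
  - (A + B) * (A ^+ a * B ^+ b) +
  (C - A * B) * (a%:R * A ^+ a.-1 * B ^+ b + b%:R * A ^+ a * B ^+ b.-1) -
  ('i * 'i) * ((A - B) * (A ^+ a * B ^+ b) +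
   (C - A * B) * (a%:R * A ^+ a.-1 * B ^+ b - b%:R * A ^+ a * B ^+ b.-1)) by ring.
rewrite ii; case: a {u ux uy dz dzb gdz gdzb gm gux guy u0 Ex Ey} => [|a] /=.
  by rewrite exprS; ring.
by rewrite !exprS -[a.+2%:R]natr1; ring.
Qed.

(** The recursion lowers both exponents. For a < b it ends at exponent 0 of z, where its right-hand
    side vanishes; conjugation gives the case a > b; on the diagonal it ends at the area of the
    disc. *)
Lemma dint_mono r a b : 0 < r <= 1 ->
  dint r (mono a b) = if a == b then (pi * r ^+ (2 * a).+2 / a.+1%:R)%:C else 0.
Proof.
move=> hr; have hr' : 0 <= r <= 1 by case/andP: hr => /ltW-> ->.
have lt0 a' b' : (a' < b')%N -> dint r (mono a' b') = 0.
  elim: a' b' => [|a' IH] [//|b'] h.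
    by have := dint_mono_rec 0 b' hr; rewrite !mul0r mul1r.
  have := dint_mono_rec a'.+1 b' hr; rewrite /= IH // mulr0.
  by move/eqP; rewrite mulf_eq0 pnatr_eq0 /= => /eqP.
case: ltngtP => [h|h|->].
- exact: lt0.
- by rewrite dint_mono_conj // lt0 // rmorph0.
elim: b => [|b IH].
  rewrite muln0 divr1 /dint.
  transitivity ((fine (area (discr r)))%:C); last by rewrite area_discr //; case/andP: hr.
  have mD := measurable_discr r; congr (_ +i* _).
    rewrite -[RHS]mul1r -Rintegral_cst //; apply: eq_Rintegral => p _.
    by rewrite /mono !expr0 mulr1.
  rewrite -[RHS](mul0r (fine (area (discr r)))) -Rintegral_cst //.
  by apply: eq_Rintegral => p _; rewrite /mono !expr0 mulr1.
have := dint_mono_rec b.+1 b hr; rewrite /= IH => h.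
have n0 : b.+2%:R != 0 :> R[i] by rewrite pnatr_eq0.
apply: (mulfI n0); rewrite h.
have natC n : n%:R = n%:R%:C :> R[i] by rewrite rmorph_nat.
rewrite !natC -!rmorphM /=; congr (_ %:C).
rewrite mulnS !exprS; field.
have h2 k : k.+1%:R + b%:R != 0 :> R by rewrite -natrD pnatr_eq0.
by rewrite (h2 0%N) (h2 1%N).
Qed.


End Moments.

(** * Inner product spaces *)

Section InnerProduct.
Variables (R : realType) (H : lmodType R[i]) (ip : {dot H for Num.conj}).
Implicit Types (x y z : H) (u : nat -> H).

Lemma ipDl x y z : ip (x + y) z = ip x z + ip y z.
Proof. exact: linearDl. Qed.

Lemma ipBl x y z : ip (x - y) z = ip x z - ip y z.
Proof. exact: linearBl. Qed.

Lemma ipZl a x y : ip (a *: x) y = a * ip x y.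
Proof. exact: linearZl_LR. Qed.

Lemma ipC x y : ip x y = (ip y x)^*.
Proof. by rewrite hermC expr0 mul1r. Qed.

Lemma ipDr x y z : ip z (x + y) = ip z x + ip z y.
Proof. exact: linearDr. Qed.

Lemma ipZr a x y : ip x (a *: y) = a^* * ip x y.
Proof. exact: linearZr_LR. Qed.

Lemma ip0l x : ip 0 x = 0. Proof. exact: linear0l. Qed.
Lemma ip0r x : ip x 0 = 0. Proof. exact: linear0r. Qed.

Lemma ip_suml n (F : 'I_n -> H) y : ip (\sum_(k < n) F k) y = \sum_(k < n) ip (F k) y.
Proof. exact: linear_sumlz. Qed.

Definition nsq x : R := complex.Re (ip x x).

Lemma ip_nsq x : ip x x = (nsq x)%:C.
Proof.
have := dnorm_ge0 ip x; rewrite /nsq lecE /= => /andP[/eqP h _].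
by case: (ip x x) h => a b /= ->.
Qed.

Lemma nsq_ge0 x : 0 <= nsq x.
Proof. by have := dnorm_ge0 ip x; rewrite ip_nsq lecR. Qed.

Lemma nsq_eq0 x : (nsq x == 0) = (x == 0).
Proof. by rewrite -(dnorm_eq0 ip) ip_nsq -[0 in RHS]/(0%:C) (inj_eq (@complexI R)). Qed.

Lemma ipnorm_sq x : ipnorm ip x ^+ 2 = nsq x.
Proof. by rewrite /ipnorm sqr_sqrtr // nsq_ge0. Qed.

Lemma ipnorm_ge0 x : 0 <= ipnorm ip x.
Proof. exact: sqrtr_ge0. Qed.

Lemma ipnorm_le x (M : R) : 0 <= M -> (ipnorm ip x <= M) = (nsq x <= M ^+ 2).
Proof. by move=> M0; rewrite -ipnorm_sq ler_pXn2r // nnegrE ipnorm_ge0. Qed.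

Lemma nsqD x y : nsq (x + y) = nsq x + nsq y + 2 * complex.Re (ip x y).
Proof.
rewrite /nsq ipDl !ipDr (ipC y x).
by case: (ip x x) (ip x y) (ip y y) => [? ?] [? ?] [? ?] /=; ring.
Qed.

Lemma nsqZ a x : nsq (a *: x) = cabs a ^+ 2 * nsq x.
Proof.
by rewrite /nsq ipZl ipZr ip_nsq -sqnormE /sqnorm; case: a => ? ? /=; ring.
Qed.

Lemma nsqN x : nsq (- x) = nsq x.
Proof. by rewrite -scaleN1r nsqZ cabsN cabs1 expr1n mul1r. Qed.

Lemma nsqB x y : nsq (x - y) = nsq x + nsq y - 2 * complex.Re (ip x y).
Proof.
rewrite nsqD nsqN -scaleN1r ipZr; case: (ip x y) => a b /=.
ring.
Qed.

(** Nonnegativity of the squared norm of x minus its projection on the line of y. *)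
Lemma ip_cauchy_schwarz x y : cabs (ip x y) <= ipnorm ip x * ipnorm ip y.
Proof.
have [->|y0] := eqVneq y 0; first by rewrite ip0r cabs0 mulr_ge0 ?ipnorm_ge0.
have N0 : 0 < nsq y by rewrite lt_def nsq_eq0 y0 nsq_ge0.
have := nsq_ge0 (x - (ip x y * (nsq y)^-1%:C) *: y).
rewrite nsqB nsqZ ipZr cabsM cabsR exprMn real_normK ?num_real //.
rewrite (_ : complex.Re _ = cabs (ip x y) ^+ 2 / nsq y); last first.
  by rewrite -sqnormE /sqnorm; case: (ip x y) => a b /=; ring.
have -> : cabs (ip x y) ^+ 2 * (nsq y)^-1 ^+ 2 * nsq y = cabs (ip x y) ^+ 2 / nsq y.
  by field; rewrite gt_eqF.
set q := _ / _ => h; have {}h : q <= nsq x by lra.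
rewrite -(@ler_pXn2r _ 2) ?nnegrE ?mulr_ge0 ?cabs_ge0 ?ipnorm_ge0 //.
by rewrite exprMn !ipnorm_sq -ler_pdivrMr.
Qed.

Lemma ipnormD x y : ipnorm ip (x + y) <= ipnorm ip x + ipnorm ip y.
Proof.
rewrite ipnorm_le ?addr_ge0 ?ipnorm_ge0 // nsqD sqrrD !ipnorm_sq.
have := le_trans (ler_norm _) (le_trans (ler_Re_cabs _) (ip_cauchy_schwarz x y)).
lra.
Qed.

Lemma ipnormN x : ipnorm ip (- x) = ipnorm ip x.
Proof. by rewrite /ipnorm -/(nsq _) nsqN. Qed.

Lemma ipnormBC x y : ipnorm ip (x - y) = ipnorm ip (y - x).
Proof. by rewrite -ipnormN opprB. Qed.

Lemma ipnormZ a x : ipnorm ip (a *: x) = cabs a * ipnorm ip x.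
Proof. by rewrite /ipnorm -!/(nsq _) nsqZ sqrtrM ?sqr_ge0 // sqrtr_sqr ger0_norm ?cabs_ge0. Qed.

Lemma ipnorm_eq0 x : (ipnorm ip x == 0) = (x == 0).
Proof. by rewrite sqrtr_eq0 -nsq_eq0 eq_le nsq_ge0 andbT. Qed.

Lemma ipnorm0 : ipnorm ip 0 = 0.
Proof. by apply/eqP; rewrite ipnorm_eq0. Qed.

Lemma ip_cvgP u x : ip_cvg ip u x <-> forall e : R, 0 < e ->
  exists N, forall n, (N <= n)%N -> ipnorm ip (u n - x) < e.
Proof.
split.
  move/cvgrPdist_lt => h e /h[N _ {}h]; exists N => n Nn.
  by have := h n Nn; rewrite /= sub0r normrN ger0_norm ?ipnorm_ge0.
move=> h; apply/cvgrPdist_lt => e /h[N {}h]; exists N => // n /= Nn.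
by rewrite sub0r normrN ger0_norm ?ipnorm_ge0 ?h.
Qed.

Lemma ip_cvg_orth u x y : ip_cvg ip u x -> (forall n, ip (u n) y = 0) -> ip x y = 0.
Proof.
move=> /ip_cvgP ux uy; apply/eqP; rewrite -cabs_eq0 eq_le cabs_ge0 andbT.
apply/ler_addgt0Pl => e e0; rewrite addr0.
have [N hN] := ux _ (divr_gt0 e0 (ltr_pwDr ltr01 (ipnorm_ge0 y))).
have {}hN := hN N (leqnn _).
have -> : ip x y = - ip (u N - x) y by rewrite ipBl uy sub0r opprK.
rewrite cabsN (le_trans (ip_cauchy_schwarz _ _)) //.
have y1 : 0 < ipnorm ip y + 1 by have := ipnorm_ge0 y; lra.
apply: (@le_trans _ _ (e / (ipnorm ip y + 1) * (ipnorm ip y + 1))).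
  by rewrite ler_pM ?ipnorm_ge0 ?(ltW hN) //; lra.
by rewrite divfK // gt_eqF.
Qed.

Lemma linear_span0 (A : set H) : linear_span A 0.
Proof.
by exists 0%N, (fun=> 0), (fun=> 0); split=> [[]//|]; rewrite big_ord0.
Qed.

Lemma linear_spanD (A : set H) x y : linear_span A x -> linear_span A y ->
  linear_span A (x + y).
Proof.
move=> [m [c [v [Av ->]]]] [n [d [w [Aw ->]]]].
exists (m + n)%N, (fun i => match fintype.split i with inl j => c j | inr k => d k end),
  (fun i => match fintype.split i with inl j => v j | inr k => w k end); split.
  by move=> i; case: fintype.split.
rewrite big_split_ord /=; congr (_ + _); apply: eq_bigr => i _.
  by case: fintype.split (@unsplitK m n (inl i)) => //= j [->].
by case: fintype.split (@unsplitK m n (inr i)) => //= j [->].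
Qed.

Lemma linear_span1 (A : set H) a x : A x -> linear_span A (a *: x).
Proof.
by move=> Ax; exists 1%N, (fun=> a), (fun=> x); split => //; rewrite big_ord1.
Qed.

Lemma linear_span_sum (A : set H) n (F : nat -> H) :
  (forall k, linear_span A (F k)) -> linear_span A (\sum_(k < n) F k).
Proof.
move=> h; elim: n => [|n IH]; first by rewrite big_ord0; exact: linear_span0.
by rewrite big_ord_recr /=; apply: linear_spanD.
Qed.

Section Orthonormal.
Variable u : nat -> H.
Hypothesis ou : forall m n, ip (u m) (u n) = (m == n)%:R.

Definition oproj n x := \sum_(k < n) ip x (u k) *: u k.

Lemma oprojD n x y : oproj n (x + y) = oproj n x + oproj n y.
Proof.
rewrite /oproj -big_split; apply: eq_bigr => k _.
by rewrite ipDl scalerDl.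
Qed.

Lemma oprojZ n a x : oproj n (a *: x) = a *: oproj n x.
Proof.
by rewrite /oproj scaler_sumr; apply: eq_bigr => k _; rewrite ipZl scalerA.
Qed.

Lemma oprojB n x y : oproj n (x - y) = oproj n x - oproj n y.
Proof. by rewrite oprojD -scaleN1r oprojZ scaleN1r. Qed.

Lemma ip_oproj n x k : ip (oproj n x) (u k) = if (k < n)%N then ip x (u k) else 0.
Proof.
rewrite /oproj ip_suml; under eq_bigr do rewrite ipZl ou.
case: ifP => kn.
  rewrite (bigD1 (Ordinal kn)) //= eqxx mulr1 big1 ?addr0 // => i ik.
  by rewrite (_ : (i : nat) == k = false) ?mulr0 //; apply/negbTE.
rewrite big1 // => i _; case: eqP => [ik|]; last by rewrite mulr0.
by rewrite -ik ltn_ord in kn.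
Qed.

Lemma nsq_oproj n x : nsq (oproj n x) = \sum_(k < n) cabs (ip x (u k)) ^+ 2.
Proof.
rewrite /nsq {1}/oproj ip_suml.
rewrite (eq_bigr (fun k : 'I_n => ((cabs (ip x (u k)) ^+ 2)%:C : R[i]))); last first.
  move=> k _; rewrite ipZl [ip (u k) _]ipC ip_oproj ltn_ord -sqnormE /sqnorm.
  by case: (ip x (u k)) => a b /=; apply/eqP; rewrite eq_complex /=;
    apply/andP; split; apply/eqP; ring.
by rewrite -rmorph_sum.
Qed.

Lemma ip_oproj_self n x : ip x (oproj n x) = (nsq (oproj n x))%:C.
Proof.
have : ip (x - oproj n x) (oproj n x) = 0.
  rewrite ipC {1}/oproj ip_suml big1 ?rmorph0 // => k _.
  by rewrite ipZl [ip (u k) _]ipC ipBl ip_oproj ltn_ord subrr rmorph0 mulr0.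
by rewrite ipBl ip_nsq => /eqP; rewrite subr_eq0 => /eqP.
Qed.

Lemma nsqB_oproj n x : nsq (x - oproj n x) = nsq x - \sum_(k < n) cabs (ip x (u k)) ^+ 2.
Proof. by rewrite nsqB ip_oproj_self /= nsq_oproj; ring. Qed.

Lemma bessel n x : \sum_(k < n) cabs (ip x (u k)) ^+ 2 <= nsq x.
Proof. by rewrite -subr_ge0 -nsqB_oproj nsq_ge0. Qed.

Lemma oproj_basis n k : (k < n)%N -> oproj n (u k) = u k.
Proof.
move=> kn; rewrite /oproj (bigD1 (Ordinal kn)) //= ou eqxx scale1r big1 ?addr0 // => i ik.
by rewrite ou (_ : k == (i : nat) = false) ?scale0r // eq_sym; apply/negbTE.
Qed.

Lemma oproj_span x : linear_span (range u) x ->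
  exists N, forall n, (N <= n)%N -> oproj n x = x.
Proof.
move=> [m [c [v [Av ->]]]]; elim: m c v Av => [|m IH] c v Av.
  exists 0%N => n _; rewrite big_ord0 /oproj big1 // => k _.
  by rewrite ip0l scale0r.
have [N hN] := IH (fun i => c (widen_ord (leqnSn m) i)) _ (fun i => Av (widen_ord (leqnSn m) i)).
have [k _ kv] := Av ord_max; exists (maxn N k.+1) => n; rewrite geq_max => /andP[Nn kn].
by rewrite big_ord_recr oprojD hN // oprojZ -kv oproj_basis.
Qed.

(** If v is in the span and n is large, x - oproj n x is the same expression for x - v, hence no
    longer than x - v. With its converse [cvg_oproj_span] this describes the closed span by
    convergence of expansions, which makes its linearity and closedness easy. *)
Lemma oproj_cvg x : closed_span ip (range u) x -> ip_cvg ip (oproj ^~ x) x.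
Proof.
move=> [v [sv /ip_cvgP vx]]; apply/ip_cvgP => e /vx[M /(_ M (leqnn _)) hM].
have [N hN] := oproj_span (sv M); exists N => n Nn.
apply: le_lt_trans hM; rewrite [leRHS]ipnormBC ipnormBC ipnorm_le ?ipnorm_ge0 // ipnorm_sq.
have -> : x - oproj n x = (x - v M) - oproj n (x - v M) by rewrite oprojB hN // opprB addrA subrK.
by rewrite nsqB_oproj gerBl sumr_ge0 // => k _; exact: sqr_ge0.
Qed.

Lemma cvg_oproj_span x : ip_cvg ip (oproj ^~ x) x -> closed_span ip (range u) x.
Proof.
move=> h; exists (oproj ^~ x); split=> // n; apply: (@linear_span_sum _ n (fun k => ip x (u k) *: u k)) => k.
by apply: linear_span1; exists k.
Qed.

Lemma cvg_oproj_lin a x y : ip_cvg ip (oproj ^~ x) x -> ip_cvg ip (oproj ^~ y) y ->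
  ip_cvg ip (oproj ^~ (a *: x + y)) (a *: x + y).
Proof.
move=> cx cy; apply: (@squeeze_cvgr _ _ _ _ (fun=> 0) (fun n => cabs a * ipnorm ip (oproj n x - x) + ipnorm ip (oproj n y - y))).
- apply: nearW => n; rewrite ipnorm_ge0 /= oprojD oprojZ opprD addrACA -scalerBr.
  by rewrite (le_trans (ipnormD _ _)) // ipnormZ.
- exact: cvg_cst.
- rewrite -[X in _ --> X](addr0 0) -[X in _ --> X + _](mulr0 (cabs a)).
  by apply: cvgD => //; apply: cvgM => //; exact: cvg_cst.
Qed.

Lemma parseval x : ip_cvg ip (oproj ^~ x) x ->
  (fun n => \sum_(k < n) cabs (ip x (u k)) ^+ 2) @ \oo --> nsq x.
Proof.
move=> cx; have c2 := cvgM cx cx.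
have -> : (fun n => \sum_(k < n) cabs (ip x (u k)) ^+ 2) =
  (fun n => nsq x - ipnorm ip (oproj n x - x) ^+ 2).
  by apply/funext => n; rewrite ipnorm_sq -[nsq (_ - x)]nsqN opprB nsqB_oproj opprB addrC subrK.
rewrite -[X in _ --> X]subr0 -[X in _ --> _ - X](mulr0 0).
by apply: cvgB; [exact: cvg_cst|exact: c2].
Qed.

(** Parseval's identity as an unordered sum, the form that can be reindexed along injections and
    bijections. *)
Lemma parseval_esum x : ip_cvg ip (oproj ^~ x) x ->
  (\esum_(k in [set: nat]) (cabs (ip x (u k)) ^+ 2)%:E = (nsq x)%:E)%E.
Proof.
move=> /parseval h; rewrite -nneseries_esumT; last by move=> n; rewrite lee_fin sqr_ge0.
apply/cvg_lim => //; rewrite (_ : (fun n => _) =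
   EFin \o (fun n => \sum_(k < n) cabs (ip x (u k)) ^+ 2)).
  by apply: cvg_EFin; [exact: nearW|exact: h].
by apply/funext => n /=; rewrite big_mkord sumEFin.
Qed.

Lemma orth_basis_eq0 x : ip_cvg ip (oproj ^~ x) x -> (forall k, ip x (u k) = 0) -> x = 0.
Proof.
move=> /ip_cvgP cx h; apply/eqP; rewrite -ipnorm_eq0 eq_le ipnorm_ge0 andbT.
apply/ler_addgt0Pl => e /cx[N /(_ N (leqnn _))]; rewrite addr0 => /ltW.
by rewrite /oproj big1 ?sub0r ?ipnormN // => k _; rewrite h scale0r.
Qed.

End Orthonormal.
End InnerProduct.

(** * Completeness of the basis of the Bergman space *)

Section BergmanBasis.
Variable R : realType.
Local Notation plane := (measurableTypeR R * measurableTypeR R)%type.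
Local Notation ip := (@bergman_ip R).
Local Notation ebas := (@Defs.basis R).
Implicit Types (f g : bergman R).

Let r01 : 0 < (1 : R) <= 1.
Proof. by rewrite ltr01 lexx. Qed.

Lemma l2ip_dint (f g : R[i] -> R[i]) :
  l2ip f g = (pi^-1)%:C * dint 1 (fun p => f (of_plane p) * (g (of_plane p))^*).
Proof. by rewrite /dint discr1. Qed.

Lemma sqint_dintegrable (f g : R[i] -> R[i]) : square_integrable f ->
  square_integrable g -> dintegrable 1 (fun p => f (of_plane p) * (g (of_plane p))^*).
Proof.
move=> sf sg; split; rewrite discr1; [exact: integrable_ReM|exact: integrable_ImM].
Qed.

Lemma dintegrableS (r s : R) (F : plane -> R[i]) : 0 <= r <= s -> dintegrable s F ->
  dintegrable r F.
Proof.
move=> /andP[r0 rs] [iR iI]; have sub : discr r `<=` discr s.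
  by move=> p /= /lt_le_trans; apply; rewrite ler_pXn2r ?nnegrE ?(le_trans r0).
by split; [apply: integrableS iR|apply: integrableS iI] => //; exact: measurable_discr.
Qed.

Lemma basisE n z : `|z| < 1 -> ebas n z = (Num.sqrt n.+1%:R)%:C * z ^+ n.
Proof. by move=> z1; rewrite /= /basis_fun z1. Qed.

Lemma conj_cmono (y : R) (z : R[i]) n : (y%:C * z ^+ n)^* = y%:C * z^* ^+ n.
Proof.
rewrite rmorphM rmorphXn; congr (_ * _).
by apply/eqP; rewrite eq_complex /= oppr0 !eqxx.
Qed.

(** Serves both for the orthonormality of the basis and for the matrix coefficients of the
    H-Toeplitz operator, whose symbol times K e_k has the form of f. *)
Lemma l2ip_cmono (f g : R[i] -> R[i]) (a b c : nat) (x y : R) :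
  (forall z, `|z| < 1 -> f z = x%:C * (z ^+ a * z^* ^+ c)) ->
  (forall z, `|z| < 1 -> g z = y%:C * z ^+ b) ->
  l2ip f g = if a == (b + c)%N then (x * y / a.+1%:R)%:C else 0.
Proof.
move=> hf hg; rewrite l2ip_dint.
have hr : 0 <= (1 : R) <= 1 by rewrite ler01 lexx.
rewrite (@eq_dint _ _ _ (fun p => (x * y)%:C * mono a (b + c) p)); last first.
  move=> p; rewrite discr1 => pd; rewrite hf // hg // [X in _ * X](conj_cmono y (of_plane p) b) rmorphM /mono exprD /=; ring.
rewrite dintZ; last exact: dgood_dintegrable (dgood_mono _ _ _).
rewrite dint_mono //; case: eqP => // _; last by rewrite !mulr0.
rewrite -!rmorphM /=; congr (_ %:C); rewrite expr1n mulr1.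
by rewrite mulrCA [_^-1 * _]mulrA mulVf ?mul1r // gt_eqF // pi_gt0.
Qed.

Lemma basis_orthonormal m n : ip (ebas m) (ebas n) = (m == n)%:R.
Proof.
rewrite /bergman_ip (@l2ip_cmono _ _ m n 0 (Num.sqrt m.+1%:R) (Num.sqrt n.+1%:R)).
- rewrite addn0; case: eqP => // <-.
  by rewrite -expr2 sqr_sqrtr ?ler0n // divff // pnatr_eq0.
- by move=> z z1; rewrite basisE // expr0 mulr1.
- by move=> z z1; rewrite basisE.
Qed.

Let coef f n := (Num.sqrt n.+1%:R)%:C * ip f (ebas n).

Let J f n (r : R) := dint r (fun p => f (of_plane p) * (ebas n (of_plane p))^*).

(** The expansion converges uniformly on the disc of radius r < rho, and by orthogonality of the
    monomials on that disc only its n-th term contributes. *)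
Lemma taylor_dint f (a : nat -> R[i]) (C rho r : R) n : 0 < r < rho -> rho < 1 ->
  (forall z, cabs z < rho -> forall N, cabs (f z - \sum_(n < N) a n * z ^+ n) <=
    C * (cabs z / rho) ^+ N / (rho - cabs z)) -> 0 <= C ->
  J f n r = a n * (pi * r ^+ (2 * n).+2 / Num.sqrt n.+1%:R)%:C.
Proof.
move=> /andP[r0 rrho] rho1 fa C0.
have hr : 0 <= r <= 1 by rewrite ltW //= ltW // (lt_trans rrho).
have hr' : 0 < r <= 1 by rewrite r0 //= ltW // (lt_trans rrho).
have iJ : dintegrable r (fun p => f (of_plane p) * (ebas n (of_plane p))^*).
  by apply: dintegrableS hr _; apply: sqint_dintegrable; exact: bergman_sqint.
have pr p : discr r p -> cabs (of_plane p) < r /\ `|of_plane p| < 1.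
  move=> /= h; have E : cabs (of_plane p) < r.
    by rewrite -(@ltr_pXn2r _ 2) ?nnegrE ?cabs_ge0 ?ltW // -sqnormE.
  by split => //; rewrite -[1]/(1%:C) lt_norm_cabs (lt_trans E) // (lt_trans rrho).
pose sn : R := Num.sqrt n.+1%:R.
have sn0 : 0 < sn by rewrite sqrtr_gt0 ltr0n.
have im k : dintegrable r (fun p => (a k * sn%:C) * mono k n p).
  by apply: dintegrableZ; exact: dgood_dintegrable (dgood_mono _ _ _).
apply/eqP; rewrite -subr_eq0 -cabs_eq0 eq_le cabs_ge0 andbT.
pose D := 2 * (C / (rho - r) * sn) * fine (area (discr r)).
have q01 : 0 <= r / rho < 1.
  by rewrite divr_ge0 ?(ltW r0) ?(ltW (lt_trans r0 rrho)) //= ltr_pdivrMr ?mul1r // (lt_trans r0).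
apply: (@geometric_bound_eq0 _ _ D (r / rho) q01).
(* The n-th term belongs to the partial sum only for N > n; the bound for smaller N is weaker since
   r/rho < 1. *)
have H N : (n < N)%N -> cabs (J f n r - a n * (pi * r ^+ (2 * n).+2 / sn)%:C) <= D * (r / rho) ^+ N.
  move=> nN.
  have -> : a n * (pi * r ^+ (2 * n).+2 / sn)%:C =
      dint r (fun p => \sum_(k < N) (a k * sn%:C) * mono k n p).
    rewrite (dint_sum N im).2 (bigD1 (Ordinal nN)) //= big1 ?addr0.
      rewrite dintZ; last exact: dgood_dintegrable (dgood_mono _ _ _).
      rewrite dint_mono // eqxx -[RHS]mulrA; congr (_ * _); rewrite -rmorphM /=; congr (_%:C).
      have -> : n.+1%:R = sn ^+ 2 by rewrite sqr_sqrtr // ler0n.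
      by field; rewrite gt_eqF.
    move=> k kn; rewrite dintZ; last exact: dgood_dintegrable (dgood_mono _ _ _).
    rewrite dint_mono // (_ : (k : nat) == n = false) ?mulr0 //.
    by apply/negbTE.
  have -> : J f n r - dint r (fun p => \sum_(k < N) (a k * sn%:C) * mono k n p) =
    dint r (fun p => f (of_plane p) * (ebas n (of_plane p))^* +
       -1 * \sum_(k < N) (a k * sn%:C) * mono k n p).
    rewrite dintD //; last by apply: dintegrableZ; exact: (dint_sum N im).1.
    by rewrite dintZ ?mulN1r //; exact: (dint_sum N im).1.
  have -> : D * (r / rho) ^+ N = 2 * (C * (r / rho) ^+ N / (rho - r) * sn) * fine (area (discr r)).
    by rewrite /D; ring.
  apply: cabs_dint_le => //.
    by apply: dintegrableD => //; apply: dintegrableZ; exact: (dint_sum N im).1.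
  move=> p /pr[pr1 pr2]; rewrite basisE //.
  set z := of_plane p in pr1 pr2 *.
  have -> : f z * (sn%:C * z ^+ n)^* + -1 * (\sum_(k < N) a k * sn%:C * mono k n p) =
     (f z - \sum_(k < N) a k * z ^+ k) * (sn%:C * z ^+ n)^*.
    rewrite mulN1r mulrBl; congr (_ - _); rewrite mulr_suml; apply: eq_bigr => k _.
    by rewrite [X in _ = _ * X](conj_cmono sn z n) /mono -/z; ring.
  rewrite cabsM cabs_conj cabsM cabsR cabsX ger0_norm ?(ltW sn0) //.
  apply: ler_pM; rewrite ?cabs_ge0 ?mulr_ge0 ?exprn_ge0 ?cabs_ge0 ?(ltW sn0) //.
    apply: le_trans (fa z _ N) _; first exact: lt_trans pr1 rrho.
    rewrite -!mulrA ler_wpM2l //; apply: ler_pM.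
    - by rewrite exprn_ge0 // divr_ge0 ?cabs_ge0 // ltW // (lt_trans r0).
    - by rewrite invr_ge0 subr_ge0 ltW // (lt_trans pr1).
    - apply: lerXn2r; rewrite ?nnegrE ?divr_ge0 ?cabs_ge0 ?(ltW r0) ?(ltW (lt_trans r0 rrho)) //.
      by rewrite ler_pM2r ?invr_gt0 ?(lt_trans r0) // ltW.
    - by rewrite lef_pV2 ?posrE ?subr_gt0 ?(lt_trans pr1) //; lra.
  by rewrite ler_piMr ?(ltW sn0) // exprn_ile1 ?cabs_ge0 // ltW // (lt_trans pr1) // (lt_trans rrho).
move=> N; apply: le_trans (H (maxn n.+1 N) _) _; first by rewrite leq_maxl.
rewrite ler_wpM2l //.
  apply: mulr_ge0; last exact: fine_ge0.
  by rewrite mulr_ge0 // mulr_ge0 ?(ltW sn0) // divr_ge0 // subr_ge0 ltW.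
case/andP: q01 => q0 q1; apply: ler_wiXn2l => //; [exact: ltW|exact: leq_maxr].
Qed.

Lemma dint_cvg (F : plane -> R[i]) (r : nat -> R) : dintegrable 1 F ->
  (forall k, 0 < r k < 1) -> r @ \oo --> (1 : R) ->
  forall e, 0 < e -> exists N, forall k, (N <= k)%N -> cabs (dint (r k) F - dint 1 F) < e.
Proof.
move=> [iR iI] r01' r1.
have H (g : plane -> R) : area.-integrable (discr 1) (EFin \o g) ->
   (fun k => \int[area]_(p in discr (r k)) g p) @ \oo --> \int[area]_(p in discr 1) g p.
  move=> ig; have mD := measurable_discr (1 : R).
  have sub k : discr (r k) `<=` discr 1.
    have /andP[h1 h2] := r01' k; move=> p /= /lt_le_trans; apply.
    by rewrite ler_pXn2r ?nnegrE ?ltW.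
  pose g_ k := ((EFin \o g) \_ (discr (r k))).
  have := @dominated_convergence _ _ R area (discr 1) mD g_ (EFin \o g) (fun p => `|(g p)%:E|%E).
  case.
  - move=> k; apply: (measurable_restrict _ _ _).1 => //; first exact: measurable_discr.
    apply: measurable_funS (measurable_int _ ig) => //; exact: subIsetl.
  - exact: measurable_int ig.
  - apply: aeW => p pd; apply: cvg_near_cst.
    have : p.1 ^+ 2 + p.2 ^+ 2 < 1 * 1 by move: pd; rewrite /discr /= expr1n mulr1.
    have rr : (fun k => r k * r k) @ \oo --> (1 * 1 : R) by apply: cvgM.
    move/cvgr_gt: rr => h /h; apply: filterS => k hk.
    by rewrite /g_ patchE mem_set //= expr2.
  - exact: integrable_abse.
  - apply: aeW => p k _; rewrite /g_ patchE; case: ifP => // _.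
    by rewrite abse0 abse_ge0.
  move=> _ _; rewrite /g_ => h.
  have fin : (\int[area]_(x in discr 1) (EFin \o g) x)%E \is a fin_num.
    exact: integrable_fin_num.
  have : (fun k => (\int[area]_(p in discr (r k)) (g p)%:E)%E) @ \oo -->
      (fine (\int[area]_(x in discr 1) (EFin \o g) x)%E)%:E.
    rewrite fineK //; apply: cvg_trans h; apply: near_eq_cvg; apply: nearW => k.
    by rewrite /= -integral_mkcondr (setIidr (sub k)).
  exact: fine_cvg.
have [hR hI] := (H _ iR, H _ iI).
move=> e e0; have e20 : 0 < e / 2 by lra.
move/cvgrPdist_lt/(_ _ e20): hR => [N1 _ H1].
move/cvgrPdist_lt/(_ _ e20): hI => [N2 _ H2].
exists (maxn N1 N2) => k; rewrite geq_max => /andP[/H1 {}H1 /H2 {}H2].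
rewrite cabsBC; apply: le_lt_trans (cabs_le _) _; rewrite (splitr e) /dint /=.
exact: ltrD.
Qed.

(** Taylor expansions are available on discs of radius rho < 1 only, while [coef] is an inner
    product over the whole disc. The two are linked through integrals over discs of radius r,
    computed for all r < 1, and the limit r -> 1. *)
Lemma bergman_taylor f (z : R[i]) (rho : R) : cabs z < rho -> rho < 1 -> exists2 C, 0 <= C &
  forall N, cabs (f z - \sum_(n < N) coef f n * z ^+ n) <= C * (cabs z / rho) ^+ N.
Proof.
move=> zrho rho1; have rho0 := le_lt_trans (cabs_ge0 z) zrho.
have rho01 : 0 < rho < 1 by rewrite rho0.
have hf := bergman_holo (f := f).
have [a [C [C0 Ha]]] := holomorphic_taylor hf rho01.
have aE n : a n = coef f n.
  pose sn : R := Num.sqrt n.+1%:R.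
  have sn0 : 0 < sn by rewrite sqrtr_gt0 ltr0n.
  have iF : dintegrable 1 (fun p => f (of_plane p) * (ebas n (of_plane p))^*).
    by apply: sqint_dintegrable; exact: bergman_sqint.
  (* J r is a constant multiple of r^(2n+2), by Taylor expansions on larger and larger discs *)
  have Jr r : 0 < r < 1 -> J f n r = a n * (pi * r ^+ (2 * n).+2 / sn)%:C.
    move=> /andP[r0 r1].
    pose rho' := Num.max r rho; pose r' := Num.min (r / 2) (rho / 2).
    have rr : rho' < 1 by rewrite gt_max r1.
    (* A radius above both r and rho. The expansions for rho and rho2 are compared on the disc of
       radius rho/2, so that their n-th coefficients agree, and the second one applies at r. *)
    pose rho2 := (1 + rho') / 2.
    have rho2b : [/\ 0 < rho2, rho2 < 1, r < rho2 & rho < rho2].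
      have h1 : r <= rho' by rewrite le_max lexx.
      have h2 : rho <= rho' by rewrite le_max lexx orbT.
      by rewrite /rho2; split; lra.
    have [b0 b1 b2 b3] := rho2b.
    have rho201 : 0 < rho2 < 1 by rewrite b0.
    have [a' [C' [C'0 Ha']]] := holomorphic_taylor hf rho201.
    have r'0 : 0 < rho / 2 by rewrite divr_gt0.
    have H1 := @taylor_dint f a C rho (rho / 2) n; rewrite r'0 in H1.
    have {}H1 := H1 _ rho1 Ha C0.
    have H2 := @taylor_dint f a' C' rho2 (rho / 2) n; rewrite r'0 in H2.
    have {}H2 := H2 _ b1 Ha' C'0.
    have H3 := @taylor_dint f a' C' rho2 r n; rewrite r0 b2 in H3.
    rewrite (H3 isT b1 Ha' C'0); congr (_ * _).
    have K0 : (pi * (rho / 2) ^+ (2 * n).+2 / Num.sqrt n.+1%:R)%:C != 0 :> R[i].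
      rewrite -[0]/(0%:C) (inj_eq (@complexI R)) gt_eqF // divr_gt0 //.
      by rewrite mulr_gt0 ?pi_gt0 // exprn_gt0.
    by apply: (mulIf K0); rewrite -H2 ?H1 //= ; lra.
  (* [k.+2] rather than [k.+1] keeps all these radii positive. *)
  pose rk (k : nat) : R := 1 - k.+2%:R^-1.
  have rk01 k : 0 < rk k < 1.
    rewrite /rk subr_gt0 invf_lt1 ?ltr0n // ltr1n /= ltrBlDr ltrDl invr_gt0 ltr0n //.
  have rk1 : rk @ \oo --> (1 : R).
    rewrite -[X in _ --> X]subr0; apply: cvgB; first exact: cvg_cst.
    have := @cvg_harmonic R; rewrite -(cvg_shiftS (@harmonic R)).
    by apply: cvg_trans; apply: near_eq_cvg; apply: nearW => k.
  pose c0 : R := pi / sn.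
  have c00 : 0 < c0 by rewrite divr_gt0 ?pi_gt0.
  have J1 : J f n 1 = a n * c0%:C.
    apply/eqP; rewrite -subr_eq0 -cabs_eq0 eq_le cabs_ge0 andbT.
    apply/ler_addgt0Pl => e e0; rewrite addr0.
    have [N1 H1] := dint_cvg iF rk01 rk1 (divr_gt0 e0 (ltr0n _ 2)).
    have rn : (fun k => rk k ^+ (2 * n).+2) @ \oo --> (1 ^+ (2 * n).+2 : R).
      elim: (2 * n).+2 => [|m IH]; first by under eq_fun do rewrite expr0; exact: cvg_cst.
      by under eq_fun do rewrite exprS; rewrite exprS; apply: cvgM.
    have e1 : 0 < e / (2 * (cabs (a n) * c0 + 1)).
      by rewrite divr_gt0 // mulr_gt0 // ltr_wpDl // mulr_ge0 ?cabs_ge0 ?(ltW c00).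
    move/cvgrPdist_lt/(_ _ e1): rn => [N2 _ H2].
    have {}H1 := H1 (maxn N1 N2) (leq_maxl _ _).
    have {}H2 := H2 (maxn N1 N2) (leq_maxr _ _).
    set k := maxn N1 N2 in H1 H2; rewrite /= expr1n in H2.
    rewrite -[J f n 1](subrK (J f n (rk k))) -addrA (le_trans (cabsD _ _)) //.
    rewrite (splitr e) lerD //; first by rewrite cabsBC ltW.
    rewrite Jr // (_ : _ - _ = a n * (c0 * (rk k ^+ (2 * n).+2 - 1))%:C); last first.
      by rewrite -mulrBr -rmorphB /=; congr (_ * _%:C); rewrite /c0; field; rewrite gt_eqF.
    rewrite cabsM cabsR normrM (ger0_norm (ltW c00)) mulrA distrC.
    have A0 : 0 <= cabs (a n) * c0 by rewrite mulr_ge0 ?cabs_ge0 ?(ltW c00).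
    set A := cabs (a n) * c0 in A0 H2 *.
    apply: (@le_trans _ _ (A * (e / (2 * (A + 1))))); first by rewrite ler_wpM2l // ltW.
    rewrite mulrA ler_pdivrMr; last by lra.
    rewrite [leRHS](_ : _ = e * (A + 1)); last by field.
    by rewrite mulrC ler_pM2l //; lra.
  rewrite /coef /bergman_ip l2ip_dint -/(J f n 1) J1 -/sn.
  have -> : sn%:C * ((pi^-1)%:C * (a n * c0%:C)) = a n * (sn * (pi^-1 * c0))%:C.
    by rewrite !rmorphM /=; ring.
  rewrite (_ : sn * _ = 1) ?mulr1 // /c0 [pi^-1 * _]mulrA mulVf ?gt_eqF ?pi_gt0 //.
  by rewrite mul1r divff // gt_eqF.
exists (C / (rho - cabs z)); first by rewrite divr_ge0 // subr_ge0 ltW.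
move=> N'; have := Ha z zrho N'; under eq_bigr do rewrite aE.
by rewrite mulrAC.
Qed.

End BergmanBasis.

(** * From pointwise to norm convergence of the expansions *)

Section BergmanComplete.
Variable R : realType.
Local Notation plane := (measurableTypeR R * measurableTypeR R)%type.
Local Notation ip := (@bergman_ip R).
Local Notation ebas := (@Defs.basis R).
Implicit Types (f g : bergman R).

Lemma bergmanD f g z : (f + g) z = f z + g z.
Proof. by []. Qed.

Lemma bergmanZ (a : R[i]) f z : (a *: f) z = a * f z.
Proof. by []. Qed.

Lemma bergmanB f g z : (f - g) z = f z - g z.
Proof. by []. Qed.

Lemma bergman_sum n (F : 'I_n -> bergman R) z : (\sum_(k < n) F k) z = \sum_(k < n) F k z.
Proof. by elim/big_ind2: _ => // f x g y; rewrite bergmanD => -> ->. Qed.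

Lemma nsq_integral f :
  (\int[area]_(p in @disc R) (sqnorm (f (of_plane p)))%:E)%E = (pi * nsq ip f)%:E.
Proof.
have -> : nsq ip f = complex.Re (l2ip f f) by [].
rewrite l2ip_norm /= mulrA divff ?mul1r ?gt_eqF ?pi_gt0 //.
rewrite /Rintegral fineK //; apply: integrable_fin_num.
  exact: measurable_disc.
by have [] := bergman_sqint f.
Qed.

Lemma oproj_bergman_cvg f z : `|z| < 1 ->
  (fun n => complex.Re (oproj ip ebas n f z) : R) @ \oo --> (complex.Re (f z) : R) /\
  (fun n => complex.Im (oproj ip ebas n f z) : R) @ \oo --> (complex.Im (f z) : R).
Proof.
move=> z1; have cz : cabs z < 1 by rewrite -lt_norm_cabs.
pose rho : R := (1 + cabs z) / 2.
have zr : cabs z < rho by rewrite /rho; lra.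
have r1 : rho < 1 by rewrite /rho; lra.
have r0 := le_lt_trans (cabs_ge0 z) zr.
have [C C0 H] := bergman_taylor f zr r1.
have q0 : 0 <= cabs z / rho by rewrite divr_ge0 ?cabs_ge0 // ltW.
have q1 : cabs z / rho < 1 by rewrite ltr_pdivrMr // mul1r.
have cq : (fun n => C * (cabs z / rho) ^+ n) @ \oo --> (C * 0 : R).
  by apply: cvgM; [exact: cvg_cst|apply: cvg_expr; rewrite ger0_norm].
rewrite mulr0 in cq.
have E n : \sum_(k < n) (Num.sqrt k.+1%:R)%:C * ip f (ebas k) * z ^+ k = oproj ip ebas n f z.
  rewrite /oproj bergman_sum; apply: eq_bigr => k _.
  by rewrite bergmanZ basisE // [RHS]mulrCA [RHS]mulrA.
have bnd n : cabs (f z - oproj ip ebas n f z) <= C * (cabs z / rho) ^+ n by rewrite -E.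
split; apply/cvgrPdist_lt => e e0; move/cvgrPdist_lt/(_ _ e0): cq => [N _ HN];
  exists N => // n /HN; rewrite /= sub0r normrN ger0_norm ?mulr_ge0 ?exprn_ge0 //;
  apply: le_lt_trans; apply: le_trans (bnd n).
  rewrite (_ : _ - _ = complex.Re (f z - oproj ip ebas n f z)) ?ler_Re_cabs //.
  by move: (f z) (bergman_fun (oproj _ _ _ _) z) => [? ?] [? ?].
rewrite (_ : _ - _ = complex.Im (f z - oproj ip ebas n f z)) ?ler_Im_cabs //.
by move: (f z) (bergman_fun (oproj _ _ _ _) z) => [? ?] [? ?].
Qed.

(** The partial sums S n converge to f pointwise by the Taylor expansion. Bessel's inequality makes
    the squared norms s n of S n converge, and Fatou's lemma applied to |S (N + M) - S N|^2 as M
    grows bounds the squared norm of f - S N by lim s - s N. *)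
Lemma bergman_oproj_cvg f : ip_cvg ip (oproj ip ebas ^~ f) f.
Proof.
have ob := @basis_orthonormal R.
pose S n := oproj ip ebas n f.
pose s n : R := \sum_(k < n) cabs (ip f (ebas k)) ^+ 2.
have snd : nondecreasing_seq s.
  apply/nondecreasing_seqP => n; rewrite /s big_ord_recr /= lerDl sqr_ge0 //.
have scv : cvgn s by apply: nondecreasing_is_cvgn => //; exists (nsq ip f) => _ [n _ <-]; exact: bessel.
have sle n : s n <= limn s by apply: nondecreasing_cvgn_le.
have SMN M N : (N <= M)%N -> nsq ip (S M - S N) = s M - s N.
  move=> NM; have -> : S N = oproj ip ebas N (S M).
    rewrite /S {1}/oproj; apply: eq_bigr => k _.
    by rewrite ip_oproj // (leq_trans (ltn_ord k)).
  rewrite nsqB_oproj // /S nsq_oproj //; congr (_ - _); apply: eq_bigr => k _.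
  by rewrite ip_oproj // (leq_trans (ltn_ord k)).
have key N : nsq ip (f - S N) <= limn s - s N.
  rewrite -(ler_pM2l (pi_gt0 R)) -lee_fin -nsq_integral.
  pose h M (p : plane) := (sqnorm ((S (N + M)%N - S N) (of_plane p)))%:E.
  have mD := @measurable_disc R.
  have hint M : (\int[area]_(p in @disc R) h M p)%E = (pi * (s (N + M)%N - s N))%:E.
    by rewrite nsq_integral SMN // leq_addr.
  have cvs : (fun M => pi * (s (N + M)%N - s N)) @ \oo --> pi * (limn s - s N).
    apply: cvgM; first exact: cvg_cst.
    apply: cvgB; last exact: cvg_cst.
    have -> : (fun M => s (N + M)%N) = [sequence s (n + N)%N]_n.
      by apply/funext => M; rewrite addnC.
    by rewrite (cvg_shiftn N s).
  have -> : (pi * (limn s - s N))%:E = limn_einf (fun M => (\int[area]_(p in @disc R) h M p)%E).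
    have H : (fun M => (\int[area]_(p in @disc R) h M p)%E) @ \oo --> (pi * (limn s - s N))%:E.
      under eq_fun do rewrite hint.
      by apply: cvg_EFin => //; exact: nearW.
    by rewrite (cvg_limn_einf_sup H).1.
  have mh M : measurable_fun (@disc R) (h M).
    by have [_ _ /measurable_int] := bergman_sqint (S (N + M)%N - S N).
  have h0 M p : @disc R p -> (0 <= h M p)%E by move=> _; rewrite lee_fin sqnorm_ge0.
  apply: le_trans (fatou area mD mh h0).
  rewrite le_eqVlt; apply/orP; left; apply/eqP; apply: eq_integral => p.
  rewrite inE => pd; apply/esym.
  suff H : h^~ p @ \oo --> (sqnorm ((f - S N) (of_plane p)))%:E by rewrite (cvg_limn_einf_sup H).1.
  have [cR cI] := @oproj_bergman_cvg f (of_plane p) pd.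
  have sh (v : nat -> R) (l : R) : v @ \oo --> l -> (fun M => v (N + M)%N) @ \oo --> l.
    have -> : (fun M => v (N + M)%N) = [sequence v (n + N)%N]_n.
      by apply/funext => M; rewrite addnC.
    by rewrite (cvg_shiftn N v).
  set z := of_plane p in cR cI *.
  have dR : (fun M => complex.Re (S (N + M)%N z) - complex.Re (S N z) : R) @ \oo -->
      (complex.Re (f z) - complex.Re (S N z) : R).
    by apply: cvgB; [exact: (sh _ _ cR)|exact: cvg_cst].
  have dI : (fun M => complex.Im (S (N + M)%N z) - complex.Im (S N z) : R) @ \oo -->
      (complex.Im (f z) - complex.Im (S N z) : R).
    by apply: cvgB; [exact: (sh _ _ cI)|exact: cvg_cst].
  apply: cvg_EFin; first exact: nearW.
  have sqE (v w : R[i]) : sqnorm (v - w) =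
     (complex.Re v - complex.Re w) * (complex.Re v - complex.Re w) +
     (complex.Im v - complex.Im w) * (complex.Im v - complex.Im w).
    by case: v w => [? ?] [? ?]; rewrite /sqnorm /= !expr2.
  rewrite bergmanB sqE.
  have -> : fine \o h^~ p = fun M =>
     (complex.Re (S (N + M)%N z) - complex.Re (S N z)) * (complex.Re (S (N + M)%N z) - complex.Re (S N z)) +
     (complex.Im (S (N + M)%N z) - complex.Im (S N z)) * (complex.Im (S (N + M)%N z) - complex.Im (S N z)).
    by apply/funext => M; rewrite -sqE.
  by apply: cvgD; apply: cvgM.
have lim0 : (fun n => limn s - s n) @ \oo --> (0 : R).
  by rewrite -[X in _ --> X](subrr (limn s)); apply: cvgB => //; exact: cvg_cst.
apply/ip_cvgP => e e0; have e20 : 0 < e ^+ 2 by rewrite exprn_gt0.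
move/cvgrPdist_lt/(_ _ e20): lim0 => [N _ HN]; exists N => n /HN /=.
rewrite sub0r normrN ger0_norm ?subr_ge0 // => hn.
rewrite ipnormBC -(@ltr_pXn2r _ 2) ?nnegrE ?ipnorm_ge0 ?(ltW e0) // ipnorm_sq.
by apply: le_lt_trans hn; exact: key.
Qed.

End BergmanComplete.

(** * The space of square-summable functions *)

Lemma conj_realM (R : realType) (y : R) (z : R[i]) : (y%:C * z)^* = y%:C * z^*.
Proof.
rewrite rmorphM; congr (_ * _).
by apply/eqP; rewrite eq_complex /= oppr0 !eqxx.
Qed.

Section RealSums.
Variables (R : realType) (X : choiceType).
Implicit Types (a b c : X -> R).

(** Unordered sums, since the index sets will be pairs of numbers, words, and products of these with
    a set of fibres. *)
Definition ssum a : \bar R := (\esum_(x in [set: X]) (a x)%:E)%E.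

Lemma ssum_ge0 a : (forall x, 0 <= a x) -> (0 <= ssum a)%E.
Proof. by move=> a0; apply: esum_ge0 => x _; rewrite lee_fin. Qed.

Lemma le_ssum a b : (forall x, a x <= b x) -> (ssum a <= ssum b)%E.
Proof. by move=> ab; apply: le_esum => x _; rewrite lee_fin. Qed.

Lemma ssumD a b : (forall x, 0 <= a x) -> (forall x, 0 <= b x) ->
  ssum (fun x => a x + b x) = (ssum a + ssum b)%E.
Proof.
move=> a0 b0; rewrite /ssum -esumD => [|x _|x _]; rewrite ?lee_fin //.
Qed.

Lemma ssum_term a x : (forall x, 0 <= a x) -> ((a x)%:E <= ssum a)%E.
Proof.
move=> a0; apply: esum_ge; exists [set x]; first by split; [exact: finite_set1|].
by rewrite fsbig_set1.
Qed.

Lemma ssum_leP a (M : R) : (forall x, 0 <= a x) ->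
  (forall s : seq X, uniq s -> \sum_(x <- s) a x <= M) -> (ssum a <= M%:E)%E.
Proof.
move=> a0 H; apply: ub_ereal_sup => _ [A [fA _] <-].
rewrite fsbig_finite //= sumEFin lee_fin; apply: H; exact: finmap.fset_uniq.
Qed.

Lemma ssum_ge_seq a (s : seq X) : (forall x, 0 <= a x) -> uniq s ->
  ((\sum_(x <- s) a x)%:E <= ssum a)%E.
Proof.
move=> a0 us; apply: esum_ge; exists [set` s]; first by split.
by rewrite -sumEFin fsbig_seq.
Qed.

Lemma ssumZ (k : R) a : 0 <= k -> (forall x, 0 <= a x) ->
  ssum (fun x => k * a x) = (k%:E * ssum a)%E.
Proof.
have le (k' : R) a' : 0 <= k' -> (forall x, 0 <= a' x) ->
    (ssum (fun x => (k' * a' x)%R) <= k'%:E * ssum a')%E.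
  move=> k0 a0; apply: ub_ereal_sup => _ [A [fA _] <-].
  rewrite fsbig_finite //= sumEFin -mulr_sumr EFinM; apply: lee_wpmul2l; first by rewrite lee_fin.
  by apply: ssum_ge_seq => //; exact: finmap.fset_uniq.
rewrite le_eqVlt => /predU1P[<-|k0] a0.
  rewrite mul0e; apply: esum1 => x _; by rewrite mul0r.
apply/eqP; rewrite eq_le le ?(ltW k0) //=.
have := le k^-1 (fun x => k * a x).
rewrite invr_ge0 ltW // => /(_ isT) H.
have {}H := H (fun x => mulr_ge0 (ltW k0) (a0 x)).
have E : ssum (fun x => k^-1 * (k * a x)) = ssum a.
  by apply: eq_esum => x _; rewrite mulKf // gt_eqF.
rewrite E in H; apply: (le_trans (lee_wpmul2l _ H)); first by rewrite lee_fin ltW.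
by rewrite muleA -EFinM divff ?mul1e // gt_eqF.
Qed.

Definition finsum a : Prop := (ssum a < +oo)%E.

Definition rsummable a : Prop := finsum (fun x => `|a x|).

(** The sum of the positive part minus that of the negative part; meaningful for [rsummable]
    functions, as [fine] sends an infinite sum to 0. *)
Definition rsum a : R := fine (ssum (fun x => Num.max (a x) 0)) - fine (ssum (fun x => Num.max (- a x) 0)).

Lemma ssum_fin a : (forall x, 0 <= a x) -> (ssum a < +oo)%E -> ssum a \is a fin_num.
Proof. by move=> a0 h; rewrite ge0_fin_numE // ssum_ge0. Qed.

(** Any decomposition into a difference of summable nonnegative functions computes the sum, not only
    the one into positive and negative parts; linearity follows from this freedom. *)
Lemma rsum_diff a b c : (forall x, 0 <= b x) -> (forall x, 0 <= c x) ->
  (ssum b < +oo)%E -> (ssum c < +oo)%E -> (forall x, a x = b x - c x) ->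
  rsum a = fine (ssum b) - fine (ssum c).
Proof.
move=> b0 c0 fb fc abc.
have p0 x : 0 <= Num.max (a x) 0 by rewrite le_max lexx orbT.
have n0 x : 0 <= Num.max (- a x) 0 by rewrite le_max lexx orbT.
have fp : finsum (fun x => Num.max (a x) 0).
  apply: le_lt_trans fb; apply: le_ssum => x; rewrite ge_max b0 andbT abc.
  by rewrite gerBl.
have fn : finsum (fun x => Num.max (- a x) 0).
  apply: le_lt_trans fc; apply: le_ssum => x; rewrite ge_max c0 andbT abc.
  by rewrite opprB gerBl.
set ap := (fun x => Num.max (a x) 0) in fp p0 *; set an := (fun x => Num.max (- a x) 0) in fn n0 *.
have : (ssum ap + ssum c = ssum b + ssum an)%E.
  rewrite -!ssumD //; apply: eq_esum => x _; congr EFin; rewrite /ap /an.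
  have := abc x; case: (leP (a x) 0); case: (leP (- a x) 0); lra.
move/(congr1 fine); rewrite !fineD ?ssum_fin // /rsum -/ap -/an; lra.
Qed.

Lemma rsummable_parts a : rsummable a ->
  [/\ finsum (fun x => Num.max (a x) 0), finsum (fun x => Num.max (- a x) 0),
     (forall x, 0 <= Num.max (a x) 0), (forall x, 0 <= Num.max (- a x) 0) &
     (forall x, a x = Num.max (a x) 0 - Num.max (- a x) 0)].
Proof.
move=> h; split.
- by apply: le_lt_trans h; apply: le_ssum => x; rewrite ge_max ler_norm normr_ge0.
- by apply: le_lt_trans h; apply: le_ssum => x; rewrite ge_max normr_ge0 -normrN ler_norm.
- by move=> x; rewrite le_max lexx orbT.
- by move=> x; rewrite le_max lexx orbT.
- move=> x; case: (leP (a x) 0); case: (leP (- a x) 0); lra.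
Qed.

Lemma rsumD a b : rsummable a -> rsummable b ->
  rsum (fun x => a x + b x) = rsum a + rsum b.
Proof.
move=> /rsummable_parts[a1 a2 a3 a4 a5] /rsummable_parts[b1 b2 b3 b4 b5].
rewrite (@rsum_diff _ (fun x => Num.max (a x) 0 + Num.max (b x) 0)
  (fun x => Num.max (- a x) 0 + Num.max (- b x) 0)).
- rewrite !ssumD // !fineD ?ssum_fin // /rsum; lra.
- by move=> x; rewrite addr_ge0.
- by move=> x; rewrite addr_ge0.
- by rewrite /finsum ssumD // lte_add_pinfty.
- by rewrite /finsum ssumD // lte_add_pinfty.
- move=> x; rewrite {1}a5 {1}b5; lra.
Qed.

Lemma rsumN a : rsum (fun x => - a x) = - rsum a.
Proof.
by rewrite /rsum opprB; congr (_ - fine (ssum _)); apply/funext => x; rewrite opprK.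
Qed.

Lemma rsumZ (k : R) a : rsummable a -> rsum (fun x => k * a x) = k * rsum a.
Proof.
have pos (k' : R) a' : 0 <= k' -> rsummable a' -> rsum (fun x => k' * a' x) = k' * rsum a'.
  move=> k0 /rsummable_parts[a1 a2 a3 a4 a5].
  rewrite (@rsum_diff _ (fun x => k' * Num.max (a' x) 0) (fun x => k' * Num.max (- a' x) 0)).
  - by rewrite (ssumZ k0 a3) (ssumZ k0 a4) !fineM ?ssum_fin // -mulrBr.
  - by move=> x; rewrite mulr_ge0.
  - by move=> x; rewrite mulr_ge0.
  - by rewrite (ssumZ k0 a3) lte_mul_pinfty ?lee_fin.
  - by rewrite (ssumZ k0 a4) lte_mul_pinfty ?lee_fin.
  - by move=> x; rewrite {1}a5; lra.
move=> sa; have [k0|k0] := leP 0 k; first exact: pos.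
have <- : rsum (fun x => - (- k * a x)) = rsum (fun x => k * a x).
  by congr rsum; apply/funext => x; rewrite mulNr opprK.
by rewrite rsumN pos ?mulNr ?opprK // oppr_ge0 ltW.
Qed.

Lemma rsum_ge0E a : (forall x, 0 <= a x) -> (ssum a < +oo)%E -> (rsum a)%:E = ssum a.
Proof.
move=> a0 h; rewrite (@rsum_diff _ a (fun=> 0)) //.
- by rewrite [X in _ - fine X](esum1 _) ?subr0 ?fineK ?ssum_fin.
- by rewrite [X in (X < _)%E](esum1 _) ?ltry.
- by move=> x; rewrite subr0.
Qed.

Lemma ssum_reindex a (s s' : X -> X) : cancel s s' -> cancel s' s ->
  ssum (fun x => a (s x)) = ssum a.
Proof.
move=> ss' s's; rewrite /ssum [RHS](@reindex_esum _ _ _ setT setT s) //; split => //.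
- by move=> x y _ _; exact: can_inj ss' x y.
- by move=> x _; exists (s' x).
Qed.

Lemma rsum_reindex a (s s' : X -> X) : cancel s s' -> cancel s' s ->
  rsum (fun x => a (s x)) = rsum a.
Proof.
move=> ss' s's; rewrite /rsum (ssum_reindex (fun x => Num.max (a x) 0) ss' s's).
by rewrite (ssum_reindex (fun x => Num.max (- a x) 0) ss' s's).
Qed.

Lemma eq_rsum a b : (forall x, a x = b x) -> rsum a = rsum b.
Proof. by move=> /funext ->. Qed.

Lemma rsummable_le a b : (forall x, `|a x| <= b x) -> (ssum b < +oo)%E -> rsummable a.
Proof. by move=> ab; apply: le_lt_trans; exact: le_ssum. Qed.

End RealSums.

Section EllTwo.
Variables (R : realType) (X : choiceType).
Implicit Types (f g h : X -> R[i]).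

Definition ell2_pred : {pred X -> R[i]} := fun f =>
  `[< (ssum (fun x => sqnorm (f x)) < +oo)%E >].

Record ell2 := Ell2 {
  ell2_fun :> X -> R[i];
  ell2_funP : ell2_fun \in ell2_pred }.

HB.instance Definition _ := [isSub for ell2_fun].
HB.instance Definition _ := [Choice of ell2 by <:].

Lemma ell2_predP f : reflect (ssum (fun x => sqnorm (f x)) < +oo)%E (f \in ell2_pred).
Proof. exact: asboolP. Qed.

Lemma sqnorm_lin (a z w : R[i]) :
  sqnorm (a * z + w) <= (2 * sqnorm a) * sqnorm z + 2 * sqnorm w.
Proof.
rewrite !sqnormE.
have h := cabsD (a * z) w; rewrite cabsM in h.
have := cabs_ge0 (a * z + w); have := cabs_ge0 a; have := cabs_ge0 z; have := cabs_ge0 w.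
move: (cabs _) (cabs a) (cabs z) (cabs w) h => s x y t h t0 y0 x0 s0.
apply: (@le_trans _ _ ((x * y + t) ^+ 2)).
  by rewrite ler_pXn2r ?nnegrE // addr_ge0 // mulr_ge0.
by have := sqr_ge0 (x * y - t); rewrite !sqrrD; nra.
Qed.

Lemma ell2_submod_closed : submod_closed ell2_pred.
Proof.
split.
  apply/ell2_predP; rewrite [X in (X < _)%E](esum1 _) ?ltry // => x _.
  by rewrite /sqnorm /= expr0n addr0.
move=> a f g /ell2_predP sf /ell2_predP sg; apply/ell2_predP.
apply: (@le_lt_trans _ _ (ssum (fun x => (2 * sqnorm a) * sqnorm (f x) + 2 * sqnorm (g x)))).
  by apply: le_ssum => x; exact: sqnorm_lin.
have a0 : 0 <= 2 * sqnorm a by rewrite mulr_ge0 // sqnorm_ge0.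
rewrite ssumD ?ssumZ //; try by move=> x; rewrite ?mulr_ge0 ?sqnorm_ge0.
by rewrite lte_add_pinfty // lte_mul_pinfty // ?lee_fin.
Qed.

HB.instance Definition _ :=
  GRing.isSubmodClosed.Build _ _ ell2_pred ell2_submod_closed.
HB.instance Definition _ := [SubChoice_isSubLmodule of ell2 by <:].

Definition ell2_ip (f g : ell2) : R[i] :=
  rsum (fun x => complex.Re (f x * (g x)^*)) +i*
  rsum (fun x => complex.Im (f x * (g x)^*)).

Lemma ell2_sq_lty (f : ell2) : (ssum (fun x => sqnorm (f x)) < +oo)%E.
Proof. exact/ell2_predP/ell2_funP. Qed.

Lemma ell2_summable (f g : ell2) :
  rsummable (fun x => complex.Re (f x * (g x)^*)) /\
  rsummable (fun x => complex.Im (f x * (g x)^*)).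
Proof.
have fg : finsum (fun x => sqnorm (f x) + sqnorm (g x)).
  rewrite /finsum ssumD; try by move=> x; exact: sqnorm_ge0.
  by rewrite lte_add_pinfty // ell2_sq_lty.
have bnd x : cabs (f x * (g x)^*) <= sqnorm (f x) + sqnorm (g x).
  rewrite cabsM cabs_conj !sqnormE.
  have := cabs_ge0 (f x); have := cabs_ge0 (g x); have := sqr_ge0 (cabs (f x) - cabs (g x)).
  rewrite sqrrB; nra.
by split; apply: rsummable_le fg => x; apply: le_trans (bnd x); [exact: ler_Re_cabs|exact: ler_Im_cabs].
Qed.

Lemma ell2_ip_hermitian (f g : ell2) : ell2_ip f g = (-1) ^+ false * (ell2_ip g f)^*.
Proof.
rewrite expr0 mul1r /ell2_ip; apply/eqP; rewrite eq_complex /=; apply/andP; split; apply/eqP.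
  by apply: eq_rsum => x; rewrite !ReM_conj; ring.
by rewrite -rsumN; apply: eq_rsum => x; rewrite !ImM_conj; ring.
Qed.

Lemma ell2_linl (h : ell2) : linear_for *%R (ell2_ip ^~ h).
Proof.
move=> a f g; have [fR fI] := ell2_summable f h; have [gR gI] := ell2_summable g h.
have sZ (k : R) (b : X -> R) : rsummable b -> rsummable (fun x => k * b x).
  move=> sb; rewrite /rsummable /finsum; apply: (@le_lt_trans _ _ (ssum (fun x => `|k| * `|b x|))).
    by apply: le_ssum => x; rewrite normrM.
  by rewrite ssumZ // lte_mul_pinfty // ?lee_fin.
have sD (b c : X -> R) : rsummable b -> rsummable c -> rsummable (fun x => b x + c x).
  move=> sb sc; rewrite /rsummable /finsum; apply: (@le_lt_trans _ _ (ssum (fun x => `|b x| + `|c x|))).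
    by apply: le_ssum => x; exact: ler_normD.
  by rewrite ssumD // lte_add_pinfty.
rewrite /ell2_ip; apply/eqP; rewrite eq_complex; apply/andP; split; apply/eqP => /=.
  rewrite (@eq_rsum _ _ _ (fun x => (complex.Re a * complex.Re (f x * (h x)^*) +
    - complex.Im a * complex.Im (f x * (h x)^*)) + complex.Re (g x * (h x)^*))); last first.
    move=> x; transitivity (complex.Re ((a * f x + g x) * (h x)^*)); first by [].
    rewrite mulrDl -mulrA.
    by move: (f x * _) (g x * _) => [? ?] [? ?]; case: (a) => ? ? /=; ring.
  have s1 := sZ (complex.Re a) _ fR; have s2 := sZ (- complex.Im a) _ fI.
  rewrite (rsumD (sD _ _ s1 s2) gR) (rsumD s1 s2) (rsumZ _ fR) (rsumZ _ fI).
  by case: (a) => ? ? /=; rewrite mulNr.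
rewrite (@eq_rsum _ _ _ (fun x => (complex.Re a * complex.Im (f x * (h x)^*) +
    complex.Im a * complex.Re (f x * (h x)^*)) + complex.Im (g x * (h x)^*))); last first.
  move=> x; transitivity (complex.Im ((a * f x + g x) * (h x)^*)); first by [].
  rewrite mulrDl -mulrA.
  by move: (f x * _) (g x * _) => [? ?] [? ?]; case: (a) => ? ? /=; ring.
have s1 := sZ (complex.Re a) _ fI; have s2 := sZ (complex.Im a) _ fR.
rewrite (rsumD (sD _ _ s1 s2) gI) (rsumD s1 s2) (rsumZ _ fI) (rsumZ _ fR).
by case: (a).
Qed.

Lemma ell2_ip_bilinear : bilinear_for *%R (Num.conj \; *%R) ell2_ip.
Proof.
split; first exact: ell2_linl.
move=> h a f g /=.
rewrite ell2_ip_hermitian [ell2_ip h f]ell2_ip_hermitian [ell2_ip h g]ell2_ip_hermitian.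
by rewrite !expr0 !mul1r ell2_linl rmorphD rmorphM.
Qed.

Lemma ell2_ip_norm (f : ell2) : ell2_ip f f = (rsum (fun x => sqnorm (f x)))%:C.
Proof.
rewrite /ell2_ip; congr (_ +i* _).
  by apply: eq_rsum => x; rewrite ReM_conj /sqnorm !expr2.
rewrite (@eq_rsum _ _ _ (fun=> 0)); last by move=> x; rewrite ImM_conj mulrC subrr.
by rewrite /rsum oppr0 subrr.
Qed.

Lemma ell2_ip_gt0 (f : ell2) : f != 0 -> 0 < ell2_ip f f.
Proof.
move=> f0; have [x fx] : exists x, f x != 0.
  apply: contrapT => nf; move/eqP: f0; apply; apply: val_inj; apply/funext => x /=.
  by apply: contrapT => /eqP h; apply: nf; exists x.
rewrite ell2_ip_norm ltcR.
rewrite -lte_fin rsum_ge0E ?ell2_sq_lty //; last by move=> ?; exact: sqnorm_ge0.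
apply: lt_le_trans (ssum_term x _); last by move=> ?; exact: sqnorm_ge0.
by rewrite lte_fin sqnormE exprn_gt0 // cabs_gt0.
Qed.

HB.instance Definition _ :=
  bilinear_isBilinear.Build R[i] ell2 ell2 _ *%R (Num.conj \; *%R)
    ell2_ip ell2_ip_bilinear.
HB.instance Definition _ :=
  isHermitianSesquilinear.Build R[i] ell2 false Num.conj ell2_ip
    ell2_ip_hermitian.
HB.instance Definition _ :=
  isDotProduct.Build R[i] ell2 ell2_ip ell2_ip_gt0.

Lemma ell2_nsq (f : ell2) : (nsq ell2_ip f)%:E = ssum (fun x => sqnorm (f x)).
Proof.
have -> : nsq ell2_ip f = complex.Re (ell2_ip f f) by [].
rewrite ell2_ip_norm /= rsum_ge0E ?ell2_sq_lty // => x; exact: sqnorm_ge0.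
Qed.

Lemma ell2B (f g : ell2) x : (f - g) x = f x - g x.
Proof. by []. Qed.

Lemma ell2_coord_le (f : ell2) x : cabs (f x) <= ipnorm ell2_ip f.
Proof.
rewrite -(@ler_pXn2r _ 2) ?nnegrE ?cabs_ge0 ?ipnorm_ge0 // ipnorm_sq -sqnormE.
rewrite -lee_fin ell2_nsq; apply: (ssum_term x) => y; exact: sqnorm_ge0.
Qed.

Lemma real_cauchy_cvg (v : nat -> R) :
  (forall e : R, 0 < e -> exists N, forall m n, (N <= m)%N -> (N <= n)%N -> `|v m - v n| < e) ->
  cvgn v.
Proof.
move=> H; apply/cauchy_cvgP/cauchy_exP => e e0; have [N HN] := H e e0.
by exists (v N), N => // n /= Nn; exact: HN.
Qed.

(** The limit is taken coordinatewise. The Cauchy estimate passes to the limit on each finite set of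
    indices, and then to the supremum over these sets. *)
Lemma ell2_complete : ip_complete ell2_ip.
Proof.
move=> u cu.
have cR x : cvgn (fun n => complex.Re (u n x) : R).
  apply: real_cauchy_cvg => e /cu[N HN]; exists N => m n Nm Nn.
  apply: le_lt_trans (HN m n Nm Nn); apply: le_trans (ell2_coord_le _ x).
  rewrite ell2B (_ : _ - _ = complex.Re (u m x - u n x)) ?ler_Re_cabs //.
  by case: (u m x) (u n x) => [? ?] [? ?].
have cI x : cvgn (fun n => complex.Im (u n x) : R).
  apply: real_cauchy_cvg => e /cu[N HN]; exists N => m n Nm Nn.
  apply: le_lt_trans (HN m n Nm Nn); apply: le_trans (ell2_coord_le _ x).
  rewrite ell2B (_ : _ - _ = complex.Im (u m x - u n x)) ?ler_Im_cabs //.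
  by case: (u m x) (u n x) => [? ?] [? ?].
pose l x : R[i] := limn (fun n => complex.Re (u n x)) +i* limn (fun n => complex.Im (u n x)).
have sqE (v w : R[i]) : sqnorm (v - w) =
     (complex.Re v - complex.Re w) * (complex.Re v - complex.Re w) +
     (complex.Im v - complex.Im w) * (complex.Im v - complex.Im w).
  by case: v w => [? ?] [? ?]; rewrite /sqnorm /= !expr2.
have cvx n x : (fun m => sqnorm (u n x - u m x)) @ \oo --> sqnorm (u n x - l x).
  have dR : (fun m => complex.Re (u n x) - complex.Re (u m x) : R) @ \oo -->
     (complex.Re (u n x) - complex.Re (l x) : R).
    by apply: cvgB; [exact: cvg_cst|exact: cR].
  have dI : (fun m => complex.Im (u n x) - complex.Im (u m x) : R) @ \oo -->
     (complex.Im (u n x) - complex.Im (l x) : R).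
    by apply: cvgB; [exact: cvg_cst|exact: cI].
  by under eq_fun do rewrite sqE; rewrite sqE; apply: cvgD; apply: cvgM.
have bnd e : 0 < e -> exists N, forall n, (N <= n)%N ->
    (ssum (fun x => sqnorm (u n x - l x)%R) <= (e ^+ 2)%:E)%E.
  move=> e0; have [N HN] := cu e e0; exists N => n Nn.
  apply: ssum_leP => [x|s us]; first exact: sqnorm_ge0.
  have cs : (fun m => \sum_(x <- s) sqnorm (u n x - u m x)) @ \oo --> \sum_(x <- s) sqnorm (u n x - l x).
    elim: (s) => [|x s' IH].
      by under eq_fun do rewrite big_nil; rewrite big_nil; exact: cvg_cst.
    under eq_fun do rewrite big_cons; rewrite big_cons.
    by apply: cvgD; [exact: cvx|exact: IH].
  apply: (@closed_cvg _ _ \oo _ _ (fun y => y <= e ^+ 2) _ _ _ cs); first exact: closed_le.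
  exists N => // m /= Nm.
  rewrite -lee_fin (le_trans (ssum_ge_seq (a := fun x => sqnorm ((u n - u m) x)) _ us)) //.
    by move=> x; exact: sqnorm_ge0.
  rewrite -ell2_nsq lee_fin -ipnorm_sq ler_pXn2r ?nnegrE ?ipnorm_ge0 ?(ltW e0) //.
  by rewrite ltW // HN.
have lin : l \in ell2_pred.
  have [N HN] := bnd 1 ltr01.
  have d2 : (fun x => u N x - l x) \in ell2_pred.
    by apply/ell2_predP; rewrite (le_lt_trans (HN N (leqnn N))) // ltry.
  have -> : l = (-1) *: (fun x => u N x - l x) + u N.
    apply/funext => x; rewrite -[RHS]/((-1) * (u N x - l x) + u N x); ring.
  by apply: ell2_submod_closed.2 => //; exact: ell2_funP.
exists (Ell2 lin); apply/ip_cvgP => e e0.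
have e20 : 0 < e / 2 by lra.
have [N HN] := bnd _ e20; exists N => n /HN.
rewrite (_ : ssum _ = ssum (fun x => sqnorm ((u n - Ell2 lin) x))) // -ell2_nsq lee_fin.
rewrite -ipnorm_le ?(ltW e20) // => h; apply: le_lt_trans h _; lra.
Qed.

(** * Weighted permutations as normal operators *)

Section WeightedPermutation.
Variables (s s' : X -> X) (th : X -> R).
Hypotheses (ss' : cancel s s') (s's : cancel s' s).
Hypotheses (th01 : forall x, 0 <= th x <= 1) (ths : forall x, th (s x) = th x).

Lemma wperm_pred (f : ell2) (r r' : X -> X) : cancel r r' -> cancel r' r ->
  (fun x => (th x)%:C * f (r x)) \in ell2_pred.
Proof.
move=> rr' r'r; apply/ell2_predP.
apply: le_lt_trans (ell2_sq_lty f); rewrite -(ssum_reindex (fun x => sqnorm (f x)) rr' r'r).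
apply: le_ssum => x; rewrite !sqnormE cabsM exprMn ler_piMl ?sqr_ge0 // cabsR.
by case/andP: (th01 x) => h0 h1; rewrite ger0_norm // exprn_ile1.
Qed.

Definition wperm (f : ell2) : ell2 := Ell2 (wperm_pred f s's ss').
Definition wperm_adj (f : ell2) : ell2 := Ell2 (wperm_pred f ss' s's).

(** The weight is real and invariant under the permutation, so the operator is the product of a
    unitary and of a commuting self-adjoint multiplication. *)
Lemma wperm_normal : normal_operator ell2_ip wperm.
Proof.
have ths' x : th (s' x) = th x by rewrite -{2}(s's x) ths.
split.
  split.
    move=> a f g; apply: val_inj; apply/funext => x /=.
    rewrite -[LHS]/((th x)%:C * (a * f (s' x) + g (s' x))).
    rewrite -[RHS]/(a * ((th x)%:C * f (s' x)) + (th x)%:C * g (s' x)); ring.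
  exists 1 => f; rewrite mul1r ipnorm_le ?ipnorm_ge0 // ipnorm_sq -lee_fin !ell2_nsq.
  rewrite -(ssum_reindex (fun x => sqnorm (f x)) s's ss').
  apply: le_ssum => x; rewrite /= !sqnormE cabsM exprMn ler_piMl ?sqr_ge0 // cabsR.
  by case/andP: (th01 x) => h0 h1; rewrite ger0_norm // exprn_ile1.
exists wperm_adj; split.
  move=> f g; rewrite -[LHS]/(ell2_ip (wperm f) g) -[RHS]/(ell2_ip f (wperm_adj g)).
  have E x : wperm f (s x) * (g (s x))^* = f x * (wperm_adj g x)^*.
    rewrite [wperm_adj g x]/((th x)%:C * g (s x)) [X in _ = _ * X](conj_realM (th x) (g (s x))).
    by rewrite /= ths ss'; ring.
  rewrite /ell2_ip; congr (_ +i* _).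
    rewrite -(rsum_reindex (fun x => complex.Re (wperm f x * (g x)^*)) ss' s's).
    by apply: eq_rsum => x; rewrite E.
  rewrite -(rsum_reindex (fun x => complex.Im (wperm f x * (g x)^*)) ss' s's).
  by apply: eq_rsum => x; rewrite E.
move=> f; apply: val_inj; apply/funext => x /=.
by rewrite ths ths' ss' s's.
Qed.

End WeightedPermutation.
End EllTwo.

(** * Normal extensions *)

Lemma ssum_pair (R : realType) (X Y : choiceType) (a : X -> Y -> R) (b : X -> R) :
  (forall x y, 0 <= a x y) -> (forall x, ssum (a x) = (b x)%:E) ->
  ssum (fun p : X * Y => a p.1 p.2) = ssum b.
Proof.
move=> a0 ab; rewrite /ssum -[LHS](_ : (\esum_(x in [set: X]) \esum_(y in [set: Y]) (a x y)%:E)%E = _).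
  by apply: eq_esum => x _; exact: ab.
rewrite esum_esum; last by move=> x y _ _; rewrite lee_fin.
by congr (esum _ _); apply/seteqP; split=> -[x y].
Qed.

Lemma ssum_extend (R : realType) (X Z : choiceType) (j : X -> Z) (oj : Z -> option X)
    (a : X -> R) : pcancel j oj -> ocancel oj j ->
  ssum (fun z => if oj z is Some x then a x else 0) = ssum a.
Proof.
move=> jK ojK; pose b z := ((if oj z is Some x then a x else 0)%:E : \bar R).
have -> : ssum a = (\esum_(z in range j) b z)%E.
  rewrite (reindex_esum [set: X] (range j) j); first by apply: eq_esum => x _; rewrite /b jK.
  by apply: inj_bij => x y _ _; exact: pcan_inj jK x y.
rewrite esum_mkcond; apply: eq_esum => z _; case: ifPn => //; rewrite notin_setE.
by case E : (oj z) => [x|] // []; exists x => //; have := ojK z; rewrite E.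
Qed.

Lemma partial_inverse (X Z : choiceType) (j : X -> Z) : injective j ->
  exists oj : Z -> option X, pcancel j oj /\ ocancel oj j.
Proof.
move=> ij; exists (fun z => if pselect (exists x, j x = z) is left e then Some (sval (cid e)) else None).
split=> [x|z].
  by case: pselect => [e|[]]; [case: cid => y /= /ij ->|exists x].
by case: pselect => // e /=; case: cid.
Qed.

Lemma bessel_ssum (R : realType) (H : lmodType R[i]) (ip : {dot H for Num.conj}) (u : nat -> H)
    (ou : forall m n, ip (u m) (u n) = (m == n)%:R) x :
  (ssum (fun k => (cabs (ip x (u k)) ^+ 2)%R) <= (nsq ip x)%:E)%E.
Proof.
apply: ssum_leP => [k|s us]; first by exact: sqr_ge0.
apply: le_trans (bessel ou (\max_(k <- s) k).+1 x).
rewrite -(big_mkord xpredT (fun k => cabs (ip x (u k)) ^+ 2)).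
rewrite [leRHS](bigID (mem s)) /= -[leLHS]addr0 lerD ?sumr_ge0 // => [|k _]; last exact: sqr_ge0.
rewrite -[leRHS]big_filter le_eqVlt; apply/orP; left; apply/eqP/perm_big.
apply: uniq_perm => // [|k]; first by rewrite filter_uniq // iota_uniq.
rewrite mem_filter mem_index_iota /=; case: (boolP (k \in s)) => //= ks.
by apply/esym; rewrite ltnS; apply: (leq_bigmax_seq (F := fun k : nat => k)).
Qed.

Section Isometry.
Variables (R : realType) (H L : lmodType R[i]).
Variables (ip : {dot H for Num.conj}) (ipL : {dot L for Num.conj}).

(** The norm of a x + y determines the real part of a <x, y>; a = 1 and a = i give the real and
    imaginary parts of <x, y>. *)
Lemma polarization (S : set H) (V : H -> L) :
  (forall a x y, S x -> S y -> S (a *: x + y)) ->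
  (forall a x y, S x -> S y -> V (a *: x + y) = a *: V x + V y) ->
  (forall x, S x -> nsq ipL (V x) = nsq ip x) ->
  forall x y, S x -> S y -> ipL (V x) (V y) = ip x y.
Proof.
move=> Sl Vl Vn x y Sx Sy.
have re a : complex.Re (a * ipL (V x) (V y)) = complex.Re (a * ip x y).
  have h := Vn _ (Sl a _ _ Sx Sy).
  rewrite (Vl _ _ _ Sx Sy) !nsqD !nsqZ !(Vn _ Sx, Vn _ Sy) !ipZl in h; lra.
apply/eqP; rewrite eq_complex; apply/andP; split; apply/eqP.
  by have := re 1; rewrite !mul1r.
have := re 'i%C; case: (ipL _ _) (ip _ _) => [? ?] [? ?] /=; rewrite !mul0r !mul1r !sub0r.
by move=> /oppr_inj.
Qed.

End Isometry.

Section ShiftOperator.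
Variables (R : realType) (H : lmodType R[i]) (ip : {dot H for Num.conj}).
Variables (W : H -> H) (u : nat -> H) (c : nat -> R) (tau : nat -> nat).
Hypothesis (bW : bounded_operator ip W).
Hypothesis (ou : forall m n, ip (u m) (u n) = (m == n)%:R).
Hypothesis (tau_inj : injective tau).
Hypothesis (Wu : forall m, W (u m) = (c m)%:C *: u (tau m)).
Let S := closed_span ip (range u).

Lemma opD x y : W (x + y) = W x + W y.
Proof. by have [lW _] := bW; have := lW 1 x y; rewrite !scale1r. Qed.

Lemma opZ a x : W (a *: x) = a *: W x.
Proof.
have [lW _] := bW; have W0 : W 0 = 0.
  by have := lW (-1) 0 0; rewrite !scaleN1r oppr0 addr0 addNr.
by have := lW a x 0; rewrite W0 !addr0.
Qed.

Lemma op_sum n (F : 'I_n -> H) : W (\sum_(k < n) F k) = \sum_(k < n) W (F k).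
Proof.
elim: n F => [|n IH] F; last by rewrite !big_ord_recr /= opD IH.
by rewrite !big_ord0 -(scale0r 0) opZ !scale0r.
Qed.

Lemma op_cvg v x : ip_cvg ip v x -> ip_cvg ip (W \o v) (W x).
Proof.
have [lW [M hM]] := bW => /ip_cvgP vx; apply/ip_cvgP => e e0.
have M1 : 0 < `|M| + 1 by have := normr_ge0 M; lra.
have [N hN] := vx _ (divr_gt0 e0 M1); exists N => n Nn /=.
have -> : W (v n) - W x = W (v n - x) by rewrite opD -scaleN1r -opZ scaleN1r.
apply: le_lt_trans (hM _) _; apply: le_lt_trans (_ : (`|M| + 1) * ipnorm ip (v n - x) < e).
  by rewrite ler_wpM2r ?ipnorm_ge0 //; have := ler_norm M; lra.
by rewrite mulrC -ltr_pdivlMr // hN.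
Qed.

Lemma op_oproj n x : W (oproj ip u n x) = \sum_(k < n) (ip x (u k) * (c k)%:C) *: u (tau k).
Proof. by rewrite op_sum; apply: eq_bigr => k _; rewrite opZ Wu scalerA. Qed.

Lemma op_cvg_oproj x : S x -> ip_cvg ip (fun n => W (oproj ip u n x)) (W x).
Proof. by move=> Sx; apply: (op_cvg (v := oproj ip u ^~ x)); exact: oproj_cvg. Qed.

Lemma op_invariant x : S x -> S (W x).
Proof.
move=> Sx; exists (fun n => W (oproj ip u n x)); split; last exact: op_cvg_oproj.
move=> n; rewrite op_oproj.
apply: (@linear_span_sum _ _ _ n (fun k => (ip x (u k) * (c k)%:C) *: u (tau k))) => k.
by apply: linear_span1; exists (tau k).
Qed.

Lemma op_coord_notin x k : S x -> (forall m, tau m <> k) -> ip (W x) (u k) = 0.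
Proof.
move=> Sx km; apply: (ip_cvg_orth (op_cvg_oproj Sx)) => n.
rewrite op_oproj ip_suml big1 // => i _; rewrite ipZl ou.
by have /eqP/negbTE -> := km i; rewrite mulr0.
Qed.

(** No adjoint of W is at hand, so coordinates are obtained by continuity: after removal of the
    component along u m, the images of all partial expansions are orthogonal to u (tau m), by
    injectivity of tau. *)
Lemma op_coord x m : S x -> ip (W x) (u (tau m)) = (c m)%:C * ip x (u m).
Proof.
move=> Sx; set a := ip x (u m); pose y := x - a *: u m.
have Su : S (u m) by apply: (cvg_oproj_span (u := u)); apply/ip_cvgP => e e0;
  exists m.+1 => n /oproj_basis ->//; rewrite subrr ipnorm0.
have Sy : S y.
  rewrite /y addrC -scaleNr; apply: cvg_oproj_span.
  by apply: (cvg_oproj_lin _ (u := u)) => //; exact: oproj_cvg.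
have yu : ip y (u m) = 0 by rewrite ipBl ipZl ou eqxx mulr1 subrr.
have : ip (W y) (u (tau m)) = 0.
  apply: (ip_cvg_orth (op_cvg_oproj Sy)) => n.
  rewrite op_oproj ip_suml big1 // => i _; rewrite ipZl ou (inj_eq tau_inj).
  by case: (eqVneq (i : nat) m) => [->|]; rewrite ?mulr0 // yu !mul0r.
have -> : W y = W x - (a * (c m)%:C) *: u (tau m).
  by rewrite /y addrC -scaleNr addrC opD opZ Wu scalerA mulNr scaleNr.
by rewrite ipBl ipZl ou eqxx mulr1 => /eqP; rewrite subr_eq0 => /eqP ->; rewrite mulrC.
Qed.

Section Subnormal.
Variables (Z Y : choiceType) (sg sg' : Z -> Z) (j : nat -> Z).
Hypotheses (sgK : cancel sg sg') (sg'K : cancel sg' sg).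
Hypotheses (j_inj : injective j) (jtau : forall m, j (tau m) = sg (j m)).
Variables (th : Y -> R) (nu : nat -> Y -> R).
Hypothesis th01 : forall y, 0 <= th y <= 1.
Hypothesis nu0 : forall m y, 0 <= nu m y.
Hypothesis nu1 : forall m, ssum (nu m) = 1%:E.
Hypothesis c0 : forall m, 0 <= c m.
Hypothesis cnu : forall m y, c m ^+ 2 * nu (tau m) y = th y ^+ 2 * nu m y.

(* Identify [u m] with the function [sqrt (nu m)] living on the fibre of [Z * Y]
   over [j m]; the normal extension moves fibres along [sg] and multiplies by
   [th], which does not depend on the fibre. *)
Lemma shift_subnormal : subnormal_in ip S W.
Proof.
have [oj [jK ojK]] := partial_inverse j_inj.
(* Points of Z outside the image of j, such as the negative times of a bilateral extension, receive
   the coordinate 0. *)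
pose b x z : R[i] := if oj z is Some m then ip x (u m) else 0.
pose q z y : R := if oj z is Some m then nu m y else 0.
pose v x (p : Z * Y) : R[i] := b x p.1 * (Num.sqrt (q p.1 p.2))%:C.
have q0 z y : 0 <= q z y by rewrite /q; case: (oj z).
have sv x : ssum (fun p => sqnorm (v x p)) = ssum (fun k => cabs (ip x (u k)) ^+ 2).
  rewrite -(ssum_extend (fun k => cabs (ip x (u k)) ^+ 2) jK ojK).
  rewrite -(@ssum_pair _ _ _ (fun z y => cabs (b x z) ^+ 2 * q z y)).
  - congr ssum; apply/funext => -[z y].
    rewrite /v sqnormE cabsM exprMn cabsR real_normK ?num_real //.
    by rewrite sqr_sqrtr.
  - by move=> z y; rewrite mulr_ge0 // sqr_ge0.
  - move=> z; rewrite ssumZ ?sqr_ge0 // /b /q; case: (oj z) => [m|].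
      by rewrite (nu1 m) mule1.
    by rewrite (_ : cabs 0 ^+ 2 = 0) ?mul0e // cabs0 expr0n.
have mv x : v x \in @ell2_pred R (Z * Y)%type.
  by apply/ell2_predP; rewrite sv (le_lt_trans (bessel_ssum ou x)) // ltry.
pose V x : ell2 R (Z * Y)%type := Ell2 (mv x).
have sgpK : cancel (fun p : Z * Y => (sg p.1, p.2)) (fun p => (sg' p.1, p.2)).
  by move=> [z y] /=; rewrite sgK.
have sgp'K : cancel (fun p : Z * Y => (sg' p.1, p.2)) (fun p => (sg p.1, p.2)).
  by move=> [z y] /=; rewrite sg'K.
have thp (p : Z * Y) : 0 <= th p.2 <= 1 by [].
have Vlin a x y : V (a *: x + y) = a *: V x + V y.
  apply: val_inj; apply/funext => -[z w].
  rewrite -[RHS]/(a * v x (z, w) + v y (z, w)) -[LHS]/(v (a *: x + y) (z, w)) /v /b /=.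
  by case: (oj z) => [m|]; rewrite ?ipDl ?ipZl; ring.
exists (ell2 R (Z * Y)%type), (@ell2_ip R (Z * Y)%type), (wperm sgpK sgp'K thp), V; split.
- exact: ell2_complete.
- exact: wperm_normal.
- by move=> a x y _ _; exact: Vlin.
- apply: polarization => [a x y Sx Sy|a x y _ _|x Sx].
  + by apply: cvg_oproj_span; apply: (cvg_oproj_lin _ (u := u)); exact: oproj_cvg.
  + exact: Vlin.
  + apply: EFin_inj; rewrite ell2_nsq -(parseval_esum (u := u)) //; last exact: oproj_cvg.
    exact: sv.
- move=> x Sx; split; first exact: op_invariant.
  apply: val_inj; apply/funext => -[z y].
  rewrite -[LHS]/(v (W x) (z, y)) -[RHS]/((th y)%:C * v x (sg' z, y)) /v /b /q /=.
  have ojP z' m : oj z' = Some m -> j m = z' by move=> E; have := ojK z'; rewrite E.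
  case E : (oj z) => [k|]; last first.
    rewrite mul0r; case E' : (oj (sg' z)) => [m|]; last by rewrite mul0r mulr0.
    by move/ojP: E' => E'; rewrite -(sg'K z) -E' -jtau jK in E.
  have [[m mk]|nk] := pselect (exists m, tau m = k).
    have -> : oj (sg' z) = Some m by rewrite -(ojP _ _ E) -mk jtau sgK jK.
    rewrite -mk op_coord //.
    have h : (c m)%:C * (Num.sqrt (nu (tau m) y))%:C = (th y)%:C * (Num.sqrt (nu m y))%:C.
      rewrite -!rmorphM /=; congr (_ %:C); have /andP[t0 _] := th01 y.
      apply/eqP; rewrite -(@eqrXn2 _ 2) ?mulr_ge0 ?sqrtr_ge0 //.
      by rewrite !exprMn !sqr_sqrtr ?cnu.
    by rewrite mulrAC h mulrA [(th y)%:C * _ * _]mulrAC.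
  have -> : ip (W x) (u k) = 0 by apply: op_coord_notin => // m mk; apply: nk; exists m.
  rewrite mul0r; case E' : (oj (sg' z)) => [m|]; last by rewrite mul0r mulr0.
  have := ojP _ _ E; rewrite -(sg'K z) -(ojP _ _ E') -jtau => /j_inj mk.
  by case: nk; exists m.
Qed.

End Subnormal.
End ShiftOperator.

(** * Series *)

Section LogSeries.
Variable R : realType.
Implicit Types (x s : R).

Lemma is_derive_log_partial x s N :
  is_derive s 1 (fun s : R => \sum_(n < N) (s * x) ^+ n.+1 / n.+1%:R) (x * \sum_(n < N) (s * x) ^+ n).
Proof.
elim: N => [|N IH].
  rewrite [X in is_derive _ _ X](_ : _ = cst 0); last by apply/funext => y; rewrite big_ord0.
  by rewrite big_ord0 mulr0; exact: is_derive_cst.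
rewrite [X in is_derive _ _ X](_ : _ = (fun s : R => \sum_(n < N) (s * x) ^+ n.+1 / n.+1%:R) +
   ((x ^+ N.+1 / N.+1%:R) \*: (@id R ^+ N.+1))); last first.
  apply/funext => y; rewrite big_ord_recr /= [RHS]/(_ + _); congr (_ + _).
  by rewrite exprMn fctE -[RHS]/(_ * _); ring.
apply: (is_derive_eq (is_deriveD IH (is_deriveZ _ (is_deriveX N.+1 (is_derive_id s 1))))).
rewrite big_ord_recr /= mulrDr; congr (_ + _).
rewrite -[LHS]/(x ^+ N.+1 / N.+1%:R * ((N.+1%:R * s ^+ N) * 1)) exprMn exprS.
have : N.+1%:R != 0 :> R by rewrite pnatr_eq0.
by move=> ?; field.
Qed.

(** The remainder along the segment from 0 to x, parametrised by s in [0, 1] so that both signs of x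
    are treated alike, vanishes at s = 0 and has derivative x (s x)^N / (1 - s x). The mean value
    theorem gives the bound. *)
Lemma log_series_bound x N : `|x| < 1 ->
  `|- ln (1 - x) - \sum_(n < N) x ^+ n.+1 / n.+1%:R| <= (1 - `|x|)^-1 * `|x| ^+ N.
Proof.
move=> x1; have x0 := normr_ge0 x.
pose g (s : R) : R := - ln (1 - s * x) - \sum_(n < N) (s * x) ^+ n.+1 / n.+1%:R.
have bsx s : 0 <= s <= 1 -> `|s * x| <= `|x| by move=> /andP[s0 s1]; rewrite normrM ger0_norm // ler_piMl.
have psx s : 0 <= s <= 1 -> 1 - `|x| <= 1 - s * x.
  by move=> /bsx h; have := ler_norm (s * x); lra.
have dg s : 0 <= s <= 1 -> is_derive s 1 g (x * (s * x) ^+ N / (1 - s * x)).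
  move=> h; have := psx s h; move=> h'.
  have p : 0 < 1 - s * x by lra.
  have d1 : is_derive s 1 (fun y : R => 1 - y * x) (- x).
    rewrite [X in is_derive _ _ X](_ : _ = cst 1 - x \*: @id R); last first.
      by apply/funext => y; rewrite -[RHS]/(1 - x * y) mulrC.
    apply: (is_derive_eq (is_deriveB (is_derive_cst (1 : R^o) (s : R^o) (1 : R^o)) (is_deriveZ x (is_derive_id (s : R^o) (1 : R^o))))).
    by rewrite sub0r -[x *: 1]/(x * 1) mulr1.
  have d2 := @is_derive1_comp R (@ln R) (fun y : R => 1 - y * x) s _ _ (is_derive1_ln p) d1.
  rewrite [X in is_derive _ _ X](_ : _ = - (@ln R \o (fun y : R => 1 - y * x)) -
     (fun s : R => \sum_(n < N) (s * x) ^+ n.+1 / n.+1%:R)); last by apply/funext.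
  apply: (is_derive_eq (is_deriveB (is_deriveN d2) (is_derive_log_partial x s N))).
  have := subrX1 (s * x) N; move: (\sum_(_ < _) _) => T hT.
  have -> : (s * x) ^+ N = 1 + (s * x - 1) * T by rewrite -hT; ring.
  by field; lra.
have [c c01 hc] : exists2 c, c \in `[0, 1]%R & g 1 - g 0 = (x * (c * x) ^+ N / (1 - c * x)) * (1 - 0).
  apply: (MVT_segment (f := g) (df := fun c => x * (c * x) ^+ N / (1 - c * x))) => //.
    by move=> s; rewrite in_itv /= => /andP[s0 s1]; apply: dg; rewrite !ltW.
  apply: derivable_within_continuous => s; rewrite in_itv /= => s01.
  by have [] := dg s s01.
have <- : g 1 = - ln (1 - x) - \sum_(n < N) x ^+ n.+1 / n.+1%:R by rewrite /g mul1r.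
have g0 : g 0 = 0.
  rewrite /g mul0r subr0 ln1 oppr0 big1 ?subr0 // => n _; by rewrite exprS !mul0r.
rewrite g0 !subr0 mulr1 in hc; rewrite hc; rewrite in_itv /= in c01.
have px := psx c c01; have bx := bsx c c01.
have p0 : 0 < 1 - `|x| by lra.
have p1 : 0 < 1 - c * x by lra.
rewrite !normrM normfV (gtr0_norm p1) mulrC normrX ler_pM ?invr_ge0 ?mulr_ge0 ?exprn_ge0 ?(ltW p1) //.
  by rewrite lef_pV2 ?posrE.
rewrite -[leRHS]mul1r ler_pM ?exprn_ge0 ?(ltW x1) //.
by rewrite lerXn2r ?nnegrE.
Qed.

Lemma log_series x : `|x| < 1 ->
  (fun N => \sum_(n < N) x ^+ n.+1 / n.+1%:R) @ \oo --> - ln (1 - x).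
Proof.
move=> x1; apply/cvgrPdist_lt => e e0.
have c0 : (fun N => (1 - `|x|)^-1 * `|x| ^+ N) @ \oo --> (0 : R).
  by apply: cvg_geometric; rewrite normr_id.
move/cvgrPdist_lt: c0 => /(_ e e0) h; near=> N.
rewrite (le_lt_trans (log_series_bound N x1)) //.
have : `|0 - (1 - `|x|)^-1 * `|x| ^+ N| < e by near: N; exact: h.
by rewrite sub0r normrN ger0_norm // mulr_ge0 ?exprn_ge0 ?invr_ge0 //; lra.
Unshelve. all: by end_near. Qed.

End LogSeries.

(** * Convergent sums and the exponential of a sum *)

Section Sums.
Variable R : realType.

Lemma ssum_nat (a : nat -> R) (l : R) : (forall n, 0 <= a n) ->
  (fun N => \sum_(n < N) a n) @ \oo --> l -> ssum a = l%:E.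
Proof.
move=> a0 h; rewrite /ssum -nneseries_esumT; last by move=> n; rewrite lee_fin.
apply/cvg_lim => //; rewrite (_ : (fun n => _) = EFin \o (fun n => \sum_(k < n) a k)).
  by apply: cvg_EFin; [exact: nearW|exact: h].
by apply/funext => n /=; rewrite big_mkord sumEFin.
Qed.

Lemma partial_sums_cvg (a : nat -> R) (M : R) : (forall n, 0 <= a n) ->
  (forall N, \sum_(n < N) a n <= M) -> cvgn (fun N => \sum_(n < N) a n).
Proof.
move=> a0 aM; apply: nondecreasing_is_cvgn.
  by apply/nondecreasing_seqP => n; rewrite big_ord_recr /= lerDl.
by exists M => _ [n _ <-].
Qed.

Lemma geometric_partial_le (q : R) N : 0 <= q < 1 -> \sum_(n < N) q ^+ n <= (1 - q)^-1.
Proof.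
move=> /andP[q0 q1]; have p : 0 < 1 - q by lra.
rewrite -(@ler_pM2l _ (1 - q)) // divff ?gt_eqF //.
have := subrX1 q N; have := exprn_ge0 N q0; move: (\sum_(_ < _) _) => T; nra.
Qed.

Lemma ssum_option (Z X : choiceType) (j : X -> Z) (oj : Z -> option X) (a : Z -> R) (b : X -> R) :
  pcancel j oj -> ocancel oj j ->
  (forall z, a z = if oj z is Some x then b x else 0) -> ssum a = ssum b.
Proof. by move=> jK ojK ab; rewrite -(ssum_extend b jK ojK); congr ssum; exact/funext. Qed.

Variables (h : nat -> R) (S : R).
Hypotheses (h0 : forall n, 0 <= h n) (hS : ssum h = S%:E).
Let ph (w : seq nat) : R := \prod_(n <- w) h n.
Let ph0 w : 0 <= ph w. Proof. exact: prodr_ge0. Qed.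

(** Words of length k index the terms of the k-th power of a sum, expanded without collecting equal
    monomials. *)
Lemma ssum_prod_size k : ssum (fun w : seq nat => if size w == k then ph w else 0) = (S ^+ k)%:E.
Proof.
elim: k => [|k IH].
  rewrite (@ssum_option _ unit (fun=> [::]) (fun w => if w is [::] then Some tt else None) _ (fun=> 1)).
  - rewrite expr0 /ssum (_ : [set: unit] = [set tt]); last by apply/seteqP; split=> -[].
    by rewrite esum_set1 // lee_fin.
  - by case.
  - by case.
  - by case=> [|n w] //=; rewrite /ph big_nil.
rewrite (@ssum_option _ (nat * seq nat)%type (fun p => p.1 :: p.2)
  (fun w => if w is n :: w' then Some (n, w') else None) _
  (fun p => h p.1 * (if size p.2 == k then ph p.2 else 0))).
- rewrite (@ssum_pair _ _ _ (fun n w => h n * (if size w == k then ph w else 0)) (fun n => S ^+ k * h n)).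
  + rewrite ssumZ // ?hS -?EFinM ?exprSr //.
    by rewrite -lee_fin -IH ssum_ge0 // => w; case: ifP.
  + by move=> n w; rewrite mulr_ge0 //; case: ifP.
  + by move=> n; rewrite ssumZ // ?IH -?EFinM ?[S ^+ k * _]mulrC // => w; case: ifP.
- by case.
- by case.
- by case=> [|n w] //=; rewrite eqSS; case: ifP => // _; rewrite ?mulr0 // /ph big_cons.
Qed.

(** The exponential of a sum expanded over all words. Every term is visibly nonnegative and no
    multinomial coefficient appears; words will index the fibres for the real powers of the
    weights. *)
Lemma ssum_exp : ssum (fun w : seq nat => ph w / (size w)`!%:R) = (expR S)%:E.
Proof.
have S0 : 0 <= S by rewrite -lee_fin -hS ssum_ge0.
(* The words are spread over pairs (k, w), with value 0 unless k is the length of w, so that the sum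
   can be taken length by length. *)
rewrite -(@ssum_option (nat * seq nat)%type _ (fun w => (size w, w))
  (fun p => if size p.2 == p.1 then Some p.2 else None)
  (fun p => (p.1)`!%:R^-1 * (if size p.2 == p.1 then ph p.2 else 0))).
- rewrite (@ssum_pair _ _ _ (fun k w => k`!%:R^-1 * (if size w == k then ph w else 0)) (exp_coeff S)).
  + apply: ssum_nat => [n|]; first exact: exp_coeff_ge0.
    have h2 : series (exp_coeff S) @ \oo --> expR S by exact: is_cvg_series_exp_coeff.
    rewrite (_ : series _ = (fun n => \sum_(k < n) exp_coeff S k)) in h2 => //.
    by apply/funext => n; rewrite /series /= big_mkord.
  + by move=> n w; rewrite mulr_ge0 ?invr_ge0 //; case: ifP.
  + move=> k; rewrite ssumZ ?invr_ge0 // ?ssum_prod_size -?EFinM; first by rewrite /exp_coeff /= mulrC.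
    by move=> w; case: ifP.
- by move=> w /=; rewrite eqxx.
- by move=> [k w] /=; case: eqP => //= ->.
- move=> [k w] /=; case: eqP => [<-|]; last by rewrite mulr0.
  by rewrite mulrC.
Qed.

End Sums.

(** * Functional equations *)

(* The distributions nu m replace the Berger measure of a subnormal shift: for
   [tau = succn] they give (c 0 ... c (m-1))^2 = sum_y th y ^ (2 m) nu 0 y. *)
Definition scaling_family (R : realType) (c : nat -> R) (tau : nat -> nat) : Prop :=
  exists (Y : choiceType) (th : Y -> R) (nu : nat -> Y -> R),
  [/\ forall y, 0 <= th y <= 1, forall m y, 0 <= nu m y,
      forall m, ssum (nu m) = 1%:E &
      forall m y, c m ^+ 2 * nu (tau m) y = th y ^+ 2 * nu m y].

Section ScalingFamilies.
Variable R : realType.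
Implicit Types (A C t : R).

(** The nu m are the terms of the series for G m divided by G m; halving T multiplies the term y by
    2^(-e y), whence th y is 2^(-(e y)/2). Several y may share an exponent, so products and
    exponentials of series need not be rearranged into power series. *)
Lemma scaling_family_powers (Y : choiceType) (g : Y -> R) (e : Y -> nat) (T G c : nat -> R)
    (tau : nat -> nat) :
  (forall y, 0 <= g y) -> (forall m, 0 <= T m) -> (forall m, 0 < G m) ->
  (forall m, ssum (fun y => g y * T m ^+ e y) = (G m)%:E) ->
  (forall m, T (tau m) = T m / 2) -> (forall m, G (tau m) = c m ^+ 2 * G m) ->
  scaling_family c tau.
Proof.
move=> g0 T0 G0 sG Ttau Gtau.
have h2 : 0 <= 2^-1 :> R by lra.
exists Y, (fun y => Num.sqrt 2^-1 ^+ e y), (fun m y => (G m)^-1 * (g y * T m ^+ e y)); split.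
- move=> y; rewrite exprn_ge0 ?sqrtr_ge0 //= exprn_ile1 ?sqrtr_ge0 //.
  by rewrite -[leRHS]sqrtr1 ler_wsqrtr //; lra.
- by move=> m y; rewrite !mulr_ge0 ?invr_ge0 ?exprn_ge0 // ltW.
- move=> m; rewrite ssumZ ?invr_ge0 ?(ltW (G0 m)) // => [|y]; last by rewrite mulr_ge0 ?exprn_ge0.
  by rewrite sG -EFinM mulVf ?gt_eqF.
- move=> m y; rewrite Ttau exprMn -exprM mulnC exprM sqr_sqrtr //.
  have := G0 (tau m); rewrite Gtau => Gm; have cG : c m ^+ 2 * G m != 0 by rewrite gt_eqF.
  move: cG; rewrite mulf_eq0 negb_or => /andP[c0 G0'].
  rewrite invfM; move: (_ ^+ e y) (T m ^+ _) => a b.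
  by rewrite -(mulrA (c m ^+ 2)^-1) mulVKf //; ring.
Qed.

Let hn n : R := 2^-1 ^+ n.
Let hn0 n : 0 < hn n. Proof. by rewrite exprn_gt0 // invr_gt0. Qed.
Let hn1 n : hn n <= 1. Proof. by rewrite exprn_ile1 //; lra. Qed.
Let hnS n : hn n.+1 = hn n / 2. Proof. by rewrite /hn exprSr. Qed.
Let hnS_lt1 n : hn n.+1 <= 2^-1. Proof. by rewrite hnS; have := hn1 n; lra. Qed.

Section LinearFactor.
Variables (A C : R).
Hypotheses (A0 : 0 <= A) (CA : C <= A).

(* Taylor coefficients at 0 of the solution G, with G(0) = 1, of the functional
   equation (1 - C t) G(t/2) = (1 - A t) G(t). *)
Fixpoint lf_coef n : R :=
  if n is n'.+1 then lf_coef n' * ((A - C * 2^-1 ^+ n') / (1 - 2^-1 ^+ n'.+1)) else 1.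

(** Since C <= A and 0 <= A, one has C 2^(-n) <= A 2^(-n) <= A, whatever the sign of C. *)
Lemma lf_coef_ge0 n : 0 <= lf_coef n.
Proof.
elim: n => [|n IH] //=; rewrite -/(hn n) -/(hn n.+1).
apply: mulr_ge0 => //; apply: divr_ge0; last by have := hnS_lt1 n; lra.
by have := ler_wpM2r (ltW (hn0 n)) CA; have := ler_wpM2l A0 (hn1 n); lra.
Qed.

Definition lf_partial t N := \sum_(n < N) lf_coef n * t ^+ n.

Lemma lf_partialS t N : lf_partial t N.+1 = lf_partial t N + lf_coef N * t ^+ N.
Proof. exact: big_ord_recr. Qed.

(** The functional equation truncated at degree N. Comparison of the terms of degree n + 1 is the
    recursion defining [lf_coef], and the exact identity passes directly to the limit. *)
Lemma lf_partial_half t N :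
  lf_partial (t / 2) N.+1 - C * t * lf_partial (t / 2) N =
  lf_partial t N.+1 - A * t * lf_partial t N.
Proof.
elim: N => [|N IH]; first by rewrite /lf_partial !big_ord_recr !big_ord0 /= !expr0 !mulr0.
rewrite !lf_partialS /= in IH *; rewrite !exprMn -!/(hn _) ![t ^+ N.+1]exprS in IH *.
have := hnS_lt1 N; rewrite hnS; move: (lf_partial _ _) (lf_partial _ _) IH => P Q.
move: (hn N) (lf_coef N) (t ^+ N) => a b c IH a1.
suff : b * ((A - C * a) / (1 - a / 2)) * (t * c * (a / 2)) - C * t * (b * (c * a)) =
   b * ((A - C * a) / (1 - a / 2)) * (t * c) - A * t * (b * c) by lra.
by field; lra.
Qed.

(** The ratio test: the ratios of successive terms tend to A t, and q lies halfway between A t and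
    1. *)
Lemma lf_cvg t : 0 <= t -> A * t < 1 -> cvgn (lf_partial t).
Proof.
move=> t0 At; pose a n := lf_coef n * t ^+ n.
have a0 n : 0 <= a n by rewrite mulr_ge0 ?lf_coef_ge0 ?exprn_ge0.
pose q := (1 + A * t) / 2.
have At0 : 0 <= A * t by rewrite mulr_ge0.
have [N hN] : exists N, forall n, (N <= n)%N -> a n.+1 <= q * a n.
  (* |C| t controls the term -C 2^(-n) t, and the summand 1 absorbs the denominator 1 - 2^(-n-1). *)
  pose k := `|C| * t + 1.
  have k0 : 0 < k by rewrite ltr_wpDl // mulr_ge0.
  have : (fun n => hn n) @ \oo --> (0 : R) by apply: cvg_expr; rewrite ger0_norm; lra.
  have e0 : 0 < (1 - A * t) / 2 / k by rewrite !divr_gt0 //; lra.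
  move=> /cvgrPdist_lt /(_ _ e0) [N _ hN]; exists N => n /hN /=.
  rewrite sub0r normrN gtr0_norm // ltr_pdivlMr // => hk.
  rewrite /a /= -/(hn n) -/(hn n.+1) [t ^+ n.+1]exprS.
  have h1 := hnS_lt1 n.
  have d0 : 0 < 1 - hn n.+1 by lra.
  rewrite (_ : _ * _ = (A - C * hn n) * t / (1 - hn n.+1) * (lf_coef n * t ^+ n)); last by ring.
  apply: ler_wpM2r; first exact: a0.
  rewrite ler_pdivrMr // hnS.
  have hC : - C * t <= `|C| * t by rewrite ler_wpM2r // -normrN ler_norm.
  have hn' := hn0 n; have hn'' := hn1 n.
  have q1 : q <= 1 by rewrite /q; lra.
  have : hn n * (- C * t) <= hn n * (`|C| * t) by rewrite ler_wpM2l // ltW.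
  have : q * (hn n / 2) <= hn n / 2 by rewrite ler_piMl //; lra.
  rewrite /k in hk; rewrite /q; nra.
have q1 : 0 < 1 - q by rewrite /q; lra.
(* From N on, a partial sum plus its next term divided by 1 - q is nonincreasing, and M is its
   initial value. *)
pose M := \sum_(n < N) a n + a N / (1 - q).
apply: (@partial_sums_cvg _ a M) => // n.
have H k : \sum_(n < N + k) a n + a (N + k)%N / (1 - q) <= M.
  elim: k => [|k IH]; first by rewrite addn0.
  rewrite addnS big_ord_recr /=; apply: le_trans IH.
  have h := hN _ (leq_addr k N); rewrite -addrA lerD2l.
  have : a (N + k).+1 / (1 - q) <= q * a (N + k)%N / (1 - q) by rewrite ler_wpM2r // invr_ge0 ltW.
  have -> : a (N + k)%N / (1 - q) = a (N + k)%N + q * a (N + k)%N / (1 - q) by field; lra.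
  by rewrite lerD2l.
apply: le_trans (H n); rewrite -[leLHS]addr0 lerD //; last by rewrite divr_ge0 // ltW.
rewrite [leRHS](_ : _ = \sum_(0 <= i < N + n) a i); last by rewrite big_mkord.
rewrite (big_cat_nat (n := n)) //= ?leq_addl // big_mkord lerDl sumr_ge0 //.
Qed.

Definition lf_sum t := limn (lf_partial t).

Lemma lf_ssum t : 0 <= t -> A * t < 1 -> ssum (fun n => lf_coef n * t ^+ n) = (lf_sum t)%:E.
Proof.
move=> t0 At; apply: ssum_nat => [n|]; first by rewrite mulr_ge0 ?lf_coef_ge0 ?exprn_ge0.
exact: lf_cvg.
Qed.

Lemma lf_sum_gt0 t : 0 <= t -> A * t < 1 -> 0 < lf_sum t.
Proof.
move=> t0 At; apply: (@lt_le_trans _ _ 1) => //; rewrite -lee_fin -lf_ssum //.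
apply: le_trans (ssum_term 0%N _) => [|n]; last by rewrite mulr_ge0 ?lf_coef_ge0 ?exprn_ge0.
by rewrite /= expr0 mulr1.
Qed.

Lemma lf_sum_half t : 0 <= t -> A * t < 1 ->
  lf_sum (t / 2) * (1 - C * t) = (1 - A * t) * lf_sum t.
Proof.
move=> t0 At; have At0 : 0 <= A * t by rewrite mulr_ge0.
have At2 : A * (t / 2) < 1 by lra.
have c1 : lf_partial t @ \oo --> lf_sum t by exact: lf_cvg.
have c2 : lf_partial (t / 2) @ \oo --> lf_sum (t / 2) by apply: lf_cvg => //; lra.
have L : (fun N => lf_partial (t / 2) N.+1 - C * t * lf_partial (t / 2) N) @ \oo -->
   lf_sum (t / 2) - C * t * lf_sum (t / 2).
  by apply: cvgB; [rewrite (cvg_shiftS (lf_partial _))|apply: cvgM => //; exact: cvg_cst].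
have L' : (fun N => lf_partial t N.+1 - A * t * lf_partial t N) @ \oo -->
   lf_sum t - A * t * lf_sum t.
  by apply: cvgB; [rewrite (cvg_shiftS (lf_partial _))|apply: cvgM => //; exact: cvg_cst].
have : lf_sum (t / 2) - C * t * lf_sum (t / 2) = lf_sum t - A * t * lf_sum t.
  rewrite -(cvg_lim (@Rhausdorff R) L) -(cvg_lim (@Rhausdorff R) L').
  by congr (limn _); apply/funext => N; exact: lf_partial_half.
lra.
Qed.

End LinearFactor.

Section HalfStep.
Variables (A B C : R) (T c : nat -> R) (tau : nat -> nat).
Hypotheses (B0 : 0 <= B) (BA : B <= A) (CB : C <= B).
Hypotheses (T0 : forall m, 0 < T m) (AT : forall m, A * T m < 1).
Hypothesis Ttau : forall m, T (tau m) = T m / 2.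
Hypothesis cT : forall m,
  c m ^+ 2 = (1 - A * T m) * (1 - B * T m) / (1 - C * T m) ^+ 2.

Let BT m : B * T m < 1.
Proof. by apply: le_lt_trans (AT m); rewrite ler_wpM2r // ltW. Qed.
Let CT m : C * T m < 1.
Proof. by apply: le_lt_trans (BT m); rewrite ler_wpM2r // ltW. Qed.
Let A0 : 0 <= A. Proof. by apply: le_trans BA. Qed.
Let CA : C <= A. Proof. by apply: le_trans BA. Qed.

(** The fibres are the pairs of exponents of the two factors, each factor contributing one (1 - C t)
    to the denominator of the squared weight. *)
Lemma scaling_family_half : scaling_family c tau.
Proof.
pose G m := lf_sum A C (T m) * lf_sum B C (T m).
apply: (@scaling_family_powers (nat * nat)%type (fun p => lf_coef A C p.1 * lf_coef B C p.2)
  (fun p => p.1 + p.2)%N T G).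
- by move=> p; rewrite mulr_ge0 // lf_coef_ge0.
- by move=> m; exact: ltW.
- by move=> m; rewrite mulr_gt0 // lf_sum_gt0 // ltW.
- move=> m; have Tm := ltW (T0 m).
  rewrite -[LHS](_ : ssum (fun p : nat * nat => (lf_coef A C p.1 * T m ^+ p.1) *
    (lf_coef B C p.2 * T m ^+ p.2)) = _); last first.
    by congr ssum; apply/funext => p; rewrite exprD; ring.
  rewrite (@ssum_pair _ _ _ (fun a b => (lf_coef A C a * T m ^+ a) * (lf_coef B C b * T m ^+ b))
    (fun a => lf_sum B C (T m) * (lf_coef A C a * T m ^+ a))).
  + rewrite ssumZ ?(lf_ssum (A := A)) //; first by rewrite -EFinM mulrC.
      by rewrite ltW // lf_sum_gt0.
    by move=> a; rewrite mulr_ge0 ?lf_coef_ge0 ?exprn_ge0.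
  + by move=> a b; rewrite !mulr_ge0 ?lf_coef_ge0 ?exprn_ge0.
  + move=> a; rewrite ssumZ ?(lf_ssum (A := B)) //; first by rewrite -EFinM mulrC.
      by rewrite mulr_ge0 ?lf_coef_ge0 ?exprn_ge0.
    by move=> b; rewrite mulr_ge0 ?lf_coef_ge0 ?exprn_ge0.
- exact: Ttau.
- move=> m; rewrite /G Ttau cT; have Tm := ltW (T0 m).
  have hA := lf_sum_half A0 CA Tm (AT m); have hB := lf_sum_half B0 CB Tm (BT m).
  have p : 1 - C * T m != 0 by rewrite gt_eqF // subr_gt0.
  move: (lf_sum A C (T m / 2)) (lf_sum B C (T m / 2)) hA hB => x y hA hB.
  have -> : x = (1 - A * T m) * lf_sum A C (T m) / (1 - C * T m) by rewrite -hA mulfK.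
  have -> : y = (1 - B * T m) * lf_sum B C (T m) / (1 - C * T m) by rewrite -hB mulfK.
  by field.
Qed.

(** * Arbitrary real powers of the weights *)

Section RealPower.
Variable p : R.
Hypotheses (p0 : 0 < p) (NCB : - B <= C) (c0 : forall m, 0 <= c m).

(* Taylor coefficients, shifted by one, of the solution L, with L(0) = 0, of
   L(t) - L(t/2) = p (2 ln (1 - C t) - ln (1 - A t) - ln (1 - B t)). *)
Definition rp_coef n : R :=
  p * (A ^+ n.+1 + B ^+ n.+1 - 2 * C ^+ n.+1) / (n.+1%:R * (1 - 2^-1 ^+ n.+1)).

Let CBn n : `|C ^+ n| <= B ^+ n.
Proof. by rewrite normrX lerXn2r ?nnegrE // ler_norml NCB. Qed.

Let BAn n : B ^+ n <= A ^+ n. Proof. by rewrite lerXn2r ?nnegrE. Qed.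

Lemma rp_coef_ge0 n : 0 <= rp_coef n.
Proof.
rewrite /rp_coef -/(hn n.+1); apply: divr_ge0; last first.
  by apply: mulr_ge0 => //; have := hnS_lt1 n; lra.
apply: mulr_ge0; first exact: ltW.
have := CBn n.+1; have := BAn n.+1; have := ler_norm (C ^+ n.+1); lra.
Qed.

(** A crude bound for comparison with a geometric series: |C| <= B <= A makes the bracket at most 4
    A^(n+1), and the denominator is at least 1/2. *)
Lemma rp_coef_le n : rp_coef n <= 8 * p * A ^+ n.+1.
Proof.
rewrite /rp_coef -/(hn n.+1) ler_pdivrMr; last first.
  by apply: mulr_gt0 => //; have := hnS_lt1 n; lra.
have h1 : 2^-1 <= n.+1%:R * (1 - hn n.+1).
  have n1 : 1 <= n.+1%:R :> R by rewrite ler1n.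
  have := hnS_lt1 n; nra.
have An : 0 <= A ^+ n.+1 by rewrite exprn_ge0.
have h2 : A ^+ n.+1 + B ^+ n.+1 - 2 * C ^+ n.+1 <= 4 * A ^+ n.+1.
  have := CBn n.+1; have := BAn n.+1; have := ler_norm (- C ^+ n.+1); rewrite normrN; lra.
apply: (@le_trans _ _ (p * (4 * A ^+ n.+1))); first by rewrite ler_wpM2l // ltW.
have : 0 <= 8 * p * A ^+ n.+1 by rewrite !mulr_ge0 // ltW.
move=> h3; apply: (@le_trans _ _ (8 * p * A ^+ n.+1 * 2^-1)); first lra.
by rewrite ler_wpM2l.
Qed.

Lemma rp_cvg t : 0 <= t -> A * t < 1 -> cvgn (fun N => \sum_(n < N) rp_coef n * t ^+ n.+1).
Proof.
move=> t0 At; apply: (@partial_sums_cvg _ (fun n => rp_coef n * t ^+ n.+1) (8 * p * (1 - A * t)^-1)) => [n|N].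
  by rewrite mulr_ge0 ?rp_coef_ge0 ?exprn_ge0.
have At0 : 0 <= A * t by rewrite mulr_ge0.
apply: (@le_trans _ _ (8 * p * \sum_(n < N) (A * t) ^+ n)); last first.
  apply: ler_wpM2l; first by have := p0; lra.
  by rewrite geometric_partial_le ?At0.
rewrite mulr_sumr ler_sum // => n _.
apply: (@le_trans _ _ (8 * p * (A * t) ^+ n.+1)).
  by rewrite exprMn mulrA ler_wpM2r ?exprn_ge0 ?rp_coef_le.
apply: ler_wpM2l; first by have := p0; lra.
by rewrite exprS ler_piMl ?exprn_ge0 // ltW.
Qed.

Definition rp_sum t := limn (fun N => \sum_(n < N) rp_coef n * t ^+ n.+1).

Lemma rp_ssum t : 0 <= t -> A * t < 1 -> ssum (fun n => rp_coef n * t ^+ n.+1) = (rp_sum t)%:E.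
Proof.
move=> t0 At; apply: ssum_nat => [n|]; first by rewrite mulr_ge0 ?rp_coef_ge0 ?exprn_ge0.
exact: rp_cvg.
Qed.

(** Passing from t to t/2 multiplies the term of degree n by 2^(-n), so the difference cancels the
    factor 1 - 2^(-n) in the denominators and leaves three logarithmic series. *)
Lemma rp_sum_half m : rp_sum (T m) - rp_sum (T m / 2) =
  p * (- ln (1 - A * T m) - ln (1 - B * T m) + 2 * ln (1 - C * T m)).
Proof.
have Tm := ltW (T0 m); have At := AT m; have At0 : 0 <= A * T m by rewrite mulr_ge0.
have c1 : (fun N => \sum_(n < N) rp_coef n * T m ^+ n.+1) @ \oo --> rp_sum (T m) by exact: rp_cvg.
have c2 : (fun N => \sum_(n < N) rp_coef n * (T m / 2) ^+ n.+1) @ \oo --> rp_sum (T m / 2).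
  by apply: rp_cvg; lra.
have nA : `|A * T m| < 1 by rewrite ger0_norm.
have nB : `|B * T m| < 1 by rewrite ger0_norm ?mulr_ge0.
have nC : `|C * T m| < 1.
  apply: le_lt_trans (BT m); rewrite normrM (ger0_norm Tm) ler_wpM2r //.
  by rewrite ler_norml NCB.
pose s x (N : nat) : R := \sum_(n < N) x ^+ n.+1 / n.+1%:R.
have L : (fun N => p * (s (A * T m) N + s (B * T m) N - 2 * s (C * T m) N)) @ \oo -->
   p * (- ln (1 - A * T m) + - ln (1 - B * T m) - 2 * - ln (1 - C * T m)).
  apply: cvgM; first exact: cvg_cst.
  apply: cvgB; last by apply: cvgM; [exact: cvg_cst|exact: log_series].
  by apply: cvgD; exact: log_series.
have E N : p * (s (A * T m) N + s (B * T m) N - 2 * s (C * T m) N) =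
    \sum_(n < N) rp_coef n * T m ^+ n.+1 - \sum_(n < N) rp_coef n * (T m / 2) ^+ n.+1.
  rewrite /s !mulr_sumr -big_split -sumrB mulr_sumr -sumrB; apply: eq_bigr => n _ /=.
  rewrite /rp_coef !exprMn -/(hn n.+1).
  have h := hnS_lt1 n; have n0 : n.+1%:R != 0 :> R by rewrite pnatr_eq0.
  move: (A ^+ _) (B ^+ _) (C ^+ _) (T m ^+ _) (n.+1%:R) n0 (hn n.+1) h => a b e w y y0 z z1.
  by field; rewrite y0 /=; lra.
rewrite (funext E) in L.
have <- : p * (- ln (1 - A * T m) + - ln (1 - B * T m) - 2 * - ln (1 - C * T m)) =
    rp_sum (T m) - rp_sum (T m / 2).
  by rewrite -(cvg_lim (@Rhausdorff R) L); apply/cvg_lim => //; exact: cvgB.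
by rewrite mulrN opprK.
Qed.

(** The exponential turns the additive equation of [rp_sum] into the multiplicative one. A word
    contributes to the exponent the sum of its letters increased by one, the degrees of the
    corresponding terms. *)
Lemma scaling_family_powR : scaling_family (fun m => c m `^ p) tau.
Proof.
have pow (w : seq nat) t : \prod_(n <- w) (rp_coef n * t ^+ n.+1) =
    (\prod_(n <- w) rp_coef n) * t ^+ (\sum_(n <- w) n.+1).
  elim: w => [|n w IH]; first by rewrite !big_nil expr0 mulr1.
  by rewrite !big_cons IH exprD; ring.
apply: (@scaling_family_powers (seq nat) (fun w => \prod_(n <- w) rp_coef n / (size w)`!%:R)
  (fun w => \sum_(n <- w) n.+1)%N T (fun m => expR (rp_sum (T m)))).
- move=> w; rewrite divr_ge0 //; apply: prodr_ge0 => n _; exact: rp_coef_ge0.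
- by move=> m; exact: ltW.
- by move=> m; exact: expR_gt0.
- move=> m; have Tm := ltW (T0 m).
  rewrite -(ssum_exp _ (rp_ssum Tm (AT m))); last first.
    by move=> n; rewrite mulr_ge0 ?rp_coef_ge0 ?exprn_ge0.
  by congr ssum; apply/funext => w; rewrite pow mulrAC.
- exact: Ttau.
- move=> m; rewrite Ttau; have h := rp_sum_half m.
  have -> : rp_sum (T m / 2) = p * (ln (1 - A * T m) + ln (1 - B * T m) - 2 * ln (1 - C * T m)) + rp_sum (T m).
    lra.
  rewrite expRD; congr (_ * _).
  have pA : 0 < 1 - A * T m by rewrite subr_gt0.
  have pB : 0 < 1 - B * T m by rewrite subr_gt0.
  have pC : 0 < 1 - C * T m by rewrite subr_gt0.
  have -> : c m `^ p ^+ 2 = (c m ^+ 2) `^ p.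
    by rewrite -powR_mulrn ?powR_ge0 // -powRrM mulrC powRrM powR_mulrn ?c0.
  rewrite cT.
  rewrite /powR gt_eqF; last by rewrite divr_gt0 ?exprn_gt0 ?mulr_gt0.
  congr (expR (_ * _)); rewrite lnM ?posrE ?invr_gt0 ?exprn_gt0 ?mulr_gt0 //.
  rewrite lnM ?posrE // lnV ?posrE ?exprn_gt0 // lnXn // mulr2n; lra.
Qed.

End RealPower.
End HalfStep.
End ScalingFamilies.

(** * Orbit decomposition *)

Section ClosedSpan.
Variables (R : realType) (H : lmodType R[i]) (ip : {dot H for Num.conj}).
Implicit Types (A : set H) (x y : H).

Lemma ip_cvg_cst x : ip_cvg ip (fun=> x) x.
Proof. by apply/ip_cvgP => e e0; exists 0%N => n _; rewrite subrr ipnorm0. Qed.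

Lemma closed_span_sub A x : A x -> closed_span ip A x.
Proof.
move=> Ax; exists (fun=> x); split; last exact: ip_cvg_cst.
by move=> _; rewrite -[x]scale1r; exact: linear_span1.
Qed.

Lemma linear_span_ip0 A x y : (forall a, A a -> ip a y = 0) -> linear_span A x -> ip x y = 0.
Proof.
move=> Ay [n [c [v [Av ->]]]]; rewrite ip_suml big1 // => i _.
by rewrite ipZl Ay ?mulr0.
Qed.

Lemma closed_span_ip0 A x y : (forall a, A a -> ip a y = 0) -> closed_span ip A x -> ip x y = 0.
Proof.
move=> Ay [v [sv /ip_cvg_orth]]; apply=> n; exact: linear_span_ip0 (sv n).
Qed.

Lemma linear_spanZ A a x : linear_span A x -> linear_span A (a *: x).
Proof.
move=> [n [c [v [Av ->]]]]; exists n, (fun i => a * c i), v; split=> //.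
by rewrite scaler_sumr; apply: eq_bigr => i _; rewrite scalerA.
Qed.

(** Gives the invariance of an orbit's span under both the operator and its adjoint, from their
    action on basis vectors alone. *)
Lemma closed_span_invariant A W x : bounded_operator ip W ->
  (forall a, A a -> linear_span A (W a)) -> closed_span ip A x -> closed_span ip A (W x).
Proof.
move=> bW AW [v [sv vx]]; exists (W \o v); split; last exact: op_cvg.
move=> n /=; have [k [c [a [Aa ->]]]] := sv n; rewrite (op_sum bW).
have {}Aa : forall i, linear_span A (W (c i *: a i)).
  by move=> i; rewrite (opZ bW); apply/linear_spanZ/AW.
elim: k c a Aa => [|k IH] c a Aa; first by rewrite big_ord0; exact: linear_span0.
rewrite big_ord_recr; apply: linear_spanD => //.
exact: (IH (fun i => c (widen_ord (leqnSn k) i)) (fun i => a (widen_ord (leqnSn k) i))).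
Qed.

(** Closedness uses that x - oproj n x is a contraction in x: expansions that converge at the v n
    therefore converge at their limit. *)
Lemma closed_span_subspace (u : nat -> H) : (forall m n, ip (u m) (u n) = (m == n)%:R) ->
  closed_subspace ip (closed_span ip (range u)).
Proof.
move=> ou; split.
- by exists (fun=> 0); split; [move=> _; exact: linear_span0|exact: ip_cvg_cst].
- by move=> a x y Sx Sy; apply: cvg_oproj_span; apply: cvg_oproj_lin => //; exact: oproj_cvg.
- move=> v x Sv /ip_cvgP vx; apply: cvg_oproj_span; apply/ip_cvgP => e e0.
  have e20 : 0 < e / 2 by lra.
  have [M /(_ M (leqnn _)) hM] := vx _ e20.
  have /ip_cvgP/(_ _ e20)[N hN] := oproj_cvg ou (Sv M).
  exists N => n /hN {}hN.
  have -> : oproj ip u n x - x = (oproj ip u n (v M) - v M) + ((v M - x) - oproj ip u n (v M - x)).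
    by rewrite oprojB // addrA subrKA opprB addrC subrKA.
  rewrite (splitr e); apply: le_lt_trans (ipnormD _ _ _) _; apply: ltrD => //.
  apply: le_lt_trans hM; rewrite ipnorm_le ?ipnorm_ge0 // ipnorm_sq nsqB_oproj // gerBl.
  by rewrite sumr_ge0 // => k _; exact: sqr_ge0.
Qed.

End ClosedSpan.

Lemma scaling_family_orbit (R : realType) (c : nat -> R) tau i : scaling_family c tau ->
  scaling_family (fun n => c (iter n tau i)) S.
Proof.
move=> [Y [th [nu [th01 nu0 nu1 cnu]]]].
by exists Y, th, (fun n => nu (iter n tau i)); split.
Qed.

(** Z with the bijection sg is an invertible extension of the injection tau; the normal extension
    lives on Z times the set of fibres. *)
Lemma scaling_family_subnormal (R : realType) (H : lmodType R[i]) (ip : {dot H for Num.conj})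
    (W : H -> H) (u : nat -> H) (c : nat -> R) (tau : nat -> nat)
    (Z : choiceType) (sg sg' : Z -> Z) (j : nat -> Z) :
  bounded_operator ip W -> (forall m n, ip (u m) (u n) = (m == n)%:R) -> injective tau ->
  (forall m, W (u m) = (c m)%:C *: u (tau m)) ->
  cancel sg sg' -> cancel sg' sg -> injective j -> (forall m, j (tau m) = sg (j m)) ->
  (forall m, 0 <= c m) -> scaling_family c tau ->
  subnormal_in ip (closed_span ip (range u)) W.
Proof.
move=> bW ou ti Wu sK s'K ji jt c0 [Y [th [nu [th01 nu0 nu1 cnu]]]].
exact: (shift_subnormal bW ou ti Wu sK s'K ji jt th01 nu0 nu1 c0 cnu).
Qed.

(** For a single shift the invertible extension of the successor is the translation of the
    integers. *)
Lemma scaling_family_subnormal_shift (R : realType) (H : lmodType R[i]) (ip : {dot H for Num.conj})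
    (S : set H) (W : H -> H) u (w : nat -> R) :
  weighted_shift_in ip S W u w -> scaling_family w succn -> subnormal_in ip S W.
Proof.
move=> [bW [w0 _] [ou ->] Wu] sw.
apply: (@scaling_family_subnormal _ _ _ _ _ w succn int (fun z => z + 1) (fun z => z - 1) Posz) => //.
- exact: succn_inj.
- by move=> z; rewrite addrK.
- by move=> z; rewrite subrK.
- by move=> m n [].
- by move=> m; rewrite -addn1 PoszD.
- by move=> m; exact: ltW.
Qed.

Section OrbitDecomposition.
Variables (R : realType) (H : lmodType R[i]) (ip : {dot H for Num.conj}).
Variables (T Ts : H -> H) (u : nat -> H) (c : nat -> R) (tau : nat -> nat).
Hypothesis ou : forall m n, ip (u m) (u n) = (m == n)%:R.
Hypothesis cu : forall x, ip_cvg ip (oproj ip u ^~ x) x.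
Hypotheses (tau_inj : injective tau) (tau_gt : forall m, (m < tau m)%N).
Hypotheses (c0 : forall m, 0 < c m) (c1 : forall m, c m <= 1).
Hypothesis adjT : adjoint ip Ts T.
Hypothesis Tu : forall m, T (u m) = (c m)%:C *: u (tau m).

Lemma basis_ext x y : (forall k, ip x (u k) = ip y (u k)) -> x = y.
Proof.
move=> h; apply/eqP; rewrite -subr_eq0; apply/eqP/(orth_basis_eq0 (u := u)) => // k.
by rewrite ipBl h subrr.
Qed.

Lemma closed_spanT : closed_span ip (range u) = [set: H].
Proof. by apply/seteqP; split=> // x _; apply: cvg_oproj_span. Qed.

Lemma T_ip x y : ip (T x) y = ip x (Ts y).
Proof. by rewrite ipC -adjT -ipC. Qed.

Lemma adj_basis_tau m : Ts (u (tau m)) = (c m)%:C *: u m.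
Proof.
apply: basis_ext => k; rewrite adjT Tu ipZr ipZl !ou (inj_eq tau_inj).
case: eqVneq => [->|]; rewrite ?mulr0 // !mulr1.
by apply/eqP; rewrite eq_complex /= oppr0 !eqxx.
Qed.

Lemma adj_basis_notin k : (forall m, tau m <> k) -> Ts (u k) = 0.
Proof.
move=> hk; apply: basis_ext => m; rewrite adjT Tu ipZr ou ip0l.
by rewrite eq_sym; have /eqP/negbTE -> := hk m; rewrite mulr0.
Qed.

(** Neither T nor Ts is assumed linear or bounded. A vector is determined by its coordinates, and
    adjointness makes those of T x and Ts x linear in x. *)
Lemma T_linear : linear T.
Proof. by move=> a x y; apply: basis_ext => k; rewrite ipDl ipZl !T_ip ipDl ipZl. Qed.

Lemma Ts_linear : linear Ts.
Proof. by move=> a x y; apply: basis_ext => k; rewrite ipDl ipZl !adjT ipDl ipZl. Qed.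

Lemma T_coord_tau x m : ip (T x) (u (tau m)) = (c m)%:C * ip x (u m).
Proof.
rewrite T_ip adj_basis_tau ipZr; congr (_ * _).
by apply/eqP; rewrite eq_complex /= oppr0 !eqxx.
Qed.

Lemma T_coord_notin x k : (forall m, tau m <> k) -> ip (T x) (u k) = 0.
Proof. by move=> hk; rewrite T_ip adj_basis_notin // ip0r. Qed.

(** By Parseval: T moves coordinates injectively along tau and multiplies them by factors at most 1,
    and the coordinates outside the range of tau vanish. *)
Lemma T_contraction x : ipnorm ip (T x) <= ipnorm ip x.
Proof.
rewrite ipnorm_le ?ipnorm_ge0 // ipnorm_sq -lee_fin -!(parseval_esum ou (cu _)).
have [ot [tK otK]] := partial_inverse tau_inj.
rewrite -[leLHS]/(ssum (fun k => cabs (ip (T x) (u k)) ^+ 2)).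
rewrite (@ssum_option _ _ _ tau ot _ (fun m => cabs (ip (T x) (u (tau m))) ^+ 2) tK otK).
  apply: le_ssum => m; rewrite T_coord_tau cabsM exprMn cabsR ler_piMl ?sqr_ge0 //.
  by rewrite gtr0_norm // exprn_ile1 // ltW.
move=> k; have := otK k; case E: (ot k) => [m|] /=; first by move=> ->.
by move=> _; rewrite T_coord_notin ?cabs0 ?expr0n // => m mk; rewrite -mk tK in E.
Qed.

Lemma T_bounded : bounded_operator ip T.
Proof. by split; [exact: T_linear|exists 1 => x; rewrite mul1r T_contraction]. Qed.

(** The squared norm of Ts x is <x, T (Ts x)>, at most the norm of x times that of Ts x. *)
Lemma Ts_bounded : bounded_operator ip Ts.
Proof.
split; [exact: Ts_linear|exists 1 => x; rewrite mul1r].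
have h : nsq ip (Ts x) <= ipnorm ip x * ipnorm ip (Ts x).
  apply: (@le_trans _ _ (cabs (ip x (T (Ts x))))).
    by rewrite -adjT (le_trans (ler_norm _)) // ler_Re_cabs.
  apply: le_trans (ip_cauchy_schwarz _ _ _) _.
  by rewrite ler_wpM2l ?ipnorm_ge0 ?T_contraction.
have := ipnorm_ge0 ip (Ts x); rewrite le_eqVlt => /predU1P[<-|p]; first exact: ipnorm_ge0.
by rewrite -(ler_pM2r p) -expr2 ipnorm_sq.
Qed.

(** Cancelling tau on both sides ends at a starting point, which has no preimage, so both sides must
    be exhausted together. *)
Lemma orbit_inj i i' n n' : (forall m, tau m <> i) -> (forall m, tau m <> i') ->
  iter n tau i = iter n' tau i' -> i = i' /\ n = n'.
Proof.
move=> hi hi'; elim: n n' => [|n IH] [|n'] //=.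
- by move=> E; case: (hi (iter n' tau i')).
- by move=> E; case: (hi' (iter n tau i)).
- by move=> /tau_inj/IH[-> ->].
Qed.

(** Going backwards along tau strictly decreases the index and therefore stops, at an index without
    preimage. *)
Lemma orbit_exists m : exists p : nat * nat, (forall k, tau k <> p.1) /\ iter p.2 tau p.1 = m.
Proof.
elim/ltn_ind: m => m IH; have [[k km]|h] := pselect (exists k, tau k = m); last first.
  by exists (m, 0%N); split=> // k km; apply: h; exists k.
have [[i n] [hi hn]] := IH k (leq_trans (tau_gt k) (eq_leq km)).
by exists (i, n.+1); split=> //=; rewrite hn.
Qed.

Let orb i n := u (iter n tau i).

Lemma orbit_orthonormal i : (forall k, tau k <> i) ->
  forall m n, ip (orb i m) (orb i n) = (m == n)%:R.
Proof.
move=> hi m n; rewrite ou; congr (_%:R); congr nat_of_bool.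
by apply/eqP/eqP => [/(orbit_inj hi hi)[]|->].
Qed.

(** The summands are indexed by the numbers outside the range of tau, each being the start of
    exactly one orbit; the adjoint kills the first vector of an orbit, so the spans reduce T. *)
Lemma orbit_direct_sum (P : set H -> Prop) :
  (forall i, (forall k, tau k <> i) -> P (closed_span ip (range (orb i)))) ->
  direct_sum_of ip T Ts P.
Proof.
move=> hP; pose I := {i : nat | `[< forall k, tau k <> i >]}.
have Ii (i : I) : forall k, tau k <> val i by case: i => i /= /asboolP.
exists I, (fun i => closed_span ip (range (orb (val i)))); split.
- move=> i; split; first exact/closed_span_subspace/orbit_orthonormal.
  + move=> x; apply: closed_span_invariant; first exact: T_bounded.
    by move=> _ [n _ <-]; rewrite /orb Tu; apply: linear_span1; exists n.+1.
  + move=> x; apply: closed_span_invariant; first exact: Ts_bounded.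
    move=> _ [[|n] _ <-]; rewrite /orb /=; first by rewrite (adj_basis_notin (Ii i)); exact: linear_span0.
    by rewrite adj_basis_tau; apply: linear_span1; exists n.
- move=> i j ij x y Sx Sy; apply: closed_span_ip0 Sx => _ [m _ <-].
  rewrite ipC (closed_span_ip0 _ Sy) ?rmorph0 // => _ [n _ <-]; rewrite ou.
  case: eqP => // E; case: ij; apply: val_inj.
  by have [] := orbit_inj (Ii j) (Ii i) E.
- apply/seteqP; split=> // x _; exists (oproj ip u ^~ x); split=> // n.
  apply: (@linear_span_sum _ _ _ n (fun k => ip x (u k) *: u k)) => k; apply: linear_span1.
  have [[i m] [/= hi <-]] := orbit_exists k.
  have pi : `[< forall k, tau k <> i >] by apply/asboolP.
  by exists (exist _ i pi : I) => //; apply: closed_span_sub; exists m.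
- by move=> i; exact: hP.
Qed.

Lemma orbit_weighted_shift i : (forall k, tau k <> i) ->
  weighted_shift_in ip (closed_span ip (range (orb i))) T (orb i) (fun n => c (iter n tau i)).
Proof.
move=> hi; split.
- exact: T_bounded.
- by split=> //; exists 1.
- by split=> //; exact: orbit_orthonormal.
- by move=> n; rewrite /orb Tu.
Qed.

(** One normal extension serves all orbits at once: an index is coded by the start of its orbit and
    its position there, and translation of the position is a bijection of nat * int. *)
Lemma scaling_family_subnormalT : scaling_family c tau -> subnormal ip T.
Proof.
move=> sc; rewrite /subnormal -closed_spanT.
pose p m := sval (cid (orbit_exists m)).
have hp m : (forall k, tau k <> (p m).1) /\ iter (p m).2 tau (p m).1 = m by exact: svalP (cid (orbit_exists m)).
have pS m : p (tau m) = ((p m).1, (p m).2.+1).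
  have [h1 h2] := hp m; have [h1' h2'] := hp (tau m).
  rewrite -{3}h2 -iterS in h2'; have [E1 E2] := orbit_inj h1' h1 h2'.
  by rewrite [p _]surjective_pairing E1 E2.
apply: (@scaling_family_subnormal _ _ _ _ _ c tau (nat * int)%type
  (fun z => (z.1, z.2 + 1)) (fun z => (z.1, z.2 - 1)) (fun m => ((p m).1, Posz (p m).2))) => //.
- exact: T_bounded.
- by move=> [z1 z2] /=; rewrite addrK.
- by move=> [z1 z2] /=; rewrite subrK.
- move=> m n [E1 E2]; have [_ <-] := hp m; have [_ <-] := hp n; by rewrite E1 E2.
- by move=> m /=; rewrite pS -addn1 PoszD.
- by move=> m; exact: ltW.
Qed.

(** At the first vector of an orbit, killed by Ts, the quadratic form of T Ts - Ts T takes the value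
    -(c i)^2. *)
Lemma adj_not_hyponormal i : (forall k, tau k <> i) -> ~ hyponormal ip Ts T.
Proof.
move=> hi /(_ (u i)); rewrite adj_basis_notin // ipBl T_ip adj_basis_notin // ip0r sub0r.
rewrite adjT Tu ip_nsq -rmorphN lecR oppr_ge0 nsqZ cabsR => h.
have : nsq ip (u (tau i)) = 1 by rewrite /nsq ou eqxx.
move=> n1; rewrite n1 mulr1 real_normK ?num_real // in h.
by move: h; rewrite leNgt exprn_gt0.
Qed.

End OrbitDecomposition.

(** * The H-Toeplitz operator *)

Section HToeplitzWeights.
Variables (R : realType) (s d : nat).

Definition ht_weight m : R :=
  Num.sqrt ((m.+1 * (m + d).+1)%:R / (m + s).+1%:R ^+ 2).

Definition ht_tau m := (2 * (m + d))%N.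

Lemma ht_weightE m : ht_weight m =
  Num.sqrt (m + d).+1%:R * Num.sqrt m.+1%:R / (m + s).+1%:R.
Proof.
rewrite /ht_weight sqrtrM // natrM sqrtrM // sqrtrV ?exprn_ge0 // sqrtr_sqr ger0_norm //.
by congr (_ / _); rewrite mulrC.
Qed.

Lemma ht_tau_inj : injective ht_tau.
Proof. by move=> m n; rewrite /ht_tau; lia. Qed.

Lemma ht_tau_gt m : (0 < d)%N -> (m < ht_tau m)%N.
Proof. by rewrite /ht_tau; lia. Qed.

Lemma ht_tau_neq0 k : (0 < d)%N -> ht_tau k <> 0%N.
Proof. by rewrite /ht_tau; lia. Qed.

Lemma ht_weight_gt0 m : 0 < ht_weight m.
Proof. by rewrite sqrtr_gt0 divr_gt0 // exprn_gt0. Qed.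

Lemma ht_weight_sq m : ht_weight m ^+ 2 = (m.+1 * (m + d).+1)%:R / (m + s).+1%:R ^+ 2.
Proof. by rewrite sqr_sqrtr // divr_ge0 // exprn_ge0. Qed.

Lemma ht_weight_le1 m : (d <= s)%N -> ht_weight m <= 1.
Proof.
move=> ds; rewrite -(@ler_pXn2r _ 2) ?nnegrE ?(ltW (ht_weight_gt0 m)) // ht_weight_sq expr1n.
by rewrite ler_pdivrMr ?exprn_gt0 // mul1r -natrX ler_nat; nia.
Qed.

Hypotheses (hd : (0 < d)%N) (hs : (d <= s)%N).

Let A : R := 2 * d%:R - 1.
Let B' : R := d%:R - 1.
Let C : R := 2 * d%:R - s%:R - 1.
Let T m : R := (m%:R + 2 * d%:R)^-1.

Let d1 : 1 <= d%:R :> R. Proof. by rewrite ler1n. Qed.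
Let ds : d%:R <= s%:R :> R. Proof. by rewrite ler_nat. Qed.
Let B0 : 0 <= B'. Proof. by rewrite subr_ge0. Qed.
Let BA : B' <= A. Proof. by rewrite /A /B'; have := d1; lra. Qed.
Let CB : C <= B'. Proof. by rewrite /C /B'; have := ds; lra. Qed.
Let Tden m : 0 < m%:R + 2 * d%:R :> R. Proof. by rewrite ltr_wpDl // mulr_gt0 // ltr0n. Qed.
Let T0 m : 0 < T m. Proof. by rewrite invr_gt0. Qed.
Let AT m : A * T m < 1.
Proof. by rewrite ltr_pdivrMr // mul1r /A; have := ler0n R m; lra. Qed.
Let Ttau m : T (ht_tau m) = T m / 2.
Proof.
rewrite /T /ht_tau natrM natrD -invfM; congr (_^-1); ring.
Qed.
(** Origin of the constants: 1 - A T, 1 - B' T and 1 - C T are m + 1, m + d + 1 and m + s + 1, each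
    divided by m + 2d. *)
Let cT m : ht_weight m ^+ 2 = (1 - A * T m) * (1 - B' * T m) / (1 - C * T m) ^+ 2.
Proof.
rewrite ht_weight_sq natrM -[m.+1%:R]natr1 -[(m + d).+1%:R]natr1 -[(m + s).+1%:R]natr1 !natrD /A /B' /C /T.
have h := Tden m; have h' := ler0n R m; have h'' := ler0n R s.
move: (m%:R) (d%:R) (s%:R) h h' h'' => x y z h h' h''.
field; apply/andP; split; lra.
Qed.

Lemma ht_scaling_family : scaling_family ht_weight ht_tau.
Proof. exact: (scaling_family_half B0 BA CB T0 AT Ttau cT). Qed.

Lemma ht_scaling_family_powR (p : R) : 0 < p -> (s <= 3 * d - 2)%N ->
  scaling_family (fun m => ht_weight m `^ p) ht_tau.
Proof.
move=> p0 sd; apply: (scaling_family_powR B0 BA CB T0 AT Ttau cT p0).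
  (* As d is positive the truncated subtraction is exact, and the hypothesis is the inequality -B'
     <= C. *)
  have : (s + 2)%:R <= (3 * d)%:R :> R by rewrite ler_nat; lia.
  by rewrite natrD natrM /B' /C; lra.
by move=> m; exact/ltW/ht_weight_gt0.
Qed.

End HToeplitzWeights.

(** * Matrix coefficients of the H-Toeplitz operator *)

Section HToeplitzAdjoint.
Variable R : realType.
Local Notation plane := (measurableTypeR R * measurableTypeR R)%type.
Local Notation ip := (@bergman_ip R).
Local Notation ebas := (@Defs.basis R).

Lemma sqint_cmono (f : R[i] -> R[i]) (a c : nat) (x : R) :
  (forall z, `|z| < 1 -> f z = x%:C * (z ^+ a * z^* ^+ c)) -> square_integrable f.
Proof.
move=> hf; pose F (p : plane) : R[i] := x%:C * mono a c p.
have gF : dgood F by apply: dgoodM; [exact: dgood_cst|exact: dgood_mono].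
have fF p : @disc R p -> f (of_plane p) = F p by move=> pd; rewrite hf.
have mD := @measurable_disc R.
have [mR mI _] := gF; split.
- apply: (eq_measurable_fun (fun p => complex.Re (F p))); last exact: measurable_funTS.
  by move=> p; rewrite inE => pd /=; rewrite fF.
- apply: (eq_measurable_fun (fun p => complex.Im (F p))); last exact: measurable_funTS.
  by move=> p; rewrite inE => pd /=; rewrite fF.
- have h1 : 0 <= (1 : R) <= 1 by rewrite ler01 lexx.
  have [] := dgood_dintegrable h1 (dgoodM gF (dgood_conj gF)); rewrite discr1 => I1 _.
  apply: eq_integrable I1 => // p; rewrite inE => pd /=.
  by rewrite fF // ReM_conj /sqnorm !expr2.
Qed.

Variables (P : (R[i] -> R[i]) -> bergman R) (K : bergman R -> (R[i] -> R[i])).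
Hypotheses (hP : bergman_projection P) (hK : HToeplitz_K K).

Lemma projection_ip f (g : bergman R) : square_integrable f -> ip (P f) g = l2ip f g.
Proof.
move=> sf; have h := hP sf g.
have E : f \- P f = (-1) *: (P f : R[i] -> R[i]) + f.
  by apply/funext => z; rewrite -[RHS]/(-1 * P f z + f z) /= mulN1r addrC.
move: h; rewrite E l2ip_linl //; try exact: bergman_sqint.
by rewrite mulN1r addrC => /eqP; rewrite subr_eq0 => /eqP ->.
Qed.

Variables (s t d : nat).
Hypotheses (hd : (0 < d)%N) (hst : s = (t + d)%N).
Variables (B Bs : bergman R -> bergman R).
Hypothesis (hB : B = HToeplitz P K (fun z => z ^+ t * (z^* ) ^+ s)).
Hypothesis (hBs : adjoint ip B Bs).

Lemma ht_symbol_even n z : `|z| < 1 ->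
  z ^+ t * z^* ^+ s * K (ebas n.*2) z = (Num.sqrt n.+1%:R)%:C * (z ^+ (n + t) * z^* ^+ s).
Proof.
move=> z1; have [_ _ -> _] := hK; rewrite basisE // exprD.
by set w := z^* ^+ s; ring.
Qed.

Lemma ht_symbol_odd n z : `|z| < 1 ->
  z ^+ t * z^* ^+ s * K (ebas n.*2.+1) z =
  (Num.sqrt n.+2%:R)%:C * (z ^+ t * z^* ^+ (s + n.+1)).
Proof.
move=> z1; have [_ _ _ ->] := hK; rewrite basisE // [X in _ * X = _]conj_cmono exprD.
by set w := z^* ^+ s; set w' := z^* ^+ n.+1; ring.
Qed.

(** Pairing with z^m requires equal total degrees in z and its conjugate. For k = 2n + 1 this reads
    t = m + s + n + 1, impossible as t < s; for k = 2n it reads n + t = m + s, that is n = m + d. *)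
Lemma ht_coef k m : ip (B (ebas k)) (ebas m) = if k == ht_tau d m then (ht_weight R s d m)%:C else 0.
Proof.
rewrite hB /HToeplitz; have := odd_double_half k; case: (odd k) => /= Ek; rewrite -Ek; move: (k./2) => n.
  rewrite add1n projection_ip; last by apply: sqint_cmono => z; exact: ht_symbol_odd.
  rewrite (l2ip_cmono (ht_symbol_odd n) (basisE m)) ifF; last by apply/eqP; lia.
  by rewrite ifF //; apply/eqP => /(congr1 odd); rewrite /ht_tau oddM /= odd_double.
rewrite add0n projection_ip; last by apply: sqint_cmono => z; exact: ht_symbol_even.
rewrite (l2ip_cmono (ht_symbol_even n) (basisE m)) /ht_tau mul2n.
rewrite (inj_eq double_inj) (_ : (n + t == m + s)%N = (n == m + d)%N); last by apply/eqP/eqP; lia.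
by case: eqP => // ->; rewrite ht_weightE; congr ((_ / _%:R)%:C); lia.
Qed.

Lemma ht_adjoint_basis m : Bs (ebas m) = (ht_weight R s d m)%:C *: ebas (ht_tau d m).
Proof.
have ext := basis_ext (ip := ip) (@bergman_oproj_cvg R).
apply: ext => k.
have E1 : ip (Bs (ebas m)) (ebas k) = if k == ht_tau d m then (ht_weight R s d m)%:C else 0.
  transitivity ((ip (B (ebas k)) (ebas m))^*); first by rewrite hBs; exact: (ipC ip).
  rewrite ht_coef; case: eqP => _; last by rewrite rmorph0.
  by apply/eqP; rewrite eq_complex /= oppr0 !eqxx.
have E2 : ip ((ht_weight R s d m)%:C *: ebas (ht_tau d m)) (ebas k) =
    if k == ht_tau d m then (ht_weight R s d m)%:C else 0.
  transitivity ((ht_weight R s d m)%:C * ip (ebas (ht_tau d m)) (ebas k)); first exact: (ipZl ip).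
  by rewrite basis_orthonormal eq_sym; case: eqP => _; rewrite ?mulr1 ?mulr0.
exact: etrans E1 (esym E2).
Qed.

End HToeplitzAdjoint.

Theorem theorem1p9 (R : realType)
    (P : (R[i] -> R[i]) -> bergman R) (hP : bergman_projection P)
    (K : bergman R -> (R[i] -> R[i])) (hK : HToeplitz_K K)
    (s t d : nat) (hs : (0 < s)%N) (hd : (0 < d)%N) (hst : s = (t + d)%N)
    (B Bs : bergman R -> bergman R)
    (hB : B = HToeplitz P K (fun z => z ^+ t * (z^* ) ^+ s))
    (hBs : adjoint (@bergman_ip R) B Bs) :
  ((s <= 3 * d - 2)%N ->
     direct_sum_of (@bergman_ip R) Bs B
       (fun S => MID_shift (@bergman_ip R) S Bs)) /\
  (direct_sum_of (@bergman_ip R) Bs B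
     (fun S => weighted_shift (@bergman_ip R) S Bs /\
               subnormal_in (@bergman_ip R) S Bs) /\
   subnormal (@bergman_ip R) Bs) /\
  ~ hyponormal (@bergman_ip R) B Bs.
Proof.
have ou := @basis_orthonormal R; have cu := @bergman_oproj_cvg R.
have ds : (d <= s)%N by rewrite hst leq_addl.
have ti := @ht_tau_inj d; have tg m := ht_tau_gt m hd.
have c0 := ht_weight_gt0 R s d; have c1 m := ht_weight_le1 R m ds.
have Tu := ht_adjoint_basis hP hK hd hst hB hBs.
have sc := ht_scaling_family R hd ds.
split; [move=> sd|split; [split|]].
- apply: (orbit_direct_sum ou cu ti tg c0 c1 hBs Tu) => i hi.
  have ws := orbit_weighted_shift ou cu ti c0 c1 hBs Tu hi.
  exists (fun n => Defs.basis R (iter n (ht_tau d) i)), (fun n => ht_weight R s d (iter n (ht_tau d) i)); split=> //.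
  (* A scaling family depends on the weights alone, so it applies to any shift on any space having
     these weights to the power p. *)
  move=> p p0 H ipH W u _ wsW.
  apply: (scaling_family_subnormal_shift wsW).
  exact: (scaling_family_orbit i (ht_scaling_family_powR hd ds p0 sd)).
- apply: (orbit_direct_sum ou cu ti tg c0 c1 hBs Tu) => i hi.
  have ws := orbit_weighted_shift ou cu ti c0 c1 hBs Tu hi.
  split; first by exists (fun n => Defs.basis R (iter n (ht_tau d) i)), (fun n => ht_weight R s d (iter n (ht_tau d) i)).
  exact: scaling_family_subnormal_shift ws (scaling_family_orbit i sc).
- exact: (scaling_family_subnormalT ou cu ti tg c0 c1 hBs Tu sc).
- exact: (adj_not_hyponormal ou cu c0 hBs Tu (fun k => @ht_tau_neq0 d k hd)).
Qed.
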